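(* Let $S$ be a connected graph other than $P_3$. Then the implication ''for every 2-connected claw-$f$-heavy graph $G$, if $G$ is $S$-free then $G$ is Hamiltonian'' holds if and only if (up to isomorphism) $S$ is one of $P_4,P_5,P_6,C_3,Z_1,Z_2,B,N,W$.
   Context: All graphs are finite and simple. $d(v)$ denotes the degree of $v$ in $G$, and $d_{G'}(u,v)$ denotes the distance between $u$ and $v$ in a graph $G'$. A graph is Hamiltonian if it has a cycle through all its vertices. $G$ is $S$-free if it contains no induced subgraph isomorphic to $S$. $f$-heavy: Let $G$ be a graph on $n$ vertices. For a given graph $H$, $G$ is $H$-$f$-heavy if for every induced subgraph $G'$ of $G$ isomorphic to $H$ and every two vertices $u,v\in V(G')$, $d_{G'}(u,v)=2$ implies $\max\{d(u),d(v)\}\geq n/2$ (degrees taken in $G$). Claw-$f$-heavy means $K_{1,3}$-$f$-heavy. Particular graphs: $P_i$ is the path on $i$ vertices; $C_3$ is the triangle; $Z_i$ is obtained from a triangle by attaching a path with $i$ edges at one of its vertices; $B$ (bull) is obtained from a triangle by attaching one pendant edge at each of two of its vertices; $N$ (net) is obtained from a triangle by attaching one pendant edge at each of its three vertices; $W$ (wounded) has vertices $a_1,a_2,a_3,b_1,b_2,c_1$ and edges $a_1a_2,a_2a_3,a_3a_1,a_1b_1,b_1c_1,a_2b_2$.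
   Formalization: S is assumed to have at least 3 vertices: for the one-vertex graph and the single edge, no 2-connected graph is S-free, so the implication holds vacuously although these graphs are not in the list. *)

(* Defs.v *)
From mathcomp Require Import all_boot.

Set Implicit Arguments.
Unset Strict Implicit.
Unset Printing Implicit Defensive.

Record sgraph := SGraph {
  vertex :> finType;
  adj : rel vertex;
  adj_sym : symmetric adj;
  adj_irrefl : irreflexive adj }.

Arguments adj {G} : rename.

Definition isomorphic (G H : sgraph) : Prop :=
  exists2 f : G -> H, bijective f & forall x y, adj (f x) (f y) = adj x y.

Section Induced.
Variables (G : sgraph) (A : {set G}).

Definition induced_adj : rel {x : G | x \in A} :=
  fun x y => adj (val x) (val y).

Lemma induced_adj_sym : symmetric induced_adj.
Proof. by move=> x y; apply: adj_sym. Qed.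

Lemma induced_adj_irrefl : irreflexive induced_adj.
Proof. by move=> x; apply: adj_irrefl. Qed.

Definition induced : sgraph := SGraph induced_adj_sym induced_adj_irrefl.
End Induced.

Definition is_free (S G : sgraph) : Prop :=
  ~ exists A : {set G}, isomorphic (induced A) S.

Definition degree (G : sgraph) (v : G) : nat := #|[set w | adj v w]|.

(* [p] lists the vertices of the walk after its first vertex [u], so
   [size p] is the number of edges. *)
Definition is_walk (G : sgraph) (u v : G) (p : seq G) : Prop :=
  path adj u p /\ last u p = v.

(* "The distance between [u] and [v] is [k]"; no [k] satisfies this when [u]
   and [v] lie in different components. *)
Definition distance_is (G : sgraph) (u v : G) (k : nat) : Prop :=
  (exists2 p, is_walk u v p & size p = k) /\
  (forall p, is_walk u v p -> k <= size p).

Definition connected (G : sgraph) : Prop :=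
  0 < #|G| /\ forall x y : G, connect adj x y.

(* Deleting the vertices of [X] leaves the subgraph induced on [~: X].  The
   complete graph on k vertices is not k-connected. *)
Definition k_connected (k : nat) (G : sgraph) : Prop :=
  k < #|G| /\ forall X : {set G}, #|X| < k -> connected (induced (~: X)).

(* [3 <= size c] rules out the degenerate closed walks on at most two
   vertices, which [ucycle] accepts. *)
Definition hamiltonian (G : sgraph) : Prop :=
  exists c : seq G, [/\ ucycle adj c, 3 <= size c & forall x, x \in c].

(* [max (d(u), d(v)) >= n / 2] is stated without division, the bound being
   n / 2 exactly and not its integer part.  Degrees are those in [G], whereas
   the distance is that in the induced subgraph. *)
Definition f_heavy (H G : sgraph) : Prop :=
  forall A : {set G}, isomorphic (induced A) H ->
  forall u v : induced A, distance_is u v 2 ->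
  #|G| <= 2 * maxn (degree (val u)) (degree (val v)).

Section EdgeList.
Variables (n : nat) (E : seq (nat * nat)).

Definition edge_list_adj : rel 'I_n := fun i j =>
  (i != j) && (((i : nat, j : nat) \in E) || ((j : nat, i : nat) \in E)).

Lemma edge_list_adj_sym : symmetric edge_list_adj.
Proof. by move=> i j; rewrite /edge_list_adj eq_sym orbC. Qed.

Lemma edge_list_adj_irrefl : irreflexive edge_list_adj.
Proof. by move=> i; rewrite /edge_list_adj eqxx. Qed.

(* The graph on {0, ..., n-1} whose edges are the pairs listed in [E]. *)
Definition edge_list_graph : sgraph :=
  SGraph edge_list_adj_sym edge_list_adj_irrefl.
End EdgeList.

Definition triangle : seq (nat * nat) := [:: (0, 1); (1, 2); (2, 0)].

Definition claw : sgraph := edge_list_graph 4 [:: (0, 1); (0, 2); (0, 3)].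

Definition pathG (i : nat) : sgraph :=
  edge_list_graph i [seq (j, j.+1) | j <- iota 0 i.-1].

Definition C3 : sgraph := edge_list_graph 3 triangle.

(* The path with [i] edges attached to the triangle is 2, 3, ..., i + 2. *)
Definition Z (i : nat) : sgraph :=
  edge_list_graph (i + 3) (triangle ++ [seq (j, j.+1) | j <- iota 2 i]).

Definition bull : sgraph :=
  edge_list_graph 5 (triangle ++ [:: (0, 3); (1, 4)]).

Definition net : sgraph :=
  edge_list_graph 6 (triangle ++ [:: (0, 3); (1, 4); (2, 5)]).

(* a1, a2, a3, b1, b2, c1 are 0, 1, 2, 3, 4, 5. *)
Definition wounded : sgraph :=
  edge_list_graph 6 (triangle ++ [:: (0, 3); (3, 5); (1, 4)]).

(* Main.v *)
(* For the forward implication, the graphs P_TTT and P_333, obtained by joining two triangles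
   by three triangles and by three paths respectively, are 2-connected, claw-free and
   non-Hamiltonian, so S is induced in both; a finite search over the induced subgraphs of
   P_TTT leaves only the listed graphs.

   Conversely, let g be a non-Hamiltonian 2-connected claw-f-heavy graph.  Joining heavy
   vertices (Bondy-Chvatal) and completing connected neighbourhoods (Ryjacek) keeps it
   non-Hamiltonian and ends in a claw-free graph e in which adjacency is transitive inside
   every neighbourhood, so that each neighbourhood consists of at most two cliques.  In e
   take a cycle with an ear whose vertex set carries no spanning cycle, of minimal order and
   then with the shortest ear: the two ends of the ear then carry an induced P_6, net and
   wounded graph.  Every edge x y of e is refined to a path of g inside the closed common
   neighbourhood of x and y, and with some care at the clique that contains several heavy
   vertices this pulls the three patterns back to g.  The other listed graphs are induced
   subgraphs of these three. *)

From mathcomp Require Import all_boot.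
From mathcomp Require Import zify.
From Stdlib Require Import ArithRing Classical.
Require Import Defs.

Set Implicit Arguments.
Unset Strict Implicit.
Unset Printing Implicit Defensive.

(** * Hamiltonian cycles and the Bondy-Chvatal closure *)

(** A claw-f-heavy graph may contain claws, but two leaves of each are heavy and hence adjacent in
    [heavy_join], where all heavy pairs are joined. The rerouting behind a completion therefore uses
    [heavy_join] edges, and Bondy-Chvatal removes them afterwards. A heavy pair is joined for good
    only when no neighbourhood can be completed any more: this is what rules out new claws with two
    light leaves.

    The obstacle in the pull-back is that g itself has claws. Let z lie in a maximal clique of e and
    have a neighbour outside. Two non-adjacent g-neighbours of z in the clique must then both be
    heavy. Heavy vertices are pairwise adjacent in e, and two maximal cliques of e share at most one
    vertex, so every maximal clique but one behaves as in a claw-free graph. The cliques at the two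
    ends of the ear differ, so one of them is good; only the wounded graph can need a triangle
    elsewhere, namely when the ends of the ear are adjacent in g. *)

Ltac perm_count :=
  apply/permP => ?; rewrite /= -?cats1 /= ?(count_cat, count_rev) /=
    ?(count_cat, count_rev) /= -?plusE; ring.

Section Lists.
Variable T : eqType.
Implicit Types (e : rel T) (s : seq T).

Lemma rev_path_sym e x s : symmetric e ->
  path e (last x s) (rev (belast x s)) = path e x s.
Proof. by move=> se; rewrite rev_path; apply: eq_path => y z; rewrite se. Qed.

Lemma last_rev_cons (x y : T) s : last y (rev (x :: s)) = x.
Proof. by rewrite rev_cons last_rcons. Qed.

(** The number of non-edges along a walk is the measure that decreases in both rerouting arguments,
    [bondy_chvatal] and [two_opt]. *)
Fixpoint misses e x s : nat :=
  if s is y :: s' then ~~ e x y + misses e y s' else 0.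

Lemma misses_cat e x s1 s2 :
  misses e x (s1 ++ s2) = misses e x s1 + misses e (last x s1) s2.
Proof. by elim: s1 x => //= y s1 IH x; rewrite IH addnA. Qed.

Lemma misses_rev e x s : symmetric e ->
  misses e (last x s) (rev (belast x s)) = misses e x s.
Proof.
move=> se; elim: s x => //= y s IH x.
rewrite rev_cons -cats1 misses_cat IH /= addn0.
have -> : last (last y s) (rev (belast y s)) = y.
  by case: s {IH} => //= z s; rewrite rev_cons last_rcons.
by rewrite se addnC.
Qed.

Lemma misses0 e x s : (misses e x s == 0) = path e x s.
Proof. by elim: s x => //= y s IH x; rewrite addn_eq0 IH eqb0 negbK. Qed.

Lemma misses_split e x s : misses e x s != 0 ->
  exists s1 b s2, s = s1 ++ b :: s2 /\ ~~ e (last x s1) b.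
Proof.
elim: s x => //= y s IH x; case: (boolP (e x y)) => /= [_|nxy _].
  by case/IH => s1 [b [s2 [-> nb]]]; exists (y :: s1), b, s2.
by exists [::], y, s.
Qed.

(** Ore's counting: the steps that start in [P] and the steps that end in [Q] together outnumber all
    steps, so some step does both. *)
Lemma count_pigeonhole (P Q : pred T) x s :
  size s < count P (belast x s) + count Q s ->
  exists s1 b s2, [/\ s = s1 ++ b :: s2, P (last x s1) & Q b].
Proof.
elim: s x => //= b s IH x lt.
case: (boolP (P x && Q b)) => [/andP[Px Qb]|nPQ]; first by exists [::], b, s.
have /IH[s1 [c [s2 [-> Pc Qc]]]]: size s < count P (belast b s) + count Q s.
  by move: nPQ lt; case: (P x); case: (Q b) => //=; lia.
by exists (b :: s1), c, s2.
Qed.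

Lemma path_clique e x s : {in x :: s &, forall y z, y != z -> e y z} ->
  uniq (x :: s) -> path e x s.
Proof.
elim: s x => //= y s IH x cl; rewrite inE negb_or => /andP[/andP[xy _] us].
rewrite cl ?inE ?eqxx ?orbT //=; apply: IH => // a b ha hb.
by apply: cl; rewrite inE ?ha ?hb orbT.
Qed.

End Lists.

Section Hamilton.
Variable T : finType.
Implicit Types (e E : rel T) (s : seq T).

Definition ham e := exists c : seq T, [/\ ucycle e c, 3 <= size c & forall x, x \in c].

Definition deg e v := #|[set w | e v w]|.

Lemma ham_cons e : ham e <-> exists x s, [/\ path e x (rcons s x), uniq (x :: s),
  1 < size s & forall y, y \in x :: s].
Proof.
split=> [[[|x s] [uc sz al]]|[x [s [p u sz al]]]] //.
  by case/andP: uc => p u; exists x, s.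
by exists (x :: s); split=> //; apply/andP.
Qed.

Lemma deg_count e x s : uniq s -> (forall y, e x y -> y \in s) -> deg e x = count (e x) s.
Proof.
move=> us al; rewrite /deg -size_filter -(card_uniqP (filter_uniq _ us)).
by apply: eq_card => y; rewrite inE mem_filter; case exy: (e x y) => //=; rewrite al.
Qed.

(* The non-[e] edges are pulled out of a Hamiltonian cycle one at a time. *)
Lemma bondy_chvatal e E : symmetric e -> symmetric E -> subrel e E ->
  (forall x y, x != y -> E x y -> e x y \/ #|T| <= deg e x + deg e y) ->
  irreflexive e -> ham E -> ham e.
Proof.
move=> se sE sub hE ir /ham_cons[x [s [p u sz al]]].
move: {2}(misses e x (rcons s x)) (leqnn (misses e x (rcons s x))) => k.
elim: k x s p u sz al => [|k IH] x s p u sz al lek.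
  apply/ham_cons; exists x, s; split=> //.
  by rewrite -misses0 -leqn0.
case: (boolP (misses e x (rcons s x) == 0)) => [|m0].
  by rewrite misses0 => pe; apply/ham_cons; exists x, s.
(* Rotating the cycle makes a non-[e] edge the closing one, from the last vertex back to [x]. *)
wlog nlx : x s p u sz al lek m0 / ~~ e (last x s) x.
  move=> W; case: (boolP (e (last x s) x)) => [elx|]; last exact: W.
  case: (misses_split m0) => s1 [b [s2 [es nb]]].
  have [s2' e2] : exists s2', s2 = rcons s2' x.
    case: (lastP s2) es => [|s2' z]; last first.
      by rewrite -rcons_cons -rcons_cat => /rcons_inj[_ ->]; exists s2'.
    rewrite cats1 => /rcons_inj[E1 E2]; move: nb elx.
    by rewrite -E1 -E2 => /negP.
  have e1 : s = s1 ++ b :: s2'.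
    by move: es; rewrite e2 -rcons_cons -rcons_cat => /rcons_inj[].
  have pm : perm_eq (b :: s2' ++ x :: s1) (x :: s).
    by rewrite e1 -cat_cons perm_catC.
  have mE : misses e b (rcons (s2' ++ x :: s1) b) = misses e x (rcons s x).
    rewrite e1 -!cats1 -!catA /= !misses_cat /= !misses_cat /=.
    by rewrite !addn0; lia.
  apply: (W b (s2' ++ x :: s1)).
  - move: p; rewrite e1 -!cats1 -!catA /= !cat_path /= !cat_path /= !andbT.
    by case/and4P=> -> -> -> ->.
  - by rewrite -/(_ ++ _) -cat_cons (perm_uniq pm).
  - by have := perm_size pm; rewrite /= => -[->].
  - by move=> y; rewrite -cat_cons (perm_mem pm).
  - by rewrite mE.
  - by rewrite mE.
  - by rewrite last_cat.
set y := last x s in nlx.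
have xy : x != y.
  rewrite /y; case: (s) sz u => //= b s' _ /andP[nx _].
  by apply: contraNneq nx => ->; rewrite mem_last.
have Exy : E x y by move: p; rewrite rcons_path sE => /andP[].
have [|dxy] := hE _ _ xy Exy; first by rewrite se (negbTE nlx).
have ux : uniq s by case/andP: u.
have lcx : #|T| = (size s).+1.
  by rewrite -[RHS]/(size (x :: s)) -(card_uniqP u); apply/eq_card => z; rewrite al inE.
have dx : deg e x = count (e x) s.
  apply: deg_count => // z exz; move: (al z); rewrite inE => /orP[/eqP zx|//].
  by rewrite zx ir in exz.
have dy : deg e y = count (e y) (belast x s).
  apply: deg_count; first by move: u; rewrite lastI rcons_uniq => /andP[].
  move=> z eyz; move: (al z); rewrite lastI mem_rcons inE => /orP[/eqP zx|//].
  by rewrite zx ir in eyz.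
have /count_pigeonhole[s1 [b [s2 [es eys exb]]]] :
  size s < count (e y) (belast x s) + count (e x) s by rewrite -dx -dy -lcx addnC.
have yE : y = last b s2 by rewrite /y es last_cat.
have rb : rev (b :: s2) = y :: rev (belast b s2) by rewrite lastI rev_rcons yE.
have pm : perm_eq (x :: s1 ++ rev (b :: s2)) (x :: s).
  by rewrite es perm_cons perm_cat2l perm_rev.
have lr : last y (rev (belast b s2)) = b.
  rewrite yE; case: (s2) => //= c s'; by rewrite rev_cons last_rcons.
(* Ore's exchange: the closing edge [y x] and the step into [b] give way to two [e]-edges, from
   [last x s1] to [y] and from [b] to [x]. *)
apply: (IH x (s1 ++ rev (b :: s2))).
- move: p; rewrite es rcons_cat /= cat_path /= rcons_path => /and4P[p1 _ p2 _].
  rewrite rb rcons_cat /= cat_path /= rcons_path p1 lr sub ?[e _ y]se //=.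
  by rewrite yE (rev_path_sym _ _ sE) p2 sE sub.
- by rewrite (perm_uniq pm).
- by have := perm_size pm => -[->].
- by move=> z; rewrite (perm_mem pm).
have : misses e x (rcons (s1 ++ rev (b :: s2)) x) < misses e x (rcons s x).
  rewrite es -!cats1 -!catA !misses_cat /= -yE.
  rewrite rb /= lr [e _ y]se eys [e b x]se exb /= yE (misses_rev _ _ se) -yE nlx.
  by rewrite !addn0 /= add0n ltn_add2l addn1 ltnS leq_addl.
by move=> lt; rewrite -ltnS (leq_trans lt).
Qed.

End Hamilton.

(** * Completing a connected neighbourhood *)

Section LocalCompletion.
(** The section is applied with [heavy_join e] as [E]. Its hypotheses are what claw-heaviness yields
    at [w] and at the neighbours of [w] in place of claw-freeness, together with the connectedness
    of the neighbourhood. *)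
Variables (T : finType) (e E : rel T) (w : T).
Hypotheses (se : symmetric e) (ire : irreflexive e) (sE : symmetric E)
  (sub : subrel e E).
Hypothesis alpha2 : forall x y z, e w x -> e w y -> e w z ->
  x != y -> x != z -> y != z -> [|| E x y, E x z | E y z].
Hypothesis clawless : forall g a b, e w g -> e g a -> e g b ->
  a != b -> a != w -> b != w -> ~~ E w a -> ~~ E w b -> E a b.
Hypothesis nbhd_conn : forall P : pred T,
  (exists2 x, e w x & P x) -> (exists2 y, e w y & ~~ P y) ->
  exists x y, [/\ e w x, e w y, P x, ~~ P y & E x y].

(* A Hamiltonian cycle of [E] plus the clique on the neighbours of [w] is cut at [w] and
   rerouted along [m]. *)
Let m x y := E x y && ((e w x (+) e w y) ==> e x y).

Let m_sym : symmetric m.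
Proof. by move=> x y; rewrite /m [E x y]sE [e x y]se addbC. Qed.

Let mE : subrel m E. Proof. by move=> x y; rewrite /m => /andP[]. Qed.

Definition good_path g s := exists L,
  [/\ perm_eq (g :: L) s, path E g L & E w (last g L)].

(** The cycle leaves [w] for the far end of the first path, follows it back to [g], crosses to [g']
    and returns to [w] from the far end of the second path. *)
Lemma cross g g' s s' : good_path g s -> good_path g' s' -> E g g' ->
  uniq (w :: s ++ s') -> (forall y, y \in w :: s ++ s') -> ham E.
Proof.
move=> [L [pL PL wL]] [L' [pL' PL' wL']] gg' u al; apply/ham_cons.
exists w, (rev (g :: L) ++ g' :: L').
have pm : perm_eq (w :: rev (g :: L) ++ g' :: L') (w :: s ++ s').
  by rewrite perm_cons perm_cat // perm_rev.
split; last 1 first.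
- by move=> y; rewrite (perm_mem pm).
- have lr z : last z (rev (g :: L)) = g by rewrite last_rev_cons.
  rewrite rcons_cat cat_path lr /= gg' rcons_path PL' sE wL' andbT /= andbT.
  rewrite lastI rev_rcons /= wL.
  by have := rev_path_sym g L sE; rewrite PL.
- by rewrite (perm_uniq pm).
- by rewrite size_cat size_rev /= addnS ltnS addSn.
Qed.

(** The ends coincide or are adjacent, so the path closes up to an [E]-cycle. Opening this cycle at
    [g], next to a neighbour of [g] that [w] sees, gives a good path. If [w] sees neither neighbour
    of [g], these two are adjacent and [g] can be bypassed. *)
Lemma detour a X g : path m a X -> uniq (a :: X) -> w \notin a :: X ->
  e w a -> e w (last a X) -> (a == last a X) || E a (last a X) ->
  g \in a :: X -> e w g ->
  good_path g (a :: X) \/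
  exists l1 c l2, X = l1 ++ g :: c :: l2 /\ E (last a l1) c
    /\ ~~ E w (last a l1) /\ ~~ E w c.
Proof.
move=> p u wX wa wl cl; rewrite inE => /orP[/eqP-> _|gX wg].
  by left; exists X; split=> //; [apply: sub_path p|apply: sub].
have agl l1 l2 : X = l1 ++ g :: l2 -> a != last g l2.
  move=> EX; apply: contraTneq u => ->; rewrite EX /= mem_cat negb_and negbK.
  by rewrite mem_last orbT.
case/splitPr: gX p u wX wl cl agl => l1 l2.
case: l2 => [|c l2] p u wX wl cl agl.
  left; exists (rev (a :: l1)).
  move: wl cl p; rewrite !last_cat /= cat_path /= andbT => wl cl /andP[p1 pg].
  split.
  - by rewrite -rev_rcons perm_rev /= cats1.
  - rewrite lastI rev_rcons /= sE mE //.
    by rewrite (rev_path_sym _ _ sE) (sub_path mE p1).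
  - by rewrite last_rev_cons sub.
have /= agl' := agl _ _ erefl.
move: wl cl p; rewrite !last_cat /= cat_path /= => wl cl /and4P[p1 pg gc pc].
have Eal : E a (last c l2) by move: cl; rewrite (negbTE agl').
case: (boolP (E w c)) => [wc|nwc].
  left; exists (rev (a :: l1) ++ rev (c :: l2)); split.
  - by perm_count.
  - rewrite cat_path last_rev_cons (lastI a) (lastI c) !rev_rcons /=.
    have P1 := sub_path mE p1; have P2 := sub_path mE pc.
    by rewrite Eal !(rev_path_sym _ _ sE) P1 P2 sE mE.
  - by rewrite last_cat last_rev_cons.
case: (boolP (E w (last a l1))) => [wp|nwp].
  left; exists (c :: l2 ++ a :: l1); split.
  - by perm_count.
  - have P1 := sub_path mE p1; have P2 := sub_path mE pc.
    by rewrite /= cat_path /= P1 P2 [E (last c l2) a]sE Eal mE.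
  - by rewrite /= last_cat.
right; exists l1, c, l2; split=> //; split=> //.
have nbc : e w c = false by apply: contraNF nwc; apply: sub.
have nbp : e w (last a l1) = false by apply: contraNF nwp; apply: sub.
have ne z : z \in a :: l1 ++ g :: c :: l2 -> z != w.
  by move=> hz; apply: contraNneq wX => <-.
(* An [m]-edge that leaves the [e]-neighbourhood of [w] is an [e]-edge; this is where the second
   clause of [m] is used. *)
apply: (@clawless g) => //.
- by rewrite se; case/andP: pg; rewrite wg nbp.
- by case/andP: gc; rewrite wg nbc.
- move: u; rewrite -cat_cons cat_uniq => /and3P[_ /hasPn H _].
  apply: contraTneq (mem_last a l1) => ->; apply: H.
  by rewrite !inE eqxx orbT.
- by apply: ne; rewrite -cat_cons mem_cat mem_last.
- by apply: ne; rewrite -cat_cons mem_cat !inE eqxx !orbT.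
Qed.

Definition two_paths a X b Y :=
  [/\ [/\ path m a X, path m b Y, uniq (w :: (a :: X) ++ b :: Y) &
        forall y, y \in w :: (a :: X) ++ b :: Y],
      [/\ e w a, e w (last a X), e w b & e w (last b Y)],
      (a == last a X) || E a (last a X), (b == last b Y) || E b (last b Y) &
      [/\ ~~ E a b, ~~ E (last a X) b & ~~ E a (last b Y)]].

Lemma two_pathsC a X b Y : two_paths a X b Y -> two_paths b Y a X.
Proof.
case=> -[p1 p2 u al] [h1 h2 h3 h4] c1 c2 [n1 n2 n3].
have pm : perm_eq (w :: (b :: Y) ++ a :: X) (w :: (a :: X) ++ b :: Y).
  by rewrite perm_cons perm_catC.
split=> //; last by rewrite ![E b _]sE [E (last b Y) _]sE.
by split=> //; [rewrite (perm_uniq pm)|move=> y; rewrite (perm_mem pm)].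
Qed.

Let misplaced a := fun g => [&& e w g, ~~ E g a & g != a].

(** By [alpha2], applied to [g], [a] and either end of the second path, [g] is adjacent to both of
    these ends. So either [detour] opens the first path at [g] and [cross] applies, or [g] is
    bypassed there and appended to the second path, where it is no longer misplaced. *)
Lemma move_misplaced a X b Y g : two_paths a X b Y -> g \in X -> misplaced a g ->
  ham E \/ exists X' Y', two_paths a X' b Y' /\
    count (misplaced a) X' + count (misplaced b) Y' <
    count (misplaced a) X + count (misplaced b) Y.
Proof.
case=> -[p1 p2 u al] [h1 h2 h3 h4] c1 c2 [n1 n2 n3] gX mg.
have /and3P[wg nga ga] := mg.
have uu : uniq ((a :: X) ++ b :: Y) by case/andP: u.
have wX : w \notin a :: X.
  by move: u; rewrite cons_uniq mem_cat negb_or => /andP[/andP[]].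
have uX : uniq (a :: X) by move: uu; rewrite cat_uniq => /andP[].
have disj z : z \in a :: X -> z \in b :: Y -> False.
  move=> zX zY; move: uu; rewrite cat_uniq => /and3P[_ /hasPn H _].
  by move: (H _ zY); rewrite zX.
have gX' : g \in a :: X by rewrite inE gX orbT.
have gb : g != b by apply: contraPneq (@disj g gX') => ->; rewrite inE eqxx; auto.
have ab : a != b by apply: contraPneq (@disj a) => ->; rewrite !inE eqxx; auto.
have Egb : E g b.
  have := alpha2 wg h1 h3 ga gb ab.
  by rewrite (negbTE nga) (negbTE n1) /= orbF.
have [gp|[l1 [c [l2 [EX [Elc [nwl nwc]]]]]]] := detour p1 uX wX h1 h2 c1 gX' wg.
  left; apply: (cross gp _ Egb u al).
  by exists Y; split=> //; [apply: sub_path p2 => x y /mE|apply: sub].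
right; exists (l1 ++ c :: l2), (rcons Y g).
have mgb : misplaced b g = false by rewrite /misplaced Egb andbF.
split; last first.
  rewrite EX -cats1 !count_cat /= mg mgb.
  by rewrite !addn0 ltn_add2r ltn_add2l add1n.
have gl : g != last b Y.
  by apply: contraPneq (@disj g gX') => ->; rewrite mem_last; auto.
have al' : a != last b Y.
  by apply: contraPneq (@disj a) => ->; rewrite mem_last inE eqxx; auto.
have Egl : E g (last b Y).
  have := alpha2 wg h1 h4 ga gl al'.
  by rewrite (negbTE nga) (negbTE n3) /= orbF.
have lX : last a (l1 ++ c :: l2) = last a X by rewrite EX !last_cat.
have pm : perm_eq (w :: (a :: l1 ++ c :: l2) ++ b :: rcons Y g)
                  (w :: (a :: X) ++ b :: Y).
  by rewrite EX; perm_count.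
split.
- split.
  + move: p1; rewrite EX !cat_path /= => /and4P[-> _ _ ->].
    rewrite /m Elc.
    have -> : e w (last a l1) = false by apply: contraNF nwl; apply: sub.
    by have -> : e w c = false by apply: contraNF nwc; apply: sub.
  + by rewrite rcons_path p2 /= /m sE Egl h4 wg.
  + by rewrite (perm_uniq pm).
  + by move=> y; rewrite (perm_mem pm).
- by rewrite lX last_rcons.
- by rewrite lX.
- by rewrite last_rcons sE Egb orbT.
- by rewrite lX last_rcons [E a g]sE.
Qed.

(** Once nothing is misplaced, every [e]-neighbour of [w] starts a good path of its side: if
    [detour] bypasses it, it is put in front of the first vertex instead. Connectedness of the
    neighbourhood then supplies an edge for [cross]. *)
Lemma two_paths_ham a X b Y : two_paths a X b Y -> ham E.
Proof.
move: {2}(count (misplaced a) X + count (misplaced b) Y).+1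
  (ltnSn (count (misplaced a) X + count (misplaced b) Y)) => k.
elim: k a X b Y => [//|k IH] a X b Y lek tp.
have [/hasP[g gX mg]|noX] := boolP (has (misplaced a) X).
  have [//|[X' [Y' [tp' lt]]]] := move_misplaced tp gX mg.
  by apply: IH tp'; apply: leq_trans lt _.
have [/hasP[g gY mg]|noY] := boolP (has (misplaced b) Y).
  have [//|[Y' [X' [tp' lt]]]] := move_misplaced (two_pathsC tp) gY mg.
  by apply: IH tp'; apply: leq_trans lt _; rewrite addnC.
have [[p1 p2 u al] [h1 h2 h3 h4] c1 c2 [n1 n2 n3]] := tp.
have uu : uniq ((a :: X) ++ b :: Y) by case/andP: u.
have [wX wY] : w \notin a :: X /\ w \notin b :: Y.
  by move: u; rewrite cons_uniq mem_cat negb_or => /andP[/andP[]].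
have [uX dj uY] : [/\ uniq (a :: X), ~~ has [in a :: X] (b :: Y) & uniq (b :: Y)].
  by move: uu; rewrite cat_uniq => /and3P[].
have [|| x [y [wx wy xX yX Exy]]] := nbhd_conn (P := [in a :: X]).
- by exists a; rewrite // inE eqxx.
- by exists b => //; apply: (hasPn dj); rewrite inE eqxx.
have yY : y \in b :: Y.
  move: (al y); rewrite inE mem_cat (negbTE yX) /= => /orP[/eqP yw|//].
  by rewrite yw ire in wy.
have fin a' X' g : path m a' X' -> uniq (a' :: X') -> w \notin a' :: X' ->
  e w a' -> e w (last a' X') -> (a' == last a' X') || E a' (last a' X') ->
  g \in a' :: X' -> e w g -> ~~ has (misplaced a') X' -> good_path g (a' :: X').
  move=> pX uX' wX' ha hl hc gX wg noM.
  have [//|[l1 [c [l2 [EX [Elc [nwl nwc]]]]]]] := detour pX uX' wX' ha hl hc gX wg.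
  have gX' : g \in X' by rewrite EX mem_cat inE eqxx orbT.
  have ga : g != a' by apply: contraTneq gX' => ->; case/andP: uX'.
  have Ega : E g a'.
    by move/hasPn: noM => /(_ _ gX'); rewrite /misplaced wg ga andbT /= negbK.
  exists (a' :: l1 ++ c :: l2); split.
  - by rewrite EX; perm_count.
  - rewrite /= Ega cat_path /= Elc.
    by move: pX; rewrite EX cat_path /= => /and4P[P1 _ _ P2]; rewrite (sub_path mE P1) (sub_path mE P2).
  - by rewrite /= last_cat /=; move: hl; rewrite EX last_cat /= => /sub.
by apply: (cross (fin _ _ _ p1 uX wX h1 h2 c1 xX wx noX)
                 (fin _ _ _ p2 uY wY h3 h4 c2 yY wy noY) Exy u al).
Qed.

Let es x y := e x y || [&& e w x, e w y & x != y].

Let es_sym : symmetric es.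
Proof. by move=> x y; rewrite /es se [e w x && _]andbCA eq_sym. Qed.

Let es_bad x y : es x y -> ~~ E x y -> e w x /\ e w y.
Proof.
by rewrite /es => /orP[/sub->//|/and3P[]].
Qed.

Let es_m x y : es x y -> E x y -> m x y.
Proof.
rewrite /m => esxy ->; apply/implyP => xr; case/orP: esxy => // /and3P[wx wy _].
by rewrite wx wy in xr.
Qed.

Let es_path a s : path es a s -> path E a s -> path m a s.
Proof.
by elim: s a => //= b s IH a /andP[h1 h2] /andP[h3 h4]; rewrite es_m //= IH.
Qed.

Let ne_uniq (s1 s2 : seq T) x y : uniq (s1 ++ s2) -> x \in s1 -> y \in s2 -> x != y.
Proof.
rewrite cat_uniq => /and3P[_ /hasPn H _] xs ys.
by apply: contraTneq xs => ->; apply: H.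
Qed.

(** Non-[E] steps have both ends in the [e]-neighbourhood of [w], so [alpha2] applies to these ends
    and allows 2-opt exchanges. When none is possible, a single such step is left, and cutting it
    leaves [two_paths]. *)
Lemma two_opt k a s : path es a s -> uniq (w :: a :: s) ->
  (forall y, y \in w :: a :: s) -> e w a -> e w (last a s) -> 0 < size s ->
  misses E a s < k -> ham E.
Proof.
elim: k a s => // k IH a s p u al wa wl sz lek.
have IH' a' s' : path es a' s' -> perm_eq (a' :: s') (a :: s) ->
    e w a' -> e w (last a' s') -> misses E a' s' < misses E a s -> ham E.
  move=> p' pm wa' wl' lt; apply: (IH a' s') => //.
  - by move: u; rewrite !(cons_uniq w) (perm_uniq pm) (perm_mem pm).
  - by move=> y; move: (al y); rewrite !(in_cons w) (perm_mem pm).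
  - by move: (perm_size pm) sz => /= -[->].
  - by apply: leq_trans lt _; rewrite -ltnS.
have us : uniq (a :: s) by case/andP: u.
have [m0|m0] := eqVneq (misses E a s) 0.
  apply/ham_cons; exists w, (a :: s); split=> //.
  rewrite /= sub //= rcons_path; apply/andP; split; first by rewrite -misses0 m0.
  by rewrite sE sub.
have al' : a != last a s.
  case: (s) sz us => // b s' _ /=; rewrite inE negb_or => /andP[/andP[ab ans] _].
  by apply: contraNneq ans => E1; move: (mem_last b s'); rewrite -E1 inE (negbTE ab).
have [Eyl|nEyl] := boolP (E (last a s) a).
  have [s1 [v [s2 [Es nuv]]]] := misses_split m0.
  move: p; rewrite Es cat_path /= => /and3P[p1 puv p2].
  have [wu wv] := es_bad puv nuv.
  apply: (IH' v (s2 ++ a :: s1)) => //.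
  - rewrite cat_path p2 /= p1 andbT /es.
    by move: wl al'; rewrite Es last_cat /= => -> nal; rewrite wa eq_sym nal orbT.
  - by rewrite Es; perm_count.
  - by rewrite last_cat.
  - rewrite Es !misses_cat /= nuv.
    by move: Eyl; rewrite Es last_cat /= => ->; rewrite add0n addnC ltn_add2l.
have claimA s1 v s2 : s = s1 ++ v :: s2 -> ~~ E (last a s1) v ->
    E (last a s1) (last a s) -> ham E.
  move=> Es nuv Euy; move: p us; rewrite Es cat_path /= => /and3P[p1 puv p2] us'.
  have [wu wv] := es_bad puv nuv.
  have ly : last a s = last v s2 by rewrite Es last_cat.
  apply: (IH' a (s1 ++ rev (v :: s2))) => //.
  - rewrite cat_path p1 /= lastI rev_rcons /= (rev_path_sym _ _ es_sym) p2 andbT.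
    rewrite /es -ly wu wl /= (@ne_uniq (a :: s1) (v :: s2)) ?orbT ?mem_last //.
    by rewrite ly mem_last.
  - by rewrite Es; perm_count.
  - by rewrite last_cat last_rev_cons.
  - rewrite Es !misses_cat /= nuv lastI rev_rcons /= (misses_rev _ _ sE).
    by move: Euy; rewrite ly => ->; rewrite ltn_add2l add0n.
(* With two missing steps, [alpha2] is applied to their first vertices and the end of the path.
   Unless [claimA] applies, the segment between the two steps is reversed; the new step [v v'] may
   be missing again, but one miss is gained. *)
have claimB t1 v t2 v' t3 : s = t1 ++ v :: t2 ++ v' :: t3 ->
    ~~ E (last a t1) v -> ~~ E (last v t2) v' -> ham E.
  move=> Es n1 n2.
  have [|nE1] := boolP (E (last a t1) (last a s)); first exact: claimA Es n1.
  have Es' : s = (t1 ++ v :: t2) ++ v' :: t3 by rewrite Es -catA.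
  have lu' : last a (t1 ++ v :: t2) = last v t2 by rewrite last_cat.
  have [|nE2] := boolP (E (last v t2) (last a s)).
    by move=> h; apply: (claimA _ _ _ Es'); rewrite lu'.
  have ly : last a s = last v' t3 by rewrite Es' last_cat.
  move: p us; rewrite Es cat_path /= cat_path /= => /and3P[p1 puv /and3P[p2 puv' p3]] us'.
  have [wu wv] := es_bad puv n1; have [wu' wv'] := es_bad puv' n2.
  have D1 : last a t1 != last v t2.
    apply: (@ne_uniq (a :: t1) (v :: t2 ++ v' :: t3)); rewrite ?mem_last //.
    by rewrite -cat_cons mem_cat mem_last.
  have D2 : last a t1 != last a s.
    apply: (@ne_uniq (a :: t1) (v :: t2 ++ v' :: t3)); rewrite ?mem_last //.
    by rewrite -cat_cons mem_cat ly mem_last orbT.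
  have D3 : last v t2 != last a s.
    apply: (@ne_uniq (a :: t1 ++ v :: t2) (v' :: t3)).
    - by rewrite /= -catA.
    - by rewrite -cat_cons mem_cat mem_last orbT.
    - by rewrite ly mem_last.
  have D4 : v != v'.
    apply: (@ne_uniq (a :: t1 ++ v :: t2) (v' :: t3)).
    - by rewrite /= -catA.
    - by rewrite inE mem_cat inE eqxx !orbT.
    - by rewrite inE eqxx.
  have := alpha2 wu wu' wl D1 D2 D3; rewrite (negbTE nE1) (negbTE nE2) !orbF => Euu.
  apply: (IH' a (t1 ++ rev (v :: t2) ++ v' :: t3)) => //.
  - rewrite cat_path p1 /= cat_path last_rev_cons /= p3 andbT.
    rewrite lastI rev_rcons /= (rev_path_sym _ _ es_sym) p2 andbT.
    by rewrite /es wu wu' wv wv' D1 D4 !orbT.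
  - by rewrite Es; perm_count.
  - by rewrite !last_cat /= -ly.
  - rewrite Es !misses_cat last_rev_cons /= misses_cat /= n1 n2.
    rewrite [rev (v :: t2)](_ : _ = last v t2 :: rev (belast v t2)); last first.
      by rewrite lastI rev_rcons.
    rewrite /= (misses_rev _ _ sE) Euu /= add0n ltn_add2l.
    by rewrite add1n ltnS leq_add2l leq_add2r; case: (E v v').
have [s1 [v [s2 [Es nuv]]]] := misses_split m0.
have [m1|m1] := eqVneq (misses E a s1) 0; last first.
  have [r1 [v' [r2 [Es1 n1]]]] := misses_split m1.
  apply: (claimB r1 v' r2 v s2) => //; first by rewrite Es Es1 -catA.
  by move: nuv; rewrite Es1 last_cat.
have [m2|m2] := eqVneq (misses E v s2) 0; last first.
  have [r1 [v' [r2 [Es1 n1]]]] := misses_split m2.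
  by apply: (claimB s1 v r1 v' r2) => //; rewrite Es Es1.
have ly : last a s = last v s2 by rewrite Es last_cat.
have [|nE1] := boolP (E (last a s1) (last a s)); first exact: claimA Es nuv.
move: (p) (us); rewrite Es cat_path /= => /and3P[p1 puv p2] us'.
have [wu wv] := es_bad puv nuv.
have va : v != a.
  by rewrite eq_sym; apply: (@ne_uniq (a :: s1) (v :: s2)) => //; rewrite inE eqxx.
have vu : v != last a s1.
  by rewrite eq_sym; apply: (@ne_uniq (a :: s1) (v :: s2)) => //; rewrite ?mem_last ?inE ?eqxx.
have [Eva|nEva] := boolP (E v a).
  apply: (IH' (last a s1) (rev (belast a s1) ++ v :: s2)) => //.
  - have lr : last (last a s1) (rev (belast a s1)) = a.
      by case: (s1) => //= z r; rewrite rev_cons last_rcons.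
    rewrite cat_path (rev_path_sym _ _ es_sym) p1 lr /= p2 andbT.
    by rewrite /es wa wv eq_sym va orbT.
  - rewrite -cat_cons -rev_rcons -lastI Es -cat_cons.
    by rewrite perm_cat2r perm_rev.
  - by rewrite last_cat /= -ly.
  - rewrite Es !misses_cat /= (misses_rev _ _ sE) nuv.
    have -> : last (last a s1) (rev (belast a s1)) = a.
      by case: (s1) => //= z r; rewrite rev_cons last_rcons.
    by rewrite sE Eva ltn_add2l.
have pm : perm_eq ((v :: s2) ++ a :: s1) (a :: s) by rewrite Es; perm_count.
apply: (@two_paths_ham v s2 a s1); split.
- split.
  + by apply: es_path => //; rewrite -misses0 m2.
  + by apply: es_path => //; rewrite -misses0 m1.
  + by move: u; rewrite !(cons_uniq w) (perm_uniq pm) (perm_mem pm).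
  + by move=> y; move: (al y); rewrite !(in_cons w) (perm_mem pm).
- by split=> //; rewrite -ly.
- have [//|vl] := eqVneq v (last v s2).
  rewrite -ly in vl *; have := alpha2 wv wl wa vl va.
  by rewrite (eq_sym _ a) al' (negbTE nEyl) (negbTE nEva) !orbF => /(_ isT) ->.
- have [//|au] := eqVneq a (last a s1).
  have := alpha2 wa wu wv au; rewrite !(eq_sym _ v) va vu [E a v]sE (negbTE nEva) (negbTE nuv).
  by rewrite !orbF => /(_ isT isT) ->.
- by rewrite -ly; split=> //; rewrite sE.
Qed.

Lemma local_completion : ham es -> ham E.
Proof.
case=> c [/andP[cy uc] sz al].
have [i [|a s] Ec] := rot_to (al w).
  by have := size_rot i c; rewrite Ec /=; case: (c) sz => [|? [|]].
have sz' : 0 < size s by move: sz (size_rot i c); rewrite Ec /= => + E1; rewrite -E1.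
have : cycle es (w :: a :: s) by rewrite -Ec rot_cycle.
rewrite /= rcons_path => /and3P[wa p lw].
have uw : uniq (w :: a :: s) by rewrite -Ec rot_uniq.
apply: (@two_opt _ a s) (ltnSn _) => //.
- by move=> y; rewrite -Ec mem_rot.
- by move: wa; rewrite /es ire orbF.
- by move: lw; rewrite /es ire /= andbF orbF se.
Qed.
End LocalCompletion.

(** * The closure of a claw-f-heavy graph *)

Section Closure.
Variable T : finType.
Implicit Types (e g : rel T).

Definition heavy e v := #|T| <= 2 * deg e v.

(** At least two of the three, written pairwise because f-heaviness speaks of each pair of leaves of
    a claw. *)
Definition two_of (a b c : bool) := [&& a || b, a || c & b || c].

Definition claw_heavy e := forall v x y z, e v x -> e v y -> e v z ->
  x != y -> x != z -> y != z -> ~~ e x y -> ~~ e x z -> ~~ e y z ->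
  two_of (heavy e x) (heavy e y) (heavy e z).

Definition heavy_join e x y := e x y || [&& heavy e x, heavy e y & x != y].

Definition common_nbhd e x y z := ((z == x) || e x z) && ((z == y) || e y z).

(* The closure only adds edges [x y] with this property, which is what allows induced
   subgraphs of the closure to be replaced by induced subgraphs of [g]. *)
Definition joined g e x y := exists p,
  [/\ path g x p, last x p = y & all (common_nbhd e x y) (x :: p)].

Definition nbhd_trans e :=
  forall v x y z, e v x -> e v y -> e v z -> e x y -> e y z -> x != z -> e x z.

Definition closed_nbhds e :=
  (forall v x y z, e v x -> e v y -> e v z ->
     x != y -> x != z -> y != z -> [|| e x y, e x z | e y z]) /\
  nbhd_trans e.

Lemma deg_mono e e' v : subrel e e' -> deg e v <= deg e' v.
Proof. by move=> sub; apply: subset_leq_card; apply/subsetP => x; rewrite !inE => /sub. Qed.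

Lemma heavy_mono e e' v : subrel e e' -> heavy e v -> heavy e' v.
Proof. by rewrite /heavy => sub /leq_trans-> //; rewrite leq_mul2l deg_mono. Qed.

Lemma heavy_join_ham e : symmetric e -> irreflexive e -> ham (heavy_join e) -> ham e.
Proof.
move=> se ie; apply: bondy_chvatal => //.
- by move=> x y; rewrite /heavy_join se andbCA eq_sym.
- by move=> x y exy; rewrite /heavy_join exy.
- by move=> x y xy; rewrite /heavy_join /heavy => /orP[|/and3P[hx hy _]]; [left|right; lia].
Qed.

(** Inclusion and exclusion, where the 2 counts [u] and [z]. If both are heavy, their common
    neighbours outnumber the vertices that neither of them sees; [heavy_pair_common] depends on this
    surplus. *)
Lemma card_nbr_union e u z : irreflexive e -> u != z -> ~~ e u z -> ~~ e z u ->
  #|[set w | e u w] :&: [set w | e z w]| + #|T| =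
  deg e u + deg e z + 2 + #|~: ([set w | (e u w || e z w) || (w \in [set u; z])])|.
Proof.
move=> ie uz nuz nzu.
have -> : [set w | (e u w || e z w) || (w \in [set u; z])] =
   ([set w | e u w] :|: [set w | e z w]) :|: [set u; z].
  by apply/setP => w; rewrite !inE.
have dis : [disjoint [set w | e u w] :|: [set w | e z w] & [set u; z]].
  rewrite -setI_eq0; apply/eqP/setP => w; rewrite !inE.
  apply/negP => /andP[+ /orP[]/eqP ww]; rewrite ww ?ie ?(negbTE nuz) ?(negbTE nzu) //.
set X := (_ :|: _) :|: _.
have := cardsC X; rewrite cardsU (disjoint_setI0 dis) cards0 subn0 cards2 uz.
have := cardsU [set w | e u w] [set w | e z w].
have : #|[set w | e u w] :&: [set w | e z w]| <= deg e u.
  by apply: subset_leq_card; apply: subsetIl.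
rewrite /deg; lia.
Qed.

Lemma heavy_common e u z : irreflexive e -> symmetric e -> u != z -> ~~ e u z ->
  heavy e u -> heavy e z -> exists w, e u w && e z w.
Proof.
move=> ie se uz nuz hu hz.
have := card_nbr_union ie uz nuz; rewrite se nuz => /(_ isT) Hc.
have : 0 < #|[set w | e u w] :&: [set w | e z w]|.
  by move: hu hz; rewrite /heavy; move: Hc; clear; lia.
by case/card_gt0P => w; rewrite !inE => H; exists w.
Qed.

Definition nbhd_rel e w a b := [&& e w a, e w b & heavy_join e a b].
Definition nbhd_connected e w :=
  [forall x, forall y, e w x ==> e w y ==> connect (nbhd_rel e w) x y].
Definition nbhd_clique e w :=
  [forall x, forall y, e w x ==> e w y ==> (x != y) ==> e x y].

Lemma connect_cross (r : rel T) (P : pred T) x y : connect r x y -> P x -> ~~ P y ->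
  exists a b, [/\ P a, ~~ P b & r a b].
Proof.
case/connectP => p; elim: p x => [|z p IH] x /=; first by move=> _ -> ->.
case/andP=> rxz pz yl Px nPy; have [Pz|nPz] := boolP (P z); first exact: (IH z).
by exists x, z.
Qed.

Section Step.
Variables (e : rel T) (se : symmetric e) (ie : irreflexive e) (ch : claw_heavy e).

Lemma heavy_alpha2 w x y z : e w x -> e w y -> e w z ->
  x != y -> x != z -> y != z -> [|| heavy_join e x y, heavy_join e x z | heavy_join e y z].
Proof.
move=> wx wy wz xy xz yz.
have [exy|nxy] := boolP (e x y); first by rewrite /heavy_join exy.
have [exz|nxz] := boolP (e x z); first by rewrite /heavy_join exz !orbT.
have [eyz|nyz] := boolP (e y z); first by rewrite /heavy_join eyz !orbT.
have := ch wx wy wz xy xz yz nxy nxz nyz; rewrite /two_of /heavy_join xy xz yz.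
by case: (heavy e x); case: (heavy e y); case: (heavy e z); rewrite ?orbT.
Qed.

Definition complete_nbhd w x y := e x y || [&& e w x, e w y & x != y].

Lemma complete_sym w : symmetric (complete_nbhd w).
Proof. by move=> x y; rewrite /complete_nbhd se [e w x && _]andbCA eq_sym. Qed.

Lemma complete_sub w : subrel e (complete_nbhd w).
Proof. by move=> x y exy; rewrite /complete_nbhd exy. Qed.

Lemma complete_not_ham w : nbhd_connected e w -> ~ ham e -> ~ ham (complete_nbhd w).
Proof.
move=> /forallP nc nh; apply: contra_not nh => H.
apply: heavy_join_ham => //; move: H.
apply: local_completion => //.
- by move=> x y; rewrite /heavy_join se andbCA eq_sym.
- by move=> x y exy; rewrite /heavy_join exy.
- exact: heavy_alpha2.
- move=> u a b wu ua ub ab aw bw na nb.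
  have [eab|nab] := boolP (e a b); first by rewrite /heavy_join eab.
  move: na nb; rewrite {1 2}/heavy_join !negb_or => /andP[nwa ha] /andP[nwb hb].
  have := @ch u w a b; rewrite se wu ua ub !(eq_sym w) aw bw ab => H.
  move: (H isT isT isT isT isT isT nwa nwb nab) ha hb.
  rewrite /two_of /heavy_join (negbTE nab) ab (eq_sym w) aw (eq_sym w) bw.
  by case: (heavy e w); case: (heavy e a); case: (heavy e b).
- move=> P [x wx Px] [y wy nPy].
  have := nc x => /forallP/(_ y); rewrite wx wy => /connect_cross/(_ Px nPy).
  by case=> a [b [Pa Pb /and3P[wa wb ab]]]; exists a, b.
Qed.

(** Completion makes [s] adjacent to [w] and to all other neighbours of [w], so a heavy [w] makes
    [s] heavy. *)
Lemma complete_deg w s : e w s -> deg e w <= deg (complete_nbhd w) s.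
Proof.
move=> ws; rewrite /deg.
have -> : #|[set x | e w x]| = #|w |: ([set x | e w x] :\ s)|.
  rewrite cardsU1 !inE ie andbF /= (cardsD1 s [set x | e w x]) inE ws.
  by rewrite !add1n.
apply: subset_leq_card; apply/subsetP => x; rewrite !inE /complete_nbhd.
case/orP=> [/eqP->|/andP[xs wx]]; first by rewrite se ws.
by rewrite ws wx eq_sym xs orbT.
Qed.

(** In a claw with a new edge [v x], replacing the leaf [x] by [w] gives a claw of [e]. Two of its
    leaves are heavy, and [complete_deg] passes heaviness from [w] to [x]. *)
Lemma complete_claw w : claw_heavy (complete_nbhd w).
Proof.
set e' := complete_nbhd w.
have sub : subrel e e' by apply: complete_sub.
have new v x y z : e' v x -> e' v y -> e' v z -> ~~ e v x ->
    ~~ e' x y -> ~~ e' x z -> ~~ e' y z -> x != y -> x != z -> y != z ->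
    two_of (heavy e' x) (heavy e' y) (heavy e' z).
  rewrite {1}/e' /complete_nbhd => vx vy vz nvx nxy nxz nyz xy xz yz.
  move: vx; rewrite (negbTE nvx) => /and3P[wv wx _].
  have far s : e' v s -> ~~ e' x s -> x != s -> e v s /\ ~~ e w s /\ w != s.
    move=> vs nxs xs.
    have nws : ~~ e w s.
      by apply: contraNN nxs => ws; rewrite /e' /complete_nbhd wx ws xs orbT.
    split; last split=> //.
      by move: vs; rewrite /e' /complete_nbhd (negbTE nws) andbF orbF.
    by apply: contraNneq nxs => <-; rewrite /e' /complete_nbhd se wx.
  have [evy [nwy wy]] := far y vy nxy xy.
  have [evz [nwz wz]] := far z vz nxz xz.
  have nyz' : ~~ e y z by apply: contraNN nyz; apply: sub.
  have := @ch v w y z; rewrite se wv evy evz wy wz yz => /(_ isT isT isT isT isT isT nwy nwz nyz').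
  have hx : heavy e w -> heavy e' x.
    by rewrite /heavy => /leq_trans->//; rewrite leq_mul2l complete_deg.
  have hs t : heavy e t -> heavy e' t by apply: heavy_mono.
  rewrite /two_of => /and3P[h1 h2 h3]; apply/and3P; split.
  - by case/orP: h1 => [/hx|/hs] ->; rewrite ?orbT.
  - by case/orP: h2 => [/hx|/hs] ->; rewrite ?orbT.
  - by case/orP: h3 => /hs ->; rewrite ?orbT.
move=> v x y z vx vy vz xy xz yz nxy nxz nyz.
have sy : symmetric e' by apply: complete_sym.
have [evx|nvx] := boolP (e v x); last exact: (@new v).
have [evy|nvy] := boolP (e v y); last first.
  have := @new v y x z vy vx vz nvy; rewrite [e' y x]sy (eq_sym y x).
  move=> /(_ nxy nyz nxz xy yz xz); rewrite /two_of.
  by case: (heavy e' x); case: (heavy e' y); case: (heavy e' z).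
have [evz|nvz] := boolP (e v z); last first.
  have := @new v z x y vz vx vy nvz; rewrite ![e' z _]sy !(eq_sym z).
  move=> /(_ nxz nyz nxy xz yz xy); rewrite /two_of.
  by case: (heavy e' x); case: (heavy e' y); case: (heavy e' z).
have N s t : ~~ e' s t -> ~~ e s t by apply: contraNN; apply: sub.
have := ch evx evy evz xy xz yz (N _ _ nxy) (N _ _ nxz) (N _ _ nyz); rewrite /two_of.
by case/and3P=> h1 h2 h3; apply/and3P; split;
  [case/orP: h1|case/orP: h2|case/orP: h3] => /(heavy_mono sub)->; rewrite ?orbT.
Qed.

Definition add_edge u z x y := e x y || ((x == u) && (y == z)) || ((x == z) && (y == u)).

Lemma add_sym u z : symmetric (add_edge u z).
Proof. by move=> x y; rewrite /add_edge se -!orbA [X in _ || X]orbC ![(_ == _) && (x == _)]andbC. Qed.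

Lemma add_sub u z : subrel e (add_edge u z).
Proof. by move=> x y exy; rewrite /add_edge exy. Qed.

Lemma add_not_ham u z : heavy e u -> heavy e z -> ~ ham e -> ~ ham (add_edge u z).
Proof.
move=> hu hz nh; apply: contra_not nh; apply: bondy_chvatal => //.
- exact: add_sym.
- exact: add_sub.
- move=> x y _; rewrite /add_edge -orbA => /orP[|h]; first by left.
  by right; move: hu hz; rewrite /heavy; case/orP: h => /andP[/eqP-> /eqP->]; lia.
Qed.

Hypothesis stuck : forall w, nbhd_connected e w -> nbhd_clique e w.

Lemma stuck_add_claw u z : heavy e u -> heavy e z -> u != z -> ~~ e u z ->
  claw_heavy (add_edge u z).
Proof.
move=> hu hz uz nuz; set e' := add_edge u z.
have sub : subrel e e' by apply: add_sub.
have N s t : ~~ e' s t -> ~~ e s t by apply: contraNN; apply: sub.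
(* A new claw with two light leaves would make some neighbourhood connected. *)
have key u1 z1 x y : heavy e u1 -> heavy e z1 -> u1 != z1 -> ~~ e u1 z1 ->
    e u1 x -> e u1 y -> x != y -> ~~ e x y -> ~~ e x z1 -> ~~ e y z1 ->
    x != z1 -> y != z1 -> heavy e x || heavy e y.
  move=> hu1 hz1 uz1 nuz1 ux uy xy nxy nxz nyz xz yz.
  apply/negPn/negP; rewrite negb_or => /andP[lx ly].
  have [w /andP[uw zw]] := heavy_common ie se uz1 nuz1 hu1 hz1.
  (* The neighbourhood of [w] contains the connected chain [a], [u1], [z1], whose last link joins a
     heavy pair. By [heavy_alpha2] any further neighbour of [w] is joined to [a] or to [z1]. The
     neighbourhood is thus connected, hence a clique, although [u1] and [z1] are not adjacent. *)
  have core a : e u1 a -> ~~ e a z1 -> a != z1 -> ~~ heavy e a -> e w a -> False.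
    move=> ua naz az la wa.
    suff /stuck/forallP/(_ u1)/forallP/(_ z1) : nbhd_connected e w.
      by rewrite ![e w _]se uw zw uz1 (negbTE nuz1).
    have Ca t : e w t -> connect (nbhd_rel e w) a t.
      move=> wt; have [->//|at_] := eqVneq a t.
      have [Jat|nJ] := boolP (heavy_join e a t).
        by apply: connect1; rewrite /nbhd_rel wa wt.
      have Caz : connect (nbhd_rel e w) a z1.
        apply: (@connect_trans _ _ u1); apply: connect1; rewrite /nbhd_rel.
          by rewrite wa [e w u1]se uw /heavy_join se ua.
        by rewrite ![e w _]se uw zw /heavy_join hu1 hz1 uz1 orbT.
      have [<-//|zt] := eqVneq z1 t.
      apply: (connect_trans Caz); apply: connect1; rewrite /nbhd_rel [e w z1]se zw wt.
      have := heavy_alpha2 wa _ wt az at_ zt; rewrite se zw => /(_ isT).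
      by rewrite (negbTE nJ) {1}/heavy_join (negbTE naz) (negbTE la).
    apply/forallP => s; apply/forallP => t; apply/implyP => ws; apply/implyP => wt.
    have sym : connect_sym (nbhd_rel e w).
      apply: sym_connect_sym => p q; rewrite /nbhd_rel /heavy_join [e p q]se andbCA.
      by rewrite [heavy e p && _]andbCA eq_sym.
    by apply: (connect_trans _ (Ca t wt)); rewrite sym Ca.
  have wx : w != x by apply: contraNneq nxz => <-; rewrite se.
  have wy : w != y by apply: contraNneq nyz => <-; rewrite se.
  have [/core|nwx] := boolP (e w x); first exact.
  have [/core|nwy] := boolP (e w y); first exact.
  by have := ch uw ux uy wx wy xy nwx nwy nxy; rewrite /two_of (negbTE lx) (negbTE ly) /= !andbF.
have new v x y s : e' v x -> e' v y -> e' v s -> ~~ e v x ->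
    ~~ e' x y -> ~~ e' x s -> ~~ e' y s -> x != y -> x != s -> y != s ->
    two_of (heavy e' x) (heavy e' y) (heavy e' s).
  move=> vx vy vs nvx nxy nxs nys xy xs ys.
  have [hv [hx [vnx xs']]] : heavy e v /\ heavy e x /\ v != x /\
      ((v == u) && (x == z)) || ((v == z) && (x == u)).
    move: vx; rewrite {1}/e' /add_edge (negbTE nvx) /= => /orP[] /andP[/eqP-> /eqP->] //.
    - by rewrite !eqxx.
    - by rewrite eq_sym !eqxx orbT.
  have old t : e' v t -> x != t -> e v t.
    move=> vt xt; move: vt; rewrite {1}/e' /add_edge -orbA => /orP[//|].
    case/orP: xs' => /andP[/eqP E1 /eqP E2] /orP[] /andP[/eqP E3 /eqP E4].
    - by rewrite E2 E4 eqxx in xt.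
    - by rewrite -E1 E3 eqxx in uz.
    - by rewrite -E3 E1 eqxx in uz.
    - by rewrite E2 E4 eqxx in xt.
  have := key v x y s hv hx vnx nvx (old _ vy xy) (old _ vs xs) ys (N _ _ nys).
  rewrite ![e _ x]se !(eq_sym _ x) => /(_ (N _ _ nxy) (N _ _ nxs) xy xs) h.
  rewrite /two_of (heavy_mono sub hx) /=.
  by case/orP: h => /(heavy_mono sub)->; rewrite ?orbT.
move=> v x y s vx vy vs xy xs ys nxy nxs nys.
have sy : symmetric e' by apply: add_sym.
have [evx|nvx] := boolP (e v x); last exact: (@new v).
have [evy|nvy] := boolP (e v y); last first.
  have := @new v y x s vy vx vs nvy; rewrite [e' y x]sy (eq_sym y x).
  move=> /(_ nxy nys nxs xy ys xs); rewrite /two_of.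
  by case: (heavy e' x); case: (heavy e' y); case: (heavy e' s).
have [evs|nvs] := boolP (e v s); last first.
  have := @new v s x y vs vx vy nvs; rewrite ![e' s _]sy !(eq_sym s).
  move=> /(_ nxs nys nxy xs ys xy); rewrite /two_of.
  by case: (heavy e' x); case: (heavy e' y); case: (heavy e' s).
have := ch evx evy evs xy xs ys (N _ _ nxy) (N _ _ nxs) (N _ _ nys); rewrite /two_of.
by case/and3P=> h1 h2 h3; apply/and3P; split;
  [case/orP: h1|case/orP: h2|case/orP: h3] => /(heavy_mono sub)->; rewrite ?orbT.
Qed.

End Step.

Lemma within_sym e x y z : common_nbhd e x y z = common_nbhd e y x z.
Proof. by rewrite /common_nbhd andbC. Qed.

(** Adjacency is transitive around [w], so a vertex equal or adjacent to both [w] and [x] is equal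
    or adjacent to [y] as well. Hence the concatenated path stays in the closed common neighbourhood
    of [x] and [y]. *)
Lemma joined_through g f x y w : symmetric f -> nbhd_trans f ->
  f w x -> f w y -> f x y -> joined g f x w -> joined g f w y -> joined g f x y.
Proof.
move=> sf tf wx wy xy [p [pp pl /allP al]] [q [qp ql /allP aql]].
have near s t z : f w s -> f w t -> f s t -> (z == w) || f w z -> (z == s) || f s z ->
    (z == t) || f t z.
  move=> ws wt st /orP[/eqP->|wz]; first by rewrite [f t w]sf wt orbT.
  case/orP=> [/eqP->|sz]; first by rewrite [f t s]sf st orbT.
  have [//|zt] := eqVneq z t.
  by apply: (tf w t s z) => //; rewrite 1?sf // eq_sym.
exists (p ++ q); split; first by rewrite cat_path pp pl.
  by rewrite last_cat pl.
apply/allP => z; rewrite -cat_cons mem_cat => /orP[/al|zq].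
  by move=> /andP[zx zw]; rewrite /common_nbhd zx; apply: near zw zx.
have /andP[zw zy] : common_nbhd f w y z by apply: aql; rewrite inE zq orbT.
by rewrite /common_nbhd zy andbT; apply: near zw zy; rewrite // sf.
Qed.

Lemma nonedge_lt e e' x y : subrel e e' -> e' x y -> ~~ e x y ->
  #|[set p : T * T | ~~ e' p.1 p.2]| < #|[set p : T * T | ~~ e p.1 p.2]|.
Proof.
move=> sub exy nxy; apply: proper_card; apply/properP; split.
  by apply/subsetP => p; rewrite !inE; apply: contraNN; apply: sub.
by exists (x, y); rewrite !inE /= ?exy ?nxy.
Qed.

Theorem closure g : symmetric g -> irreflexive g -> claw_heavy g -> ~ ham g ->
  exists e, [/\ [/\ symmetric e, irreflexive e & subrel g e], ~ ham e,
    forall x y, heavy e x -> heavy e y -> x != y -> e x y, closed_nbhds e &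
    forall x y, e x y -> joined g e x y].
Proof.
move=> sg ig chg nhg.
(* Induction on the number of non-edges. An intermediate [e] is not yet transitive on
   neighbourhoods, and its common neighbourhoods still grow; hence [joined] is carried along for
   every later transitive [f]. *)
suff H k e : #|[set p : T * T | ~~ e p.1 p.2]| < k ->
    [/\ symmetric e, irreflexive e & subrel g e] -> ~ ham e -> claw_heavy e ->
    (forall x y, e x y -> forall f, symmetric f -> nbhd_trans f -> subrel e f ->
       joined g f x y) ->
  exists e, [/\ [/\ symmetric e, irreflexive e & subrel g e], ~ ham e,
    forall x y, heavy e x -> heavy e y -> x != y -> e x y, closed_nbhds e &
    forall x y, e x y -> joined g e x y].
  apply: (H _ g (ltnSn _)) => // [|x y gxy f sf _ sub]; first by split=> // x y.
  exists [:: y].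
  by split=> //=; rewrite ?gxy // /common_nbhd !eqxx [f y x]sf (sub _ _ gxy) !orbT.
elim: k e => // k IH e lek [se ie sub] nh ch jn.
have [/existsP[w /andP[cw ncw]]|none] :=
    boolP [exists w, nbhd_connected e w && ~~ nbhd_clique e w].
  set e' := complete_nbhd e w.
  have sub' : subrel e e' by apply: complete_sub.
  move: (ncw); rewrite negb_forall => /existsP[x]; rewrite negb_forall => /existsP[y].
  rewrite !negb_imply => /and4P[wx wy xy nxy].
  have exy' : e' x y by rewrite /e' /complete_nbhd wx wy xy orbT.
  apply: (IH e').
  - by apply: leq_trans (nonedge_lt sub' exy' nxy) _; rewrite -ltnS.
  - split; first exact: complete_sym.
      by move=> z; rewrite /e' /complete_nbhd ie eqxx !andbF.
    by move=> a b /sub /sub'.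
  - exact: complete_not_ham.
  - exact: complete_claw.
  - move=> a b e'ab f sf tf sf'; have [eab|nab] := boolP (e a b).
      by apply: jn => // s t /sub'/sf'.
    move: (e'ab); rewrite /e' /complete_nbhd (negbTE nab) => /and3P[wa wb ab].
    have J s t : e s t -> joined g f s t by move=> st; apply: jn => // ? ? /sub'/sf'.
    apply: (@joined_through g f a b w) => //; try exact/sf'/sub'; try exact: sf'.
      by apply: J; rewrite se.
    exact: J.
have stuck w : nbhd_connected e w -> nbhd_clique e w.
  by move=> cw; apply: contraNT none => ncw; apply/existsP; exists w; rewrite cw.
have [/existsP[u /existsP[z /and4P[hu hz uz nuz]]]|noh] :=
    boolP [exists u, exists z, [&& heavy e u, heavy e z, u != z & ~~ e u z]].
  set e' := add_edge e u z.
  have sub' : subrel e e' by apply: add_sub.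
  have exy' : e' u z by rewrite /e' /add_edge !eqxx orbT.
  apply: (IH e').
  - by apply: leq_trans (nonedge_lt sub' exy' nuz) _; rewrite -ltnS.
  - split; first exact: add_sym.
      move=> t; rewrite /e' /add_edge ie /=; apply/negP => /orP[] /andP[/eqP-> h];
      by rewrite ?(negbTE uz) // eq_sym (negbTE uz) in h.
    by move=> a b /sub /sub'.
  - exact: add_not_ham.
  - exact: stuck_add_claw.
  - have [w /andP[uw zw]] := heavy_common ie se uz nuz hu hz.
    move=> a b e'ab f sf tf sf'; have [eab|nab] := boolP (e a b).
      by apply: jn => // s t /sub'/sf'.
    have J s t : e s t -> joined g f s t by move=> st; apply: jn => // ? ? /sub'/sf'.
    have wab : e w a /\ e w b.
      move: e'ab; rewrite /e' /add_edge (negbTE nab) /= ![e w _]se.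
      by case/orP=> /andP[/eqP-> /eqP->].
    case: wab => wa wb.
    apply: (@joined_through g f a b w) => //; try exact/sf'/sub'; try exact: sf'.
      by apply: J; rewrite se.
    exact: J.
have hc x y : heavy e x -> heavy e y -> x != y -> e x y.
  move=> hx hy xy; apply: contraNT noh => nxy; apply/existsP; exists x.
  by apply/existsP; exists y; rewrite hx hy xy.
have a2 v x y z : e v x -> e v y -> e v z ->
     x != y -> x != z -> y != z -> [|| e x y, e x z | e y z].
  move=> vx vy vz xy xz yz; have := heavy_alpha2 ch vx vy vz xy xz yz.
  rewrite /heavy_join; case/or3P => /orP[->|/and3P[h1 h2 h3]]; rewrite ?orbT //.
  - by rewrite hc.
  - by rewrite [e x z]hc // orbT.
  - by rewrite [e y z]hc // !orbT.
(* If [x] and [z] were not adjacent, [a2] would attach every other neighbour of [v] to one of them.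
   With [y] linking the two, the neighbourhood of [v] would be connected, hence a clique. *)
have tr : nbhd_trans e.
  move=> v x y z vx vy vz xy yz xz; apply/negPn/negP => nxz.
  suff /stuck/forallP/(_ x)/forallP/(_ z) : nbhd_connected e v.
    by rewrite vx vz xz (negbTE nxz).
  have ej s t : e v s -> e v t -> e s t -> connect (nbhd_rel e v) s t.
    by move=> vs vt st; apply: connect1; rewrite /nbhd_rel vs vt /heavy_join st.
  have Cx t : e v t -> connect (nbhd_rel e v) x t.
    move=> vt; have [->//|xt] := eqVneq x t.
    have [ext|nxt] := boolP (e x t); first exact: ej.
    have Cz : connect (nbhd_rel e v) x z by apply: (connect_trans (ej _ _ vx vy xy)); apply: ej.
    have [<-//|zt] := eqVneq z t.
    apply: (connect_trans Cz); apply: ej => //.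
    have := a2 v x z t vx vz vt xz xt zt.
    by rewrite (negbTE nxz) (negbTE nxt).
  apply/forallP => s; apply/forallP => t; apply/implyP => vs; apply/implyP => vt.
  apply: (connect_trans _ (Cx t vt)).
  have sym : connect_sym (nbhd_rel e v).
    apply: sym_connect_sym => p q; rewrite /nbhd_rel /heavy_join [e p q]se andbCA.
    by rewrite [heavy e p && _]andbCA eq_sym.
  by rewrite sym Cx.
exists e; split=> // x y exy; exact: jn.
Qed.

End Closure.

(** * Minimal cycles with an ear *)

Section Theta.
Variables (T : finType) (e : rel T).
Hypotheses (se : symmetric e) (ie : irreflexive e).
Hypothesis alpha2 : forall v x y z, e v x -> e v y -> e v z ->
  x != y -> x != z -> y != z -> [|| e x y, e x z | e y z].
Hypothesis tr : nbhd_trans e.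
Implicit Types (u v x y : T) (p q r : seq T).

Definition span (s : seq T) := exists2 c, cycle e c & perm_eq c s.

Definition seg x (s : seq T) y := path e x (rcons s y).

Lemma seg_edge x y : e x y -> seg x [::] y.
Proof. by rewrite /seg /= andbT. Qed.

Lemma seg_nil x y : seg x [::] y = e x y. Proof. by rewrite /seg /= andbT. Qed.

Lemma seg_cat x s y t z : seg x (s ++ y :: t) z = seg x s y && seg y t z.
Proof. by rewrite /seg rcons_cat rcons_cons -cat_rcons cat_path last_rcons. Qed.

Lemma seg_cons x y t z : seg x (y :: t) z = e x y && seg y t z.
Proof. by []. Qed.

Lemma seg_join x s y t z : seg x s y -> seg y t z -> seg x (s ++ y :: t) z.
Proof. by rewrite seg_cat => -> ->. Qed.

Lemma seg_rev x s y : seg x s y -> seg y (rev s) x.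
Proof.
have := rev_path_sym x (rcons s y) se; rewrite last_rcons belast_rcons /seg => <-.
by rewrite rev_cons.
Qed.

Lemma seg_cycle x s : seg x s x -> cycle e (x :: s). Proof. by []. Qed.

Definition theta u v q1 q2 p :=
  [/\ uniq (u :: v :: q1 ++ q2 ++ p), seg u q1 v, seg v q2 u & seg u p v].

(* The cycle [u q1 v q2] has the ear [p] from [u] to [v]; the vertex set is minimal among
   such sets that carry no spanning cycle, and then the ear is shortest. *)
Definition min_theta u v q1 q2 p := [/\ theta u v q1 q2 p,
  ~ span (u :: v :: q1 ++ q2 ++ p) &
  forall c a b r, cycle e c -> uniq (c ++ r) -> a \in c -> b \in c -> a != b ->
    seg a r b -> ~ span (c ++ r) ->
    size (u :: v :: q1 ++ q2 ++ p) <= size c + size r /\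
    (size (u :: v :: q1 ++ q2 ++ p) = size c + size r -> size p <= size r)].

Lemma span_perm s s' : perm_eq s s' -> span s -> span s'.
Proof. by move=> pm [c cc pc]; exists c => //; apply: perm_trans pm. Qed.

Lemma min_theta_mirror u v q1 q2 p : min_theta u v q1 q2 p -> min_theta v u q2 q1 (rev p).
Proof.
move=> [[un p1 p2 p3] ns mn].
have pm : perm_eq (v :: u :: q2 ++ q1 ++ rev p) (u :: v :: q1 ++ q2 ++ p) by perm_count.
split.
- split=> //; first by rewrite (perm_uniq pm).
  exact: seg_rev.
- by move=> sp; apply: ns; exact: (span_perm pm sp).
- by move=> c a b r *; rewrite (perm_size pm) size_rev; apply: (mn c a b r).
Qed.

Lemma min_theta_rev u v q1 q2 p : min_theta u v q1 q2 p -> min_theta u v (rev q2) (rev q1) p.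
Proof.
move=> [[un p1 p2 p3] ns mn].
have pm : perm_eq (u :: v :: rev q2 ++ rev q1 ++ p) (u :: v :: q1 ++ q2 ++ p) by perm_count.
split.
- by split=> //; [rewrite (perm_uniq pm)|apply: seg_rev|apply: seg_rev].
- by move=> sp; apply: ns; exact: (span_perm pm sp).
- by move=> c a b r *; rewrite (perm_size pm); apply: (mn c a b r).
Qed.

Section Facts.
Variables (u v : T) (q1 q2 p : seq T).
Hypothesis mt : min_theta u v q1 q2 p.

Let un : uniq (u :: v :: q1 ++ q2 ++ p). Proof. by case: mt => -[]. Qed.
Let P1 : seg u q1 v. Proof. by case: mt => -[]. Qed.
Let P2 : seg v q2 u. Proof. by case: mt => -[]. Qed.
Let P3 : seg u p v. Proof. by case: mt => -[]. Qed.
Let ns : ~ span (u :: v :: q1 ++ q2 ++ p). Proof. by case: mt. Qed.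

Lemma cycle_spans c : cycle e c -> perm_eq c (u :: v :: q1 ++ q2 ++ p) -> False.
Proof. by move=> cc pc; apply: ns; exists c. Qed.

(** The remainder of the ear would be a shorter ear of the cycle [c] on the same vertex set, against
    the second minimality; an empty remainder would make [c] a spanning cycle. *)
Lemma no_prefix_cycle c pa x pb : cycle e c -> p = pa ++ x :: pb ->
  perm_eq c (u :: v :: q1 ++ q2 ++ pa ++ [:: x]) -> False.
Proof.
move=> cc pE pc; case: pb pE => [|y pb] pE.
  by apply: (cycle_spans cc); rewrite pE.
have pm : perm_eq (c ++ y :: pb) (u :: v :: q1 ++ q2 ++ p).
  rewrite pE; apply: (perm_trans (perm_cat pc (perm_refl _))); perm_count.
have [_ _ /(_ c x v (y :: pb) cc)] := mt.
rewrite (perm_uniq pm) un !(perm_mem pc) => /(_ isT).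
rewrite !(inE, mem_cat, eqxx, orbT) => /(_ isT isT) H.
have xv : x != v.
  apply: contraTneq un => xv.
  have vin : v \in q1 ++ q2 ++ p by rewrite pE xv !mem_cat mem_head !orbT.
  by rewrite /= vin andbF.
have pxv : seg x (y :: pb) v by move: P3; rewrite pE seg_cat => /andP[].
have nsp : ~ span (c ++ y :: pb) by move=> sp; apply: ns; exact: (span_perm pm sp).
have [_] := H xv pxv nsp.
rewrite -size_cat (perm_size pm) => /(_ erefl).
by rewrite pE size_cat /= addnS; move: (size pb) (size pa); clear; lia.
Qed.

End Facts.

Lemma no_suffix_cycle u v q1 q2 p c pa x pb : min_theta u v q1 q2 p ->
  cycle e c -> p = pa ++ x :: pb ->
  perm_eq c (u :: v :: q1 ++ q2 ++ x :: pb) -> False.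
Proof.
move/min_theta_mirror => mt cc pE pc.
apply: (no_prefix_cycle mt cc (pa := rev pb) (x := x) (pb := rev pa)).
  by rewrite pE rev_cat rev_cons -cats1 -catA.
by apply: (perm_trans pc); perm_count.
Qed.

Lemma min_theta_nil u v q1 q2 p : min_theta u v q1 q2 p ->
  [/\ q1 != [::], q2 != [::] & p != [::]].
Proof.
move=> mt; have [[un P1 P2 P3] ns _] := mt; split; apply/negP => /eqP E.
- apply: (cycle_spans mt (c := u :: p ++ v :: q2)); last by rewrite E; perm_count.
  exact: seg_join.
- apply: (cycle_spans mt (c := u :: p ++ v :: rev q1)); last by rewrite E; perm_count.
  by apply: seg_join => //; apply: seg_rev.
- apply: (cycle_spans mt (c := u :: q1 ++ v :: q2)); last by rewrite E; perm_count.
  exact: seg_join.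
Qed.

Lemma uniq_part (s s1 s2 : seq T) : uniq s -> perm_eq s (s1 ++ s2) -> uniq s1.
Proof. by move=> us pm; move: us; rewrite (perm_uniq pm) cat_uniq => /andP[]. Qed.

Lemma min_theta_cycle u v q1 q2 p : min_theta u v q1 q2 p ->
  cycle e (u :: q1 ++ v :: q2).
Proof. by case=> -[_ P1 P2 _] _ _; apply/seg_cycle/seg_join. Qed.

Lemma small_ear u v q1 q2 p c a b r : min_theta u v q1 q2 p ->
  cycle e c -> uniq (c ++ r) -> a \in c -> b \in c -> a != b -> seg a r b ->
  size c + size r < size (u :: v :: q1 ++ q2 ++ p) \/
    (size c + size r = size (u :: v :: q1 ++ q2 ++ p) /\ size r < size p) ->
  (span (c ++ r) -> False) -> False.
Proof.
case=> _ _ mn cc uc ac bc ab sr lt nsp.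
have [le eq] := mn c a b r cc uc ac bc ab sr nsp.
case: lt => [|[/esym/eq le' lt]]; first by rewrite ltnNge le.
by rewrite ltnNge le' in lt.
Qed.

(** An edge [y x] gives an ear that uses only the part of [p] up to [y], or [y] alone if it is the
    last vertex. The smaller vertex set has a spanning cycle by minimality, which [no_prefix_cycle]
    or [no_suffix_cycle] forbids. *)
Lemma ear_far u v q1 q2 p x y : min_theta u v q1 q2 p -> 1 < size p ->
  y \in p -> x \in q1 ++ q2 -> ~~ e y x.
Proof.
move=> mt sz /splitPr yp xq; case: yp mt sz => pa pb mt sz; apply/negP => yx.
have [[un P1 P2 P3] _ _] := mt.
have cyc := min_theta_cycle mt.
move: (P3); rewrite seg_cat => /andP[Pa Pb].
have xc : x \in u :: q1 ++ v :: q2.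
  by move: xq; rewrite inE !mem_cat inE => /orP[]->; rewrite !orbT.
have xu : u != x.
  by apply: contraTneq un => ->; rewrite cons_uniq inE catA mem_cat xq orbT.
have xv : x != v.
  by apply: contraTneq un => <-; rewrite !cons_uniq catA (mem_cat x) xq andbF.
case: pb sz Pb mt un P3 => [|z pb] sz Pb mt un P3.
- have pm : perm_eq ((u :: q1 ++ v :: q2) ++ [:: y]) (u :: v :: q1 ++ q2 ++ [:: y]).
    by perm_count.
  apply: (small_ear mt cyc (a := x) (b := v) (r := [:: y])) => //.
  + by apply: (uniq_part (s2 := pa) un); perm_count.
  + by rewrite inE mem_cat mem_head !orbT.
  + by rewrite seg_cons se yx.
  + left; move: sz; rewrite /= !size_cat /=; move: (size pa) (size q1) (size q2).
    by clear; lia.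
  + by case=> c cc pc; apply: (no_suffix_cycle mt cc erefl); apply: perm_trans pm.
- have pm : perm_eq ((u :: q1 ++ v :: q2) ++ pa ++ [:: y]) (u :: v :: q1 ++ q2 ++ pa ++ [:: y]).
    by perm_count.
  apply: (small_ear mt cyc (a := u) (b := x) (r := pa ++ [:: y])) => //.
  + by apply: (uniq_part (s2 := z :: pb) un); perm_count.
  + by rewrite inE eqxx.
  + by rewrite seg_cat Pa seg_edge.
  + left; rewrite /= !size_cat /=; move: (size pa) (size pb) (size q1) (size q2).
    by clear; lia.
  + by case=> c cc pc; apply: (no_prefix_cycle mt cc erefl); apply: perm_trans pm.
Qed.

(** Otherwise the first edge of [q1] could be routed through [x], a cycle that absorbs a prefix of
    the ear. *)
Lemma ear_start_far u v q1 q2 p x p' a q : min_theta u v q1 q2 p ->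
  p = x :: p' -> q1 = a :: q -> ~~ e x a.
Proof.
move=> mt pE qE; apply/negP => pa.
apply: (no_prefix_cycle mt (c := u :: x :: a :: q ++ v :: q2)
  (pa := [::]) (x := x) (pb := p')) => //; last by rewrite qE; perm_count.
have [[_ P1 P2 P3] _ _] := mt.
move: P1 P3; rewrite qE pE !seg_cons => /andP[_ pq] /andP[up _].
by apply: seg_cycle; rewrite !seg_cons up pa /=; apply: seg_join.
Qed.

Lemma ear_start_far' u v q1 q2 p x p' a q : min_theta u v q1 q2 p ->
  p = x :: p' -> q2 = rcons q a -> ~~ e x a.
Proof.
by move/min_theta_rev => mt pE qE; apply: (ear_start_far mt pE); rewrite qE rev_rcons.
Qed.

Lemma theta_neq u v q1 q2 p : min_theta u v q1 q2 p ->
  [/\ u != v, {in q1 ++ q2 ++ p, forall x, u != x /\ v != x},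
      {in q1 & q2, forall x y, x != y} & {in p & q1 ++ q2, forall x y, x != y}].
Proof.
case=> -[un _ _ _] _ _; move: un; rewrite /= !inE negb_or -andbA => /and4P[uv uq vq uqq].
split=> //.
- by move=> x xq; split; [apply: contraNneq uq|apply: contraNneq vq] => ->.
- move=> x y xq yq; move: uqq; rewrite cat_uniq => /and3P[_ /hasPn H _].
  by apply: contraTneq xq => ->; apply: H; rewrite mem_cat yq.
- move=> x y xq yq; move: uqq; rewrite catA cat_uniq => /and3P[_ /hasPn H _].
  by apply: contraTneq yq => <-; apply: H.
Qed.

Lemma theta_nbrs u v q1 q2 p x p' a q b q' : min_theta u v q1 q2 p ->
  p = x :: p' -> q1 = a :: q -> q2 = rcons q' b ->
  [/\ e u x, e u a, e u b & e a b].
Proof.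
move=> mt pE q1E q2E; have [[_ P1 P2 P3] _ _] := mt.
have [_ ne nq np] := theta_neq mt.
have ux : e u x by move: P3; rewrite pE seg_cons => /andP[].
have ua : e u a by move: P1; rewrite q1E seg_cons => /andP[].
have ub : e u b by move: P2; rewrite q2E -cats1 seg_cat seg_nil se => /andP[].
split=> //.
have xa : x != a by apply: np; rewrite ?pE ?q1E ?mem_head ?mem_cat ?mem_head.
have xb : x != b by apply: np; rewrite ?pE ?q2E ?mem_head ?mem_cat ?mem_rcons ?mem_head ?orbT.
have ab : a != b by apply: nq; rewrite ?q1E ?q2E ?mem_head ?mem_rcons ?mem_head.
have := alpha2 ux ua ub xa xb ab.
by rewrite (negbTE (ear_start_far mt pE q1E)) (negbTE (ear_start_far' mt pE q2E)).
Qed.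

Lemma seg_end x s y : seg x s y = path e x s && e (last x s) y.
Proof. by rewrite /seg rcons_path. Qed.

(** * The neighbourhoods of the ends of the ear *)

Lemma seq_ends (s : seq T) : s != [::] -> exists a s1 s2 b, s = a :: s1 /\ s = rcons s2 b.
Proof. by case: s => // a s _; exists a, s, (belast a s), (last a s); rewrite -lastI. Qed.

Lemma first_split (P : pred T) s : has P s ->
  exists s1 x s2, [/\ s = s1 ++ x :: s2, P x & all (predC P) s1].
Proof.
elim: s => //= a s IH; have [Pa _|nPa /=] := boolP (P a); first by exists [::], a, s.
by case/IH => s1 [x [s2 [-> Px al]]]; exists (a :: s1), x, s2; rewrite /= nPa.
Qed.

(* The neighbours of [u] split into two cliques, one containing the first vertex [x] of
   the ear; [side u x] is the other one. *)
Definition side u x y := [&& e u y, ~~ e x y & y != x].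

Lemma side_clique u x y z : e u x -> side u x y -> side u x z -> y != z -> e y z.
Proof.
move=> ux /and3P[uy nxy yx] /and3P[uz nxz zx] yz.
have := alpha2 ux uy uz; rewrite !(eq_sym x) => /(_ yx zx yz).
by rewrite (negbTE nxy) (negbTE nxz).
Qed.

(** Otherwise [v] lies in the clique of [u] away from the ear and sees the first vertex of [q1]. At
    [v], [alpha2] makes [u] adjacent to the last vertex of [q1] or of [p], and each case yields a
    spanning cycle. *)
Lemma chord_near u v q1 q2 p x p' : min_theta u v q1 q2 p -> p = x :: p' -> e u v -> e x v.
Proof.
move=> mt pE uv; apply/negPn/negP => nxv.
have [nq1 nq2 np] := min_theta_nil mt.
have [a1 [s1 [s2 [y [q1E q1E']]]]] := seq_ends nq1.
have [b1 [t1 [t2 [z [q2E q2E']]]]] := seq_ends nq2.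
have [x' [r1 [r2 [pr [pE1 pE']]]]] := seq_ends np.
have [[un P1 P2 P3] _ _] := mt.
have [ux ua uz az] := theta_nbrs mt pE q1E q2E'.
have mt' := min_theta_mirror mt.
have pE'' : rev p = pr :: rev r2 by rewrite pE' rev_rcons.
have [vpr vb vy yb] := theta_nbrs mt' pE'' q2E q1E'.
have [_ ne nq nqp] := theta_neq mt.
have inq1 w : w \in q1 -> w \in q1 ++ q2 ++ p by rewrite mem_cat => ->.
have inq2 w : w \in q2 -> w \in q1 ++ q2 ++ p by rewrite !mem_cat => ->; rewrite orbT.
have inp w : w \in p -> w \in q1 ++ q2 ++ p by rewrite !mem_cat => ->; rewrite !orbT.
have a1q : a1 \in q1 by rewrite q1E mem_head.
have yq : y \in q1 by rewrite q1E' mem_rcons mem_head.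
have bq : b1 \in q2 by rewrite q2E mem_head.
have prp : pr \in p by rewrite pE' mem_rcons mem_head.
have xp : x \in p by rewrite pE mem_head.
have va : e v a1.
  apply: (side_clique ux); rewrite /side ?uv ?ua ?nxv ?(ear_start_far mt pE q1E) //=.
  - by have [_ ->] := ne _ (inp _ xp).
  - by rewrite eq_sym; apply: nqp; rewrite // mem_cat a1q.
  - by have [_ ->] := ne _ (inq1 _ a1q).
have uy : u != y by have [] := ne _ (inq1 _ yq).
have upr : u != pr by have [] := ne _ (inp _ prp).
have ypr : y != pr by rewrite eq_sym; apply: nqp; rewrite // mem_cat yq.
have nypr : ~~ e y pr by rewrite se (ear_start_far' mt' pE'' q1E').
have vu : e v u by rewrite se.
case/or3P: (alpha2 vu vy vpr uy upr ypr) => [uy'|upr'|]; last by rewrite (negbTE nypr).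
- have ub : e u b1.
    apply: (@tr v u y b1) => //; first by rewrite se.
    by have [] := ne _ (inq2 _ bq).
  have ab : e a1 b1.
    rewrite se; apply: (@tr u b1 v a1) => //; first by rewrite se.
    by rewrite eq_sym; apply: nq.
  apply: (cycle_spans mt (c := u :: p ++ v :: rev q1 ++ q2)); last by perm_count.
  apply/seg_cycle/seg_join => //; rewrite q2E.
  apply: seg_join; last by move: P2; rewrite q2E seg_cons => /andP[].
  rewrite q1E rev_cons -cats1; apply: seg_join; last by rewrite seg_nil.
  by apply: seg_rev; move: P1; rewrite q1E seg_cons => /andP[].
- have pa : e pr a1.
    apply: (@tr u pr v a1) => //; first by rewrite se.
    by apply: nqp; rewrite // mem_cat a1q.
  apply: (cycle_spans mt (c := u :: p ++ q1 ++ v :: q2)); last by perm_count.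
  apply/seg_cycle; rewrite pE' -cats1 -catA /=; apply: seg_join.
    by move: P3; rewrite pE' -cats1 seg_cat => /andP[].
  rewrite q1E /= seg_cons pa /=; apply: seg_join => //.
  by move: P1; rewrite q1E seg_cons => /andP[].
Qed.

(** Leaving [u] along [q1], [c] is the last vertex of the initial run inside the clique away from
    the ear, and [s] the first one outside. The run cannot exhaust [q1], since [q1] could then be
    inserted between the end of [q2] and [u]. *)
Lemma end_split u v q1 q2 p x p' : min_theta u v q1 q2 p -> p = x :: p' ->
  exists cl c s q, [/\ q1 = cl ++ c :: s :: q, {in rcons cl c, forall y, side u x y},
    e c s & ~~ e u s].
Proof.
move=> mt pE.
have [nq1 nq2 np] := min_theta_nil mt.
have [a1 [s1 [s2 [y [q1E q1E']]]]] := seq_ends nq1.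
have [b1 [t1 [t2 [z [q2E q2E']]]]] := seq_ends nq2.
have [[un P1 P2 P3] _ _] := mt.
have [ux ua uz az] := theta_nbrs mt pE q1E q2E'.
have [_ ne nq nqp] := theta_neq mt.
have xp : x \in p by rewrite pE mem_head.
have sa1 : side u x a1.
  rewrite /side ua (ear_start_far mt pE q1E) eq_sym nqp // mem_cat q1E mem_head //.
have [/first_split[r1 [s [q [qE ns al]]]]|] := boolP (has (predC (side u x)) q1); last first.
  rewrite has_predC negbK => /allP al; exfalso.
  apply: (cycle_spans mt (c := u :: p ++ v :: q2 ++ q1)); last by perm_count.
  apply/seg_cycle/seg_join => //; rewrite q1E; apply: seg_join.
    by move: P2; rewrite !seg_end q2E' last_rcons => /andP[-> _]; rewrite se.
  move: P1; rewrite q1E seg_cons !seg_end => /and3P[_ -> _] /=.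
  have /al/and3P[uy _ _] : y \in q1 by rewrite q1E' mem_rcons mem_head.
  have -> : last a1 s1 = y by have := congr1 (last u) q1E'; rewrite q1E last_rcons.
  by rewrite se.
case: (lastP r1) qE al => [|cl c] qE al.
  by move: ns; rewrite qE in q1E; case: q1E => -> _; rewrite /= sa1.
have al' : {in rcons cl c, forall y, side u x y}.
  by move=> w /(allP al) /=; rewrite negbK.
have cs : e c s.
  by move: P1; rewrite qE cat_rcons seg_cat seg_cons => /and3P[].
exists cl, c, s, q; split=> //; first by rewrite qE cat_rcons.
apply/negP => us; move: ns; rewrite /= /side us /= negb_and !negbK => xs.
have /and3P[uc nxc cx] : side u x c by apply: al'; rewrite mem_rcons mem_head.
have sq : s \in q1 by rewrite qE mem_cat mem_head orbT.
have xs' : e x s.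
  by case/orP: xs => // /eqP sx; have := nqp x s xp; rewrite mem_cat sq sx eqxx => /(_ isT).
move: nxc; rewrite (@tr u x s c) //; first by rewrite se.
by rewrite eq_sym.
Qed.

(** The run up to [c] sees the last vertex of [q2] and can be moved between it and [u]. An edge from
    [s] to [v] or to [x] would then close a cycle that minimality forbids. *)
Lemma end_facts u v q1 q2 p x p' : min_theta u v q1 q2 p -> p = x :: p' ->
  exists cl c s q, [/\ q1 = cl ++ c :: s :: q, {in rcons cl c, forall y, side u x y},
    [/\ e c s, ~~ e u s, ~~ e v s & ~~ e v c] &
    {in p, forall y, ~~ e y c /\ ~~ e y s}].
Proof.
move=> mt pE; have [cl [c [s [q [qE al cs nus]]]]] := end_split mt pE.
exists cl, c, s, q.
have [nq1 nq2 np] := min_theta_nil mt.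
have [a1 [s1 [s2 [y [q1E q1E']]]]] := seq_ends nq1.
have [b1 [t1 [t2 [z [q2E q2E']]]]] := seq_ends nq2.
have [x' [r1 [r2 [pr [pE1 pE']]]]] := seq_ends np.
have [[un P1 P2 P3] _ _] := mt.
have [ux ua uz az] := theta_nbrs mt pE q1E q2E'.
have mt' := min_theta_mirror mt.
have pE'' : rev p = pr :: rev r2 by rewrite pE' rev_rcons.
have [vpr vb vy yb] := theta_nbrs mt' pE'' q2E q1E'.
have [uv ne nq nqp] := theta_neq mt.
have cq : c \in q1 by rewrite qE mem_cat mem_head orbT.
have sq : s \in q1 by rewrite qE mem_cat !inE eqxx !orbT.
have /and3P[uc nxc cx] : side u x c by apply: al; rewrite mem_rcons mem_head.
have ly : last s q = y.
  by have := congr1 (last u) q1E'; rewrite qE last_cat last_rcons.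
have [rest E1] : exists rest, cl ++ [:: c] = a1 :: rest.
  by move: qE; rewrite q1E; case: (cl) => [|a l] [->]; [exists [::]|exists (l ++ [:: c])].
have rest_u : seg a1 rest u.
  move: P1; rewrite qE -cat_rcons -cats1 seg_cat E1 => /andP[+ _].
  rewrite seg_cons !seg_end => /and3P[_ -> _] /=.
  have -> : last a1 rest = c by have := congr1 (last u) E1; rewrite last_cat.
  by rewrite se.
have sqv : seg s q v by move: P1; rewrite qE seg_cat seg_cons => /and3P[].
have nvs : ~~ e v s.
  apply/negP => vs.
  apply: (cycle_spans mt (c := u :: p ++ v :: s :: q ++ q2 ++ cl ++ [:: c])); last first.
    by rewrite qE; perm_count.
  apply/seg_cycle/seg_join => //; rewrite seg_cons vs E1 /= q2E /=.
  apply: seg_join; first by move: sqv; rewrite !seg_end ly => /andP[-> _]; rewrite se.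
  apply: seg_join => //.
  move: P2; rewrite q2E seg_cons !seg_end => /and3P[_ -> _] /=.
  have -> : last b1 t1 = z by have := congr1 (last u) q2E'; rewrite q2E last_rcons.
  by rewrite se.
have nxs : ~~ e x s.
  apply/negP => xs.
  apply: (no_prefix_cycle mt (c := u :: x :: s :: q ++ v :: q2 ++ cl ++ [:: c])
    (pa := [::]) (x := x) (pb := p')) => //; last by rewrite qE; perm_count.
  apply/seg_cycle; rewrite !seg_cons ux xs /=; apply: seg_join => //; rewrite E1.
  apply: seg_join => //; move: P2; rewrite !seg_end q2E' last_rcons => /andP[-> _].
  by rewrite se.
have fr : {in p, forall w, ~~ e w c /\ ~~ e w s}.
  move=> w wp; have [sz|sz] := ltnP 1 (size p).
    by split; apply: (ear_far mt sz wp); rewrite mem_cat ?cq ?sq.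
  by move: wp sz; rewrite pE; case: (p') => // ; rewrite inE => /eqP->.
split=> //; split=> //; apply/negP => vc.
have [uv'|nuv] := boolP (e u v).
  have xv := chord_near mt pE uv'; move: nxc.
  by rewrite (@tr v x u c) // 1?se // 1?se // eq_sym.
have := @alpha2 c u s v; rewrite se uc cs se vc.
have := ne s; rewrite mem_cat sq => /(_ isT)[us vs].
by rewrite us uv eq_sym vs (negbTE nus) (negbTE nuv) se (negbTE nvs) => /(_ isT isT isT isT isT isT).
Qed.

(** The pairs [c], [s] and [d], [t] come from the two sides of the cycle. If [s] and [t] are
    adjacent, another private neighbour of [c] replaces [s]; that none exists contradicts minimality
    of the order. *)
Lemma net_end u v q1 q2 p x p' : min_theta u v q1 q2 p -> p = x :: p' ->
  exists c d s t, [/\ side u x c, side u x d & c != d] /\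
    [/\ [/\ e c s, ~~ e u s, s != u & ~~ e x s],
      [/\ e d t, ~~ e u t, t != u & ~~ e x t] & ~~ e s t].
Proof.
move=> mt pE; have [cl [c [s [q [q1E sc [cs us vs vc] fr]]]]] := end_facts mt pE.
have mtr := min_theta_rev mt.
have [dl [d [t [q'' [q2E sd [dt ut vt vd] fr']]]]] := end_facts mtr pE.
have [uv ne nq nqp] := theta_neq mt.
have [[un P1 P2 P3] _ _] := mt.
have ux : e u x by move: P3; rewrite pE seg_cons => /andP[].
have xp : x \in p by rewrite pE mem_head.
have xs : ~~ e x s by have [] := fr _ xp.
have xt : ~~ e x t by have [] := fr' _ xp.
have c1 : c \in q1 by rewrite q1E mem_cat mem_head orbT.
have d2 : d \in q2 by rewrite -mem_rev q2E mem_cat mem_head orbT.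
have cd : c != d by apply: nq.
have sdc : side u x c by apply: sc; rewrite mem_rcons mem_head.
have sdd : side u x d by apply: sd; rewrite mem_rcons mem_head.
have /and3P[uc xc cx] := sdc.
have /and3P[ud xd dx] := sdd.
have q2E' : q2 = rev q'' ++ t :: d :: rev dl.
  by rewrite -[q2]revK q2E rev_cat !rev_cons -!cats1 -!catA.
have us' : u != s by have [] := ne s; rewrite // q1E !mem_cat !inE eqxx !orbT.
have ut' : u != t by have [] := ne t; rewrite // q2E' !mem_cat !inE eqxx !orbT.
have [st|nst] := boolP (e s t).
  2: by exists c, d, s, t; rewrite (eq_sym s) us' (eq_sym t) ut'.
have tc : ~~ e t c.
  apply/negP => tc; move: ut; rewrite (@tr d u c t) //; rewrite 1?se //.
  exact: side_clique sdc sdd cd.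
have side_c y : e c y -> ~~ e u y -> y != u -> y != s -> e s y.
  move=> cy uy yu ys; have := @alpha2 c u s y.
  rewrite se uc cs cy us' eq_sym yu eq_sym ys => /(_ isT isT isT isT isT isT).
  by rewrite (negbTE us) (negbTE uy).
have [/existsP[s' /and5P[cs' us1 xs1 ss1 su1]]|no] :=
    boolP [exists s', [&& e c s', ~~ e u s', ~~ e x s', s' != s & s' != u]].
  exists c, d, s', t; rewrite su1 (eq_sym t) ut'; split=> //; split=> //; apply/negP => s't.
  have ss' := side_c s' cs' us1 su1 ss1.
  move: tc; rewrite (@tr s t s' c) //; try by rewrite se.
  by rewrite eq_sym; apply: nq; rewrite // q2E' mem_cat mem_head orbT.
exfalso.
have M1 y : e c y -> ~~ e u y -> y != s -> y != u -> e x y.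
  move=> cy uy ys yu; apply: contraNT no => nxy; apply/existsP; exists y.
  by rewrite cy uy nxy ys yu.
have M1u y y' : e c y -> ~~ e u y -> y != s -> y != u ->
    e c y' -> ~~ e u y' -> y' != s -> y' != u -> y = y'.
  move=> cy uy ys yu cy' uy' ys' yu'; apply/eqP/negPn/negP => yy'.
  have xy := M1 y cy uy ys yu; have xy' := M1 y' cy' uy' ys' yu'.
  have := @alpha2 c u y y'; rewrite se uc cy cy' eq_sym yu eq_sym yu' yy'.
  move=> /(_ isT isT isT isT isT isT); rewrite (negbTE uy) (negbTE uy') /= => eyy.
  by move: xc; rewrite se (@tr y c y' x) // se.
pose L := cl ++ rev dl.
have sL y : y \in c :: L -> side u x y.
  rewrite inE mem_cat mem_rev => /or3P[/eqP->//|yc|yd].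
    by apply: sc; rewrite mem_rcons inE yc orbT.
  by apply: sd; rewrite mem_rcons inE yd orbT.
(* The edge [s t] closes this cycle. Its ear from [s] through [c], the rest of both runs, [u] and
   [p] to [v] takes in every vertex but [d], so minimality gives a spanning cycle of this smaller
   set. *)
pose C1 := s :: q ++ v :: rev q'' ++ [:: t].
have pmX : perm_eq (u :: v :: q1 ++ q2 ++ p) ((C1 ++ c :: L ++ u :: p) ++ [:: d]).
  by rewrite q1E q2E' /C1 /L; perm_count.
have uC1 : uniq (C1 ++ c :: L ++ u :: p) by apply: (uniq_part un pmX).
have cycC1 : cycle e C1.
  move: P1 P2; rewrite q1E q2E' !seg_cat !seg_cons => /and3P[_ _ sv] /andP[vt' _].
  by apply: seg_cycle; rewrite !seg_cat sv vt' seg_nil se.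
apply: (small_ear mt cycC1 uC1 (a := s) (b := v)).
- by rewrite mem_head.
- by rewrite inE mem_cat mem_head !orbT.
- have sX : s \in q1 ++ q2 ++ p by rewrite q1E !mem_cat !inE eqxx !orbT.
  by have [_ +] := ne s sX; rewrite eq_sym.
- rewrite seg_cons se cs /=; apply: seg_join => //.
  have uL : uniq (c :: L).
    by move: uC1; rewrite cat_uniq -cat_cons => /and3P[_ _]; rewrite cat_uniq => /andP[].
  rewrite seg_end path_clique //=; last first.
    by move=> y z /sL sy /sL sz; apply: side_clique sy sz.
  by have /sL/and3P[] := mem_last c L; rewrite se.
- by left; rewrite (perm_size pmX) !size_cat /= addn1.
case=> g cg pg.
have cg_in : c \in g by rewrite (perm_mem pg) mem_cat mem_head orbT.
have [i g' gE] := rot_to cg_in.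
have cyg : cycle e (c :: g') by rewrite -gE rot_cycle.
have pmg : perm_eq (c :: g') (C1 ++ c :: L ++ u :: p).
  by rewrite -gE perm_rot.
have dnew : d \notin c :: g'.
  rewrite (perm_mem pmg); move: un; rewrite (perm_uniq pmX) cat_uniq.
  by case/and3P=> _ /hasPn/(_ d) H _; apply: H; rewrite mem_head.
(* A neighbour of [c] on the cycle lying in the clique of [u] would let [d] be inserted. *)
have outer y g2 : cycle e (c :: y :: g2) -> perm_eq (c :: y :: g2) (c :: g') ->
    [/\ e c y, ~~ e u y & y != u].
  move=> cyc pm; have cy : e c y by move: cyc => /andP[].
  have nsd : e d y -> False.
    move=> dy; apply: (cycle_spans mt (c := c :: d :: y :: g2)).
      have cd' : e c d by apply: side_clique sdc sdd cd.
      by move: cyc => /andP[_ cyc]; apply/andP; split=> //; apply/andP.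
    apply: (@perm_trans _ ((c :: y :: g2) ++ [:: d])); first by perm_count.
    rewrite perm_sym; apply: (perm_trans pmX); rewrite perm_sym.
    by apply: perm_cat (perm_refl _); apply: perm_trans pmg.
  have yd : d != y by apply: contraNneq dnew => ->; rewrite -(perm_mem pm) !inE eqxx orbT.
  split=> //; last by apply/eqP => yu; apply: nsd; rewrite yu se.
  apply/negP => uy; apply: nsd; apply: (side_clique ux sdd) => //.
  rewrite /side uy /=; apply/andP; split.
    by apply: contraNN xc => xy; rewrite (@tr u x y c) // 1?se // eq_sym.
  by apply: contraNneq xc => <-; rewrite se.
(* By [outer], both cycle neighbours of [c] lie outside the closed neighbourhood of [u]; at most one
   of them is [s]. The other sees [x] by [M1]. *)
have [s' [s'in cs' us1 su1 ss1]] : exists s', [/\ s' \in c :: g', e c s', ~~ e u s', s' != u & s' != s].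
  have sz3 : 3 < size (c :: g').
    rewrite (perm_size pmg) /C1 !size_cat /= ?size_cat /= pE /=.
    move: (size q) (size q'') (size L) (size p'); clear; lia.
  have [y [g2 [g3 [z [E1 E2]]]]] := seq_ends (s := g') ltac:(by case: (g') sz3).
  have [cy uy yu] : [/\ e c y, ~~ e u y & y != u].
    by apply: (@outer y g2); rewrite -E1 //.
  have [cz uz zu] : [/\ e c z, ~~ e u z & z != u].
    apply: (@outer z (rev g3)).
      by rewrite -rev_rcons -E2; apply: seg_cycle; apply: seg_rev; exact: cyg.
    by rewrite E2; perm_count.
  have yz : y != z.
    have : uniq g' by have := perm_uniq pmg; rewrite uC1 /= => /andP[].
    rewrite E2; case: (g3) E1 E2 => [|y' g4] E1 E2.
      by move: sz3; rewrite E2.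
    have -> : y' = y by move: E2; rewrite E1 => -[].
    by rewrite rcons_cons cons_uniq mem_rcons inE negb_or => /andP[/andP[]].
  have [ys|ys] := eqVneq y s.
    by exists z; split; rewrite // ?E2 ?inE ?mem_rcons ?mem_head ?orbT // -ys eq_sym.
  by exists y; split; rewrite // E1 !inE eqxx orbT.
have xs1 := M1 s' cs' us1 ss1 su1.
have s'q : s' \in q1 ++ q2.
  have : s' \in u :: v :: q1 ++ q2 ++ p.
    by rewrite (perm_mem pmX) mem_cat -(perm_mem pmg) s'in.
  rewrite !inE (negbTE su1) catA mem_cat /= => /or3P[/eqP s'v|//|/fr[]].
    by move: vc; rewrite -s'v se cs'.
  by rewrite se cs'.
(* As [x] sees the vertex [s'] of the original cycle, [ear_far] leaves only the ear [[:: x]]. The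
   rest of the proof tries to insert [x] into that cycle next to [s']. *)
have [sz|sz] := ltnP 1 (size p).
  by move: xs1; rewrite (negbTE (ear_far mt sz xp s'q)).
have pE1 : p = [:: x] by move: sz; rewrite pE; case: (p').
pose R := q ++ v :: q2 ++ u :: cl.
have cyR : cycle e (c :: s :: R).
  have := min_theta_cycle mt; rewrite -(rot_cycle (size (u :: cl))) q1E.
  have -> : u :: (cl ++ c :: s :: q) ++ v :: q2 = (u :: cl) ++ c :: s :: q ++ v :: q2.
    by rewrite /= -catA.
  by rewrite rot_size_cat /R /= -!catA.
have pmR : perm_eq (c :: s :: R) (u :: v :: q1 ++ q2) by rewrite q1E; perm_count.
have uR : uniq (c :: s :: R).
  by rewrite (perm_uniq pmR); apply: (uniq_part (s2 := p) un); perm_count.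
have cs1 : s' != c by apply: contraTneq cs' => ->; rewrite ie.
have s'R : s' \in R.
  have : s' \in c :: s :: R by rewrite (perm_mem pmR) !inE s'q !orbT.
  by rewrite !inE (negbTE cs1) (negbTE ss1).
have sizeR : 1 < size R by rewrite /R !size_cat /= ?size_cat /= !addnS.
case/splitPr: {R}s'R cyR pmR uR sizeR => R1 R2 cyR pmR uR sizeR.
have /andP[segL segR] : seg c (s :: R1) s' && seg s' R2 c by rewrite -seg_cat.
have absorb l : seg c l c -> perm_eq (c :: l) (x :: c :: s :: R1 ++ s' :: R2) -> False.
  move=> sl pml.
  apply: (no_prefix_cycle mt (c := c :: l) (pa := [::]) (x := x) (pb := [::])) => //.
  apply: (perm_trans pml); rewrite -(perm_cons x) in pmR; apply: (perm_trans pmR).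
  by perm_count.
have xR : x \notin c :: s :: R1 ++ s' :: R2.
  rewrite (perm_mem pmR); have : uniq (x :: u :: v :: q1 ++ q2); last by case/andP.
  by apply: (uniq_part (s2 := [::]) un); rewrite pE1; perm_count.
(* A cycle neighbour of [s'] that misses [x] sees [c] by [alpha2], hence equals [s]. Since [x]
   cannot be inserted, this would hold for both cycle neighbours of [s']. *)
have nxt y : y \in s :: R1 ++ s' :: R2 -> e s' y -> ~~ e x y -> e c y /\ (y != s -> False).
  move=> yin s'y xy.
  have yc : c != y by apply: contraTneq uR => ->; rewrite cons_uniq yin.
  have cy : e c y.
    have xy' : x != y by apply: contraNneq xR => ->; rewrite inE yin orbT.
    have := @alpha2 s' x c y; rewrite se xs1 se cs' s'y eq_sym cx xy' yc.
    by rewrite (negbTE xc) (negbTE xy) /=; apply.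
  split=> // ys; have [yu|yu] := eqVneq y u; first by rewrite yu se ux in xy.
  have := M1 y cy _ ys yu; rewrite (negbTE xy) => H; apply: notF; apply: H.
  apply/negP => uy; move: us1; rewrite (@tr c u y s') //; rewrite 1?se //.
  by rewrite eq_sym.
have R10 : R1 = [::].
  case: (lastP R1) => // r y in segL uR pmR cyR sizeR absorb nxt *.
  have yin : y \in s :: rcons r y ++ s' :: R2.
    by rewrite inE mem_cat mem_rcons mem_head !orbT.
  have [sr sy] : seg c (s :: r) y /\ e y s'.
    by move: segL; rewrite -cats1 -cat_cons seg_cat seg_nil => /andP[].
  have xy : ~~ e x y.
    apply/negP => xy; apply: (absorb (s :: r ++ y :: x :: s' :: R2)); last by perm_count.
    by rewrite -cat_cons seg_cat sr !seg_cons [e y x]se xy xs1.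
  have [|_ H] := nxt y yin _ xy; first by rewrite se.
  exfalso; apply: H; apply: contraTneq uR => ->.
  by rewrite /= mem_cat mem_rcons mem_head andbF.
case: R2 => [|y R2] in segR uR pmR cyR sizeR absorb xR nxt *; first by rewrite R10 in sizeR.
have s'y : e s' y by move: segR; rewrite seg_cons => /andP[].
have yin : y \in s :: R1 ++ s' :: y :: R2 by rewrite !inE mem_cat !inE eqxx !orbT.
have xy : ~~ e x y.
  apply/negP => xy; apply: (absorb (s :: R1 ++ s' :: x :: y :: R2)); last by perm_count.
  move: segR; rewrite -cat_cons seg_cat segL !seg_cons [e s' x]se xs1 xy /=.
  by case/andP.
have [_] := nxt y yin s'y xy; apply; apply: contraTneq uR => ->.
by rewrite /= mem_cat !inE eqxx !orbT andbF.
Qed.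

(** * Induced paths and chords of the ear *)

Fixpoint ipath x (s : seq T) :=
  if s is y :: s' then [&& e x y, all (fun z => ~~ e x z && (z != x)) s' & ipath y s']
  else true.

Lemma not_ipath x s : path e x s -> uniq (x :: s) -> ~~ ipath x s ->
  exists s1 y m z s2, [/\ x :: s = s1 ++ y :: m ++ z :: s2, m != [::] & e y z].
Proof.
elim: s x => //= y s IH x /andP[xy py] /andP[xs us]; rewrite xy /= negb_and.
case/orP=> [|/(IH _ py us)[s1 [a [m [b [s2 [-> mn ab]]]]]]]; last first.
  by exists (x :: s1), a, m, b, s2.
case/allPn=> z zs; rewrite negb_and !negbK => /orP[xz|/eqP zx]; last first.
  by move: xs; rewrite inE -zx zs orbT.
by case/splitPr: zs => m s2; exists [::], x, (y :: m), z, s2.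
Qed.

(** A chord shortens the ear, so by minimality the smaller vertex set has a spanning cycle. If the
    chord avoids [u] and [v], the skipped part [m] is a shorter ear of that cycle on the full vertex
    set; otherwise the cycle absorbs a prefix or suffix of the ear. *)
Lemma ear_induced u v q1 q2 p : min_theta u v q1 q2 p -> ~~ e u v -> ipath u (rcons p v).
Proof.
move=> mt nuv; apply/negPn/negP => nip.
have [[un P1 P2 P3] ns mn] := mt; have [uv ne nq nqp] := theta_neq mt.
have cyc := min_theta_cycle mt.
have up : uniq (u :: rcons p v).
  by apply: (uniq_part (s2 := q1 ++ q2) un); perm_count.
have [s1 [y [m [z [s2 [E mn0 yz]]]]]] := not_ipath P3 up nip.
case: s1 E => [|u' s1] [Eu E].
- case: (lastP s2) E => [|s2' v'] E.
    have v_z : v = z by move: E; rewrite cats1 => /rcons_inj[].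
    by rewrite Eu v_z yz in nuv.
  have pE : p = m ++ z :: s2'.
    by move: E; rewrite -rcons_cons -rcons_cat => /rcons_inj[].
  have pm : perm_eq ((u :: q1 ++ v :: q2) ++ z :: s2') (u :: v :: q1 ++ q2 ++ z :: s2').
    by perm_count.
  apply: (small_ear mt cyc (a := u) (b := v) (r := z :: s2')) => //.
  + by rewrite (perm_uniq pm); apply: (uniq_part (s2 := m) un); rewrite pE; perm_count.
  + by rewrite mem_head.
  + by rewrite inE mem_cat mem_head !orbT.
  + by move: P3; rewrite pE seg_cat !seg_cons Eu yz => /andP[].
  + left; rewrite pE /= !size_cat /= ?size_cat /=; case: (m) mn0 => //= a r _.
    by move: (size q1) (size q2) (size r) (size s2'); clear; lia.
  + by case=> c cc pc; apply: (no_suffix_cycle mt cc pE); apply: perm_trans pm.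
- case: (lastP s2) E => [|s2' v'] E.
    have [pE v_z] : p = s1 ++ y :: m /\ v = z.
      by move: E; rewrite cats1 -rcons_cons -rcons_cat => /rcons_inj[].
    have pm : perm_eq ((u :: q1 ++ v :: q2) ++ s1 ++ [:: y]) (u :: v :: q1 ++ q2 ++ s1 ++ [:: y]).
      by perm_count.
    apply: (small_ear mt cyc (a := u) (b := v) (r := s1 ++ [:: y])) => //.
    + by rewrite (perm_uniq pm); apply: (uniq_part (s2 := m) un); rewrite pE; perm_count.
    + by rewrite mem_head.
    + by rewrite inE mem_cat mem_head !orbT.
    + by move: P3; rewrite pE !seg_cat seg_nil v_z yz => /andP[-> _].
    + left; rewrite pE /= !size_cat /=; case: (m) mn0 => //= a r _.
      by move: (size q1) (size q2) (size r) (size s1); clear; lia.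
    + by case=> c cc pc; apply: (no_prefix_cycle mt cc pE); apply: perm_trans pm.
  have pE : p = s1 ++ y :: m ++ z :: s2'.
    by move: E; rewrite -!rcons_cons -!rcons_cat -rcons_cons -rcons_cat => /rcons_inj[].
  set r := s1 ++ y :: z :: s2'.
  have pm : perm_eq ((u :: q1 ++ v :: q2) ++ r) (u :: v :: q1 ++ q2 ++ r).
    by rewrite /r; perm_count.
  have pmX : perm_eq (u :: v :: q1 ++ q2 ++ p) ((u :: v :: q1 ++ q2 ++ r) ++ m).
    by rewrite /r pE; perm_count.
  apply: (small_ear mt cyc (a := u) (b := v) (r := r)) => //.
  + by rewrite (perm_uniq pm); apply: (uniq_part (s2 := m) un).
  + by rewrite mem_head.
  + by rewrite inE mem_cat mem_head !orbT.
  + by move: P3; rewrite pE /r !seg_cat !seg_cons yz => /and3P[-> _].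
  + left; rewrite pE /r /= !size_cat /= ?size_cat /=; case: (m) mn0 => //= a r' _.
    by move: (size q1) (size q2) (size r') (size s1) (size s2'); clear; lia.
  + case=> c cc pc.
    have pc' := perm_trans pc pm.
    have pcm : perm_eq (c ++ m) (u :: v :: q1 ++ q2 ++ p).
      by rewrite perm_sym; apply: (perm_trans pmX); apply: perm_cat; rewrite // perm_sym.
    apply: (small_ear mt cc (a := y) (b := z) (r := m)).
    * by rewrite (perm_uniq pcm).
    * by rewrite (perm_mem pc') /r !(inE, mem_cat) eqxx !orbT.
    * by rewrite (perm_mem pc') /r !(inE, mem_cat) eqxx !orbT.
    * by apply: contraTneq yz => ->; rewrite ie.
    * by move: P3; rewrite pE !seg_cat => /and3P[].
    * right; split; first by rewrite -size_cat (perm_size pcm).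
      by rewrite pE !size_cat /= size_cat; move: (size m) (size s1) (size s2'); clear; lia.
    * by move=> sp; apply: ns; apply: span_perm sp.
Qed.

(** * Existence of a minimal cycle with an ear *)

Lemma min_ex (P : nat -> Prop) : (exists n, P n) ->
  exists2 n, P n & forall m, P m -> n <= m.
Proof.
case=> n; elim/ltn_ind: n => n IH Pn.
have [[m [lt Pm]]|no] := classic (exists m, m < n /\ P m); first exact: IH lt Pm.
exists n => // m Pm; rewrite leqNgt; apply/negP => lt; apply: no; by exists m.
Qed.

Definition two_connected := 2 < #|T| /\ forall w x y, x != w -> y != w ->
  connect (fun a b => [&& e a b, a != w & b != w]) x y.

Lemma avoiding_path w x y : two_connected -> x != w -> y != w ->
  exists s, [/\ path e x s, last x s = y, uniq (x :: s) & w \notin x :: s].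
Proof.
case=> _ H xw yw; have /connectP[s ps ly] := H w x y xw yw.
case/shortenP: ps ly => s' ps us _ ly; exists s'; split=> //.
- by apply: sub_path ps => a b /andP[].
- rewrite inE negb_or eq_sym xw /=; elim: s' (x) ps {us ly} => //= a r IH z.
  by case/andP=> /and3P[_ _ aw] /IH; rewrite inE negb_or eq_sym aw.
Qed.

Lemma third (a b : T) : 2 < #|T| -> exists c, c != a /\ c != b.
Proof.
move=> lt; have : 0 < #|~: [set a; b]|.
  by have := cardsC [set a; b]; rewrite cards2; case: (a != b) lt => /=; lia.
by case/card_gt0P => c; rewrite !inE negb_or => /andP[]; exists c.
Qed.

Lemma has_cycle : two_connected -> exists2 c, cycle e c & uniq c && (2 < size c).
Proof.
move=> tc; have lt : 2 < #|T| by case: tc.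
have /card_gt0P[u _] : 0 < #|T| by apply: leq_trans lt.
have step w y : u != w -> y != w -> y != u -> exists2 a, e u a & a != w.
  move=> uw yw yu; have [[|a s] [ps ly us ws]] := avoiding_path tc uw yw.
    by rewrite -ly eqxx in yu.
  exists a; first by case/andP: ps.
  by apply: contraNneq ws => <-; rewrite !inE eqxx orbT.
have [y1 [y1u _]] := third u u lt; have [w [wu wy]] := third u y1 lt.
have [a ua _] : exists2 a, e u a & a != w by apply: (@step w y1) => //; rewrite eq_sym.
have au : a != u by apply: contraTneq ua => ->; rewrite ie.
have [y2 [y2u y2a]] := third u a lt.
have [b ub ba] : exists2 b, e u b & b != a by apply: (@step a y2) => //; rewrite eq_sym.
have bu : b != u by apply: contraTneq ub => ->; rewrite ie.
have [s [ps ls us ws]] := avoiding_path tc au bu.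
exists (u :: a :: s); first by rewrite /= ua rcons_path ps ls se.
rewrite cons_uniq ws us /=; case: (s) ls => //= lab; by rewrite lab eqxx in ba.
Qed.

Definition ear c a b r := [/\ cycle e c, uniq (c ++ r) & a \in c] /\
  [/\ b \in c, a != b, seg a r b & ~ span (c ++ r)].

(** For a longest cycle, any ear will do: a spanning cycle of the cycle together with the ear would
    be longer. *)
Lemma has_ear : two_connected -> ~ ham e -> exists c a b r, ear c a b r.
Proof.
move=> tc nh; have lt : 2 < #|T| by case: tc.
pose P k := exists2 c, cycle e c & [&& uniq c, 2 < size c & k == #|T| - size c].
have [|k [c cc /and3P[uc szc /eqP kE]] mink] := @min_ex P.
  by have [c cc /andP[uc szc]] := has_cycle tc; exists (#|T| - size c), c => //; rewrite uc szc eqxx.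
have szT (s : seq T) : uniq s -> size s <= #|T|.
  by move/card_uniqP <-; apply: max_card.
have long c' : cycle e c' -> uniq c' -> 2 < size c' -> size c' <= size c.
  move=> cc' uc' sz'; have := mink (#|T| - size c').
  rewrite kE => H; have := H (ex_intro2 _ _ c' cc' _); rewrite uc' sz' eqxx => /(_ isT).
  by have := szT _ uc; have := szT _ uc'; clear; lia.
have [x xc] : exists x, x \notin c.
  have [/existsP[x xc]|all_in] := boolP [exists x, x \notin c]; first by exists x.
  case: nh; exists c; split; rewrite // /ucycle ?cc // => y.
  by apply: contraNT all_in => yc; apply/existsP; exists y.
have [u1 [w [r0 cE]]] : exists u1 w r0, c = u1 :: w :: r0.
  by case: (c) szc => [|u1 [|w r0]] // _; exists u1, w, r0.
have uw : u1 != w by move: uc; rewrite cE /= inE negb_or => /andP[/andP[]].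
have wc : w \in c by rewrite cE !inE eqxx orbT.
have xw : x != w by apply: contraNneq xc => ->.
have [_ conn] := tc.
have u1c : u1 \in c by rewrite cE mem_head.
(* The walk from the cycle to [x] avoids [w], so the foot [a] of the ear differs from [w]. A path
   from [b] to [w] avoiding [a] therefore returns to the cycle at another vertex. *)
have [a [b [ac bc /and3P[ab aw bw]]]] :=
  connect_cross (conn w u1 x uw xw) (P := [in c]) u1c xc.
have ba : b != a by apply: contraNneq bc => ->.
have wa : w != a by rewrite eq_sym.
have [s [ps ls us as_]] := avoiding_path tc ba wa.
have hs : has [in c] s.
  apply/hasP; exists w => //; case: (s) ls => [bw'|z s' /= <-]; last exact: mem_last.
  by move: bc; rewrite (bw' : b = w) wc.
have [r1 [v [r2 [sE vc al]]]] := first_split hs.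
have va : a != v.
  by apply: contraNneq as_ => ->; rewrite sE inE mem_cat mem_head !orbT.
have ucr : uniq (c ++ b :: r1).
  rewrite cat_uniq uc /= (negbTE bc) /=.
  have -> : has [in c] r1 = false by rewrite -[has _ _]negbK -all_predC al.
  by apply: (uniq_part (s1 := b :: r1) (s2 := v :: r2) us); rewrite sE.
exists c, a, v, (b :: r1); do 2![split=> //].
- rewrite seg_cons ab /=; move: ps; rewrite sE cat_path /= => /and3P[p1 p2 _].
  by rewrite seg_end p1.
- case=> c' cc' pc'; have := long c' cc'; rewrite (perm_uniq pc') (perm_size pc') ucr.
  rewrite size_cat /= addnS => /(_ isT) H.
  have /H : 2 < (size c + size r1).+1 by rewrite (leq_trans szc) // leqW // leq_addr.
  by rewrite ltnNge leq_addr.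
Qed.

Lemma has_min_theta : two_connected -> ~ ham e ->
  exists u v q1 q2 p, min_theta u v q1 q2 p.
Proof.
move=> tc nh; have [c0 [a0 [b0 [r0 E0]]]] := has_ear tc nh.
(* Since [size r] is at most [#|T|], this number orders the pairs of total order and ear length
   lexicographically. *)
pose m (c r : seq T) := (size c + size r) * #|T|.+1 + size r.
pose P k := exists c a b r, ear c a b r /\ k = m c r.
have [|k [c [a [b [r [er kE]]]]] mink] := @min_ex P.
  by exists (m c0 r0), c0, a0, b0, r0.
have [[cc ucr ac] [bc ab sr nsp]] := er.
have [i c' cE] := rot_to ac.
have : b \in a :: c' by rewrite -cE mem_rot.
rewrite inE eq_sym (negbTE ab) /= => bc'.
case/splitPr: bc' cE => q1 q2 cE.
have pm : perm_eq (a :: b :: q1 ++ q2 ++ r) (c ++ r).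
  have : perm_eq (a :: b :: q1 ++ q2 ++ r) ((a :: q1 ++ b :: q2) ++ r) by perm_count.
  by move/perm_trans; apply; rewrite perm_cat2r -cE perm_rot.
have : seg a (q1 ++ b :: q2) a by rewrite -[seg _ _ _]/(cycle e (a :: q1 ++ b :: q2)) -cE rot_cycle.
rewrite seg_cat => /andP[s1 s2].
exists a, b, q1, q2, r; split.
- by split=> //; rewrite (perm_uniq pm).
- by move=> sp; apply: nsp; apply: span_perm sp.
- move=> c1 a1 b1 r1 h1 h2 h3 h4 h5 h6 h7.
  have /mink : P (m c1 r1) by exists c1, a1, b1, r1.
  rewrite (perm_size pm) size_cat kE /m.
  have r1T : size r1 <= #|T|.
    by move: h2; rewrite cat_uniq => /and3P[_ _ /card_uniqP <-]; apply: max_card.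
  move=> le; have {nsp}H (N N' x y : nat) : N * #|T|.+1 + x <= N' * #|T|.+1 + y -> y <= #|T| ->
      N <= N' /\ (N = N' -> x <= y); last exact: H le r1T.
    clear => le yM.
    split; last by move=> E; move: le; rewrite E leq_add2l.
    rewrite leqNgt; apply/negP => lt; have : N'.+1 * #|T|.+1 <= N * #|T|.+1.
      by rewrite leq_mul2r lt orbT.
    by rewrite mulSn; move: (N' * _) (N * _) le => A B; lia.
Qed.

End Theta.

(** * Induced subgraphs of the closure and of the graph *)

Section InducedPaths.
Variables (T : finType) (e : rel T).
Hypotheses (se : symmetric e) (ie : irreflexive e).
Implicit Types (x y z : T) (s r : seq T).

Definition nadj y z := ~~ e y z && (z != y).

Lemma nadjE y z : nadj y z = ~~ e y z && (z != y).
Proof. by []. Qed.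

Lemma nadj_sym y z : nadj y z = nadj z y.
Proof. by rewrite /nadj se eq_sym. Qed.

Lemma ipath_cons x y s : ipath e x (y :: s) = [&& e x y, all (nadj x) s & ipath e y s].
Proof. by []. Qed.

Definition far s r := all (fun y => all (fun z => ~~ e y z && (z != y)) r) s.

Lemma farP s r : reflect (forall y z, y \in s -> z \in r -> ~~ e y z /\ z != y) (far s r).
Proof.
apply: (iffP allP) => [H y z ys zr|H y ys].
  by have /allP/(_ z zr)/andP := H y ys.
by apply/allP => z zr; apply/andP; apply: H.
Qed.

Lemma far_cons y s r : far (y :: s) r = all (nadj y) r && far s r.
Proof. by []. Qed.

Lemma far_nil r : far [::] r. Proof. by []. Qed.

Lemma far_sym s r : far s r = far r s.
Proof. by apply/farP/farP => H y z ys zr; have [] := H z y zr ys; rewrite se eq_sym. Qed.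

Lemma ipath_cat x s r : ipath e x (s ++ r) =
  [&& ipath e x s, ipath e (last x s) r & far (belast x s) r].
Proof.
elim: s x => [|y s IH] x /=; first by rewrite andbT.
rewrite all_cat IH /=; case: (e x y) => //=.
case: (all _ s) => //=; case: (ipath e y s) => /=; last by rewrite andbF.
by rewrite andbCA.
Qed.

Lemma ipath_take n x s : ipath e x s -> ipath e x (take n s).
Proof. by rewrite -{1}(cat_take_drop n s) ipath_cat => /and3P[]. Qed.

Lemma ipath_uniq x s : ipath e x s -> uniq (x :: s).
Proof.
elim: s x => //= y s IH x /and3P[xy /allP al /IH /=-> ]; rewrite andbT inE negb_or.
rewrite (contraTneq _ xy) => [|->]; last by rewrite ie.
by apply/negP => /al; rewrite eqxx andbF.
Qed.

Lemma ipath_rev x s : ipath e (last x s) (rev (belast x s)) = ipath e x s.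
Proof.
elim: s x => //= y s IH x; rewrite rev_cons -cats1 ipath_cat IH.
have -> : last (last y s) (rev (belast y s)) = y.
  by case: s {IH} => //= z s; rewrite rev_cons last_rcons.
rewrite /= se andbT andbCA; congr (_ && _); rewrite andbC; congr (_ && _).
have -> : far (belast (last y s) (rev (belast y s))) [:: x] = far s [:: x].
  apply: perm_all.
  have : perm_eq (last y s :: rev (belast y s)) (y :: s).
    by rewrite -rev_rcons -lastI perm_rev.
  rewrite lastI; have -> : last (last y s) (rev (belast y s)) = y.
    by case: s {IH} => //= z s; rewrite rev_cons last_rcons.
  by rewrite perm_rcons perm_cons.
by rewrite far_sym /far /= andbT.
Qed.

Lemma ipath_split x s s1 a s2 : ipath e x s -> x :: s = s1 ++ a :: s2 ->
  [/\ ipath e a (rev s1), ipath e a s2, far s1 s2 &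
      forall s1' a', s1 = rcons s1' a' -> e a' a].
Proof.
case: s1 => [|x' s1] ip [xE sE].
  by rewrite -xE -sE; split=> // -[].
subst x' s; move: ip; rewrite -cat_rcons ipath_cat last_rcons belast_rcons => /and3P[ip1 ip2 f].
split=> //; first by have := ipath_rev x (rcons s1 a); rewrite last_rcons belast_rcons => ->.
move=> s1' a' E; move: ip1; rewrite -cats1 ipath_cat /= andbT => /and3P[_ + _].
by have := congr1 (last a) E; rewrite last_rcons /= => <-.
Qed.

(* A triangle with an induced path hanging from each vertex: the net is the case of
   lengths 1, 1, 1 and the wounded graph that of lengths 2, 1, 0. *)
Definition tripod x1 s1 x2 s2 x3 s3 :=
  [/\ [/\ ipath e x1 s1, ipath e x2 s2 & ipath e x3 s3],
      [/\ e x1 x2, e x1 x3 & e x2 x3],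
      [/\ far s1 (x2 :: s2), far s1 (x3 :: s3) & far s2 (x3 :: s3)] &
      [/\ far [:: x1] s2, far [:: x1] s3 & far [:: x2] s3]].

End InducedPaths.

(** * Refining cliques and induced paths of the closure in the graph *)

Section PullBack.
Variables (T : finType) (g e : rel T).
Hypotheses (sg : symmetric g) (ig : irreflexive g) (chg : claw_heavy g).
Hypotheses (se : symmetric e) (ie : irreflexive e) (sub : subrel g e).
Hypothesis alpha2 : forall v x y z, e v x -> e v y -> e v z ->
  x != y -> x != z -> y != z -> [|| e x y, e x z | e y z].
Hypothesis tr : nbhd_trans e.
Hypothesis hK : forall x y, heavy g x -> heavy g y -> x != y -> e x y.
Hypothesis jn : forall x y, e x y -> joined g e x y.
Implicit Types (x y z w : T) (s r : seq T).

Local Notation within := (common_nbhd e).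

Lemma within_l x y : e x y -> within x y x.
Proof. by rewrite /common_nbhd eqxx /= se => ->; rewrite orbT. Qed.

Lemma within_r x y : e x y -> within x y y.
Proof. by rewrite /common_nbhd eqxx /= andbT => ->; rewrite orbT. Qed.

Lemma within_clique x y z a : e x y -> within x y z -> within x y a -> z != a -> e z a.
Proof.
move=> xy /andP[xz zy] /andP[xa ya] za.
case/orP: xz => [/eqP zx|xz].
  by case/orP: xa => [/eqP ax|]; [rewrite zx ax eqxx in za|rewrite zx].
case/orP: xa => [/eqP->|xa]; first by rewrite se.
case/orP: zy => [/eqP zy|yz].
  by case/orP: ya => [/eqP ay|]; [rewrite zy ay eqxx in za|rewrite zy].
case/orP: ya => [/eqP->|ya]; first by rewrite se.
by apply: (@tr x z y a) => //; rewrite 1?se.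
Qed.

(** Transitivity inside the neighbourhoods of [z] and [a]; it means that distinct maximal cliques
    share at most one vertex. *)
Lemma clique_ext x y z a f : e x y -> within x y z -> within x y a -> z != a ->
  e z f -> e a f -> within x y f.
Proof.
move=> xy Dz Da za zf af; have eza := within_clique xy Dz Da za.
have H t : (z == t) || e t z -> (a == t) || e t a -> (f == t) || e t f.
  have [//|ft] := eqVneq f t.
  move=> /orP[/eqP <-//|tz] /orP[/eqP <-//|ta].
  by rewrite se; apply: (@tr z f a t) => //; rewrite 1?se.
by move: Dz Da => /andP[xz yz] /andP[xa ya]; apply/andP; split; apply: H.
Qed.

Lemma within_change x y a b z : e x y -> within x y a -> within x y b -> a != b ->
  within a b z = within x y z.
Proof.
move=> xy Da Db ab; have eab := within_clique xy Da Db ab.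
apply/idP/idP.
  case/andP=> /orP[/eqP->//|az] /orP[/eqP->//|bz].
  exact: (clique_ext xy Da Db ab).
move=> Dz; apply/andP; split.
  have [//|za] := eqVneq z a; rewrite se; exact: (within_clique xy).
have [//|zb] := eqVneq z b; rewrite se; exact: (within_clique xy).
Qed.

Lemma outside_far x y a f z : e x y -> within x y a -> e a f -> ~~ within x y f ->
  within x y z -> z != a -> ~~ e f z /\ z != f.
Proof.
move=> xy Da af nf Dz za; split; last by apply: contraNneq nf => <-.
by apply: contraNN nf => fz; apply: (clique_ext xy Dz Da za) => //; rewrite se.
Qed.

(** The first step of the path refining [z f] will do: it equals or sees [f], so if it lay in the
    clique, [clique_ext] would pull [f] in. *)
Lemma outside_nbr x y z f : e x y -> within x y z -> e z f -> ~~ within x y f ->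
  exists2 f', g z f' & ~~ within x y f'.
Proof.
move=> xy Dz zf nf; have [[|f' p] [pp pl al]] := jn zf.
  by move: nf; rewrite -(pl : z = f) Dz.
move: al => /= /and3P[_ /andP[zf' ff'] _].
have gzf : g z f' by case/andP: pp.
exists f' => //; apply: contraNN nf => Df'.
have zf'n : z != f' by apply: contraTneq gzf => ->; rewrite ig.
case/orP: ff' => [/eqP <-//|ff'].
by apply: (clique_ext xy Dz Df' zf'n) => //; rewrite se.
Qed.

(** The leaves [a], [b], [f] form a claw of [g] at [z]. A heavy [f] would be adjacent in [e] to
    whichever of [a], [b] is heavy, which [outside_far] excludes, so the two heavy leaves are [a]
    and [b]. *)
Lemma claw_port x y z a b f : e x y -> within x y z -> within x y a -> within x y b ->
  g z a -> g z b -> a != b -> ~~ g a b -> g z f -> ~~ within x y f ->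
  heavy g a /\ heavy g b.
Proof.
move=> xy Dz Da Db za zb ab nab zf nf.
have far1 t : within x y t -> t != z -> ~~ e t f /\ t != f.
  by move=> Dt tz; rewrite se; apply: (outside_far xy Dz (sub zf)).
have az : a != z by apply: contraTneq za => ->; rewrite ig.
have bz : b != z by apply: contraTneq zb => ->; rewrite ig.
have [af anf] := far1 a Da az; have [bf bnf] := far1 b Db bz.
have N (q t : T) : ~~ e q t -> ~~ g q t by apply: contraNN; apply: sub.
have := chg za zb zf ab anf bnf nab (N _ _ af) (N _ _ bf).
rewrite /two_of; case ha: (heavy g a); case hb: (heavy g b); case hf: (heavy g f) => //= _.
  by rewrite (hK ha hf anf) in af.
by rewrite (hK hb hf bnf) in bf.
Qed.

Definition simplicial x y z := within x y z && [forall t, e z t ==> within x y t].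

(** If no common neighbour were simplicial, each could choose a neighbour outside the clique. The
    choice is injective by [clique_ext] and lands among the vertices that neither [h1] nor [h2]
    sees, which are too few by [card_nbr_union]. *)
Lemma heavy_pair_common h1 h2 : heavy g h1 -> heavy g h2 -> h1 != h2 -> ~~ g h1 h2 ->
  exists w, [/\ g h1 w, g h2 w & simplicial h1 h2 w].
Proof.
move=> H1 H2 h12 n12.
have n21 : ~~ g h2 h1 by rewrite sg.
have eh := hK H1 H2 h12.
set W := [set w | g h1 w] :&: [set w | g h2 w].
set Z := ~: [set w | (g h1 w || g h2 w) || (w \in [set h1; h2])].
have cW : #|Z| < #|W|.
  by have := card_nbr_union ig h12 n12 n21; rewrite -/W -/Z; move: H1 H2; rewrite /heavy; clear; lia.
have [/existsP[w /andP[]]|none] := boolP [exists w, (w \in W) && simplicial h1 h2 w].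
  by rewrite !inE => /andP[h1w h2w] sw; exists w.
pose F w := odflt w [pick t | e w t && ~~ within h1 h2 t].
have FP w : w \in W -> e w (F w) && ~~ within h1 h2 (F w).
  move=> wW; rewrite /F; case: pickP => //= no; case/negP: none; apply/existsP; exists w.
  rewrite wW /= /simplicial; move: wW; rewrite !inE => /andP[h1w h2w].
  rewrite /common_nbhd (sub h1w) (sub h2w) !orbT /=.
  by apply/forallP => t; apply/implyP => wt; move: (no t); rewrite wt /= => /negbFE.
have DW w : w \in W -> within h1 h2 w.
  by rewrite !inE => /andP[h1w h2w]; rewrite /common_nbhd (sub h1w) (sub h2w) !orbT.
have Fi : {in W &, injective F}.
  move=> w w' wW w'W E; apply/eqP/negPn/negP => ww.
  have /andP[wf nf] := FP w wW; have /andP[wf' _] := FP w' w'W.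
  by case/negP: nf; apply: (clique_ext eh (DW w wW) (DW w' w'W) ww) => //; rewrite E.
have FZ : F @: W \subset Z.
  apply/subsetP => f /imsetP[w wW ->]; have /andP[wf nf] := FP w wW.
  move: (wW); rewrite !inE => /andP[h1w h2w].
  have k h : g h w -> within h1 h2 h -> ~~ g h (F w) /\ F w != h.
    move=> hw Dh; split; last by apply: contraNneq nf => ->.
    have hwn : h != w by apply: contraTneq hw => ->; rewrite ig.
    by apply: contraNN nf => hf; apply: (clique_ext eh Dh (DW w wW) hwn) => //; apply: sub.
  have [a1 b1] := k h1 h1w (within_l eh); have [a2 b2] := k h2 h2w (within_r eh).
  by rewrite !negb_or a1 a2 b1 b2.
by have := subset_leq_card FZ; rewrite (card_in_imset Fi) leqNgt cW.
Qed.

Lemma simplicial_change x y a b z : e x y -> within x y a -> within x y b -> a != b ->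
  simplicial a b z -> simplicial x y z.
Proof.
move=> xy Da Db ab /andP[Dz /forallP H]; apply/andP; split.
  by rewrite -(within_change z xy Da Db ab).
by apply/forallP => t; move: (H t); rewrite (within_change t xy Da Db ab).
Qed.

Lemma not_simplicial x y z : within x y z -> ~~ simplicial x y z ->
  exists2 f, e z f & ~~ within x y f.
Proof.
move=> Dz; rewrite /simplicial Dz /= negb_forall => /existsP[f].
by rewrite negb_imply => /andP[zf nf]; exists f.
Qed.

(** Among the shortest paths of [g] inside the clique, one with the fewest non-simplicial vertices
    is taken. At a non-simplicial inner vertex, [claw_port] makes both path neighbours heavy, and
    [heavy_pair_common] supplies a simplicial replacement. *)
Lemma simplicial_path x y : e x y ->
  exists i, ipath g x (rcons i y) /\ {in i, forall z, simplicial x y z}.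
Proof.
move=> xy.
pose W p := [/\ path g x p, last x p = y & all (within x y) (x :: p)].
have [|n [p0 Wp0 sz0] minn] := @min_ex (fun k => exists2 p, W p & size p = k).
  by have [p Wp] := jn xy; exists (size p), p.
have ip p : W p -> size p = n -> ipath g x p.
  move=> Wp szp; have [pp pl al] := Wp.
  have shorter p' : path g x p' -> last x p' = y -> {subset p' <= p} -> size p <= size p'.
    move=> pp' pl' sb; rewrite szp; apply: minn; exists p' => //; split=> //.
    apply/allP => z; rewrite inE => /orP[/eqP->|/sb zp]; first exact: within_l.
    by apply: (allP al); rewrite inE zp orbT.
  have up : uniq (x :: p).
    move: pl; case: (shortenP pp) => p' pp' up' sb pl.
    have le := shorter p' pp' pl sb; move: (up') => /= /andP[xp' up''].
    have [_ E] := uniq_min_size up'' sb le.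
    by rewrite -E xp' (leq_size_uniq up'' sb le).
  apply/negPn/negP => /(not_ipath pp up)[s1 [a [m [b [s2 [E mn ab]]]]]].
  case: s1 E => [|x' s1] [Ex E].
    have : size p <= size (b :: s2).
      apply: shorter.
      - by move: pp; rewrite E cat_path /= => /and3P[_ _ ->]; rewrite Ex ab.
      - by rewrite -pl E last_cat.
      - by move=> z zi; rewrite E mem_cat zi orbT.
    rewrite E size_cat /=; case: (m) mn => //= c m' _.
    by move: (size m') (size s2); clear; lia.
  have : size p <= size (s1 ++ a :: b :: s2).
    apply: shorter.
    - move: pp; rewrite E !cat_path /= cat_path /= ab.
      by case/and3P=> -> -> /and3P[_ _ ->].
    - by rewrite -pl E !last_cat /= last_cat.
    - move=> z; rewrite E !mem_cat !inE mem_cat inE.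
      by case/or4P=> -> //; rewrite ?orbT.
  rewrite E !size_cat /= size_cat /=; case: (m) mn => //= c m' _.
  by move: (size s1) (size m') (size s2); clear; lia.
have [|k [p [Wp szp] kE] mink] :=
    @min_ex (fun k => exists2 p, W p /\ size p = n & count (predC (simplicial x y)) p = k).
  by exists (count (predC (simplicial x y)) p0), p0.
have [pp pl al] := Wp.
have ipp := ip p Wp szp.
case: (lastP p) pl pp ipp al Wp szp kE => [|i y'] pl pp ipp al Wp szp kE.
  by rewrite (pl : x = y) ie in xy.
move: pl; rewrite last_rcons => yE; subst y'.
exists i; split=> // z zi; apply/negPn/negP => nz.
have Dz : within x y z by apply: (allP al); rewrite inE mem_rcons inE zi !orbT.
case/splitPr: zi pp ipp al Wp szp kE => i1 i3 pp ipp al Wp szp kE.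
have [b [i4 E4]] : exists b i4, rcons i3 y = b :: i4.
  by case: (i3) => [|b i4]; [exists y, [::]|exists b, (rcons i4 y)].
have pE : rcons (i1 ++ z :: i3) y = i1 ++ z :: b :: i4 by rewrite rcons_cat rcons_cons E4.
move: ipp; rewrite pE ipath_cat /= => /and3P[ip1 /and4P[az /andP[/andP[nab bna] _] zb _] _].
set a := last x i1 in az nab bna.
have Da : within x y a.
  apply: (allP al); rewrite pE -cat_cons mem_cat mem_last //.
have Db : within x y b by apply: (allP al); rewrite pE !(inE, mem_cat) eqxx !orbT.
have [f zf nf] := not_simplicial Dz nz.
have [f' zf' nf'] := outside_nbr xy Dz zf nf.
rewrite sg in az; rewrite eq_sym in bna.
have [ha hb] := claw_port xy Dz Da Db az zb bna nab zf' nf'.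
have [w [aw bw sw]] := heavy_pair_common ha hb bna nab.
have sw' := simplicial_change xy Da Db bna sw.
have Dw : within x y w by case/andP: sw'.
have : k <= count (predC (simplicial x y)) (i1 ++ w :: b :: i4).
  apply: mink; exists (i1 ++ w :: b :: i4) => //; split.
    split.
    - move: pp; rewrite pE !cat_path /= => /and4P[-> _ _ ->].
      by rewrite -/a aw sg bw.
    - have := congr1 (last x) pE; rewrite last_rcons !last_cat /= => <- //.
    - move: al; rewrite pE /= !all_cat /= => /and5P[-> -> _ -> ->].
      by rewrite Dw.
  by rewrite -szp pE !size_cat.
rewrite -kE pE !count_cat /= nz sw' /= leq_add2l add0n add1n.
by rewrite ltnn.
Qed.

Definition dominated y z := forall t, (t == y) || e y t -> (t == z) || e z t.

(* How an induced path of the closure controls its refinement in [g]: the new vertices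
   have no neighbours that their shadows lack. *)
Definition shadow s r := {in s, forall y, exists2 z, z \in r & dominated y z}.

Lemma dominated_far y z t : dominated y z -> ~~ e z t -> t != z -> ~~ e y t /\ t != y.
Proof.
move=> dy zt tz; have := dy t; rewrite (negbTE zt) (negbTE tz) /= => H.
by split; apply/negP => h; apply: notF; apply: H; rewrite h ?orbT.
Qed.

Lemma simplicial_dominated x y z : simplicial x y z -> dominated z x /\ dominated z y.
Proof.
case/andP=> Dz /forallP H; split=> t /orP[/eqP->|zt]; try by case/andP: Dz.
  by move: (H t); rewrite zt => /= /andP[].
by move: (H t); rewrite zt => /= /andP[].
Qed.

(** The refined edges are concatenated. New vertices are dominated by the ends of their edge, so no
    chord arises; cutting to the old length keeps the path induced. *)
Lemma leg x s : ipath e x s -> exists r, [/\ size r = size s, ipath g x r & shadow r s].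
Proof.
elim: s x => [|x1 s IH] x; first by exists [::].
move=> /= /and3P[xx1 /allP fx ip1].
have [r [szr ipr shr]] := IH x1 ip1.
have [i [ipi simi]] := simplicial_path xx1.
exists (take (size s).+1 (rcons i x1 ++ r)); split.
- rewrite size_takel // size_cat size_rcons szr addSn ltnS leq_addl //.
- apply: ipath_take; rewrite ipath_cat ipi last_rcons ipr /=.
  apply/farP => y z; rewrite belast_rcons inE => yi zr.
  have [z' z's dz] := shr z zr.
  have /andP[xz' z'x] := fx z' z's.
  have dy : dominated y x.
    case/orP: yi => [/eqP-> t //|/simi sy].
    by have [] := simplicial_dominated sy.
  have nz : ~~ ((z == y) || e y z).
    apply/negP => /dy h; have /dz : (x == z) || e z x.
      by case/orP: h => [/eqP->|h]; rewrite ?eqxx // [e z x]se h orbT.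
    by rewrite eq_sym (negbTE z'x) se (negbTE xz').
  by split; [apply: contraNN nz => /sub->; rewrite orbT|apply: contraNN nz => ->].
- move=> y /mem_take; rewrite mem_cat mem_rcons inE -orbA => /or3P[/eqP->|/simi sy|yr].
  + by exists x1; rewrite ?mem_head // => t.
  + by exists x1; rewrite ?mem_head //; have [] := simplicial_dominated sy.
  + by have [z zs d] := shr y yr; exists z; rewrite // inE zs orbT.
Qed.

(** * Triangles with hanging paths at a clique with at most one heavy vertex *)

(* A maximal clique of the closure is the set [within x y] for any two of its vertices;
   since the heavy vertices form a clique, at most one maximal clique has two of them. *)
Definition nonbig x y :=
  forall a b, within x y a -> within x y b -> heavy g a -> heavy g b -> a = b.

Definition port x y z := within x y z /\ exists2 f, e z f & ~~ within x y f.

Lemma port_clique x y z a b : e x y -> nonbig x y -> port x y z ->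
  within x y a -> within x y b -> g z a -> g z b -> a != b -> g a b.
Proof.
move=> xy nb [Dz [f zf nf]] Da Db za zb ab; apply/negPn/negP => nab.
have [f' zf' nf'] := outside_nbr xy Dz zf nf.
have [ha hb] := claw_port xy Dz Da Db za zb ab nab zf' nf'.
by rewrite (nb a b Da Db ha hb) eqxx in ab.
Qed.

Lemma nonbig_claw x y z a b c : e x y -> nonbig x y ->
  within x y a -> within x y b -> within x y c -> g z a -> g z b -> g z c ->
  a != b -> a != c -> b != c -> [|| g a b, g a c | g b c].
Proof.
move=> xy nb Da Db Dc za zb zc ab ac bc.
case nab: (g a b) => //; case nac: (g a c) => //; case nbc: (g b c) => //.
have := chg za zb zc ab ac bc; rewrite nab nac nbc => /(_ isT isT isT).
rewrite /two_of; case ha: (heavy g a); case hb: (heavy g b); case hc: (heavy g c) => //= _.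
- by rewrite (nb a b Da Db ha hb) eqxx in ab.
- by rewrite (nb a b Da Db ha hb) eqxx in ab.
- by rewrite (nb a c Da Dc ha hc) eqxx in ac.
- by rewrite (nb b c Db Dc hb hc) eqxx in bc.
Qed.

Definition inner_leg x y t l z := [/\ last t l = z, {in t :: l, forall w, within x y w} &
  {in belast t l, forall w, simplicial x y w}].

Lemma port_not_simplicial x y z : port x y z -> ~~ simplicial x y z.
Proof.
move=> [Dz [f zf nf]]; rewrite /simplicial negb_and negb_forall; apply/orP; right.
by apply/existsP; exists f; rewrite negb_imply zf.
Qed.

(** A simplicial path [S] joins [x1] to [x2], and a second one from [x3] is followed until its first
    vertex [q] in or next to [S]. In the absence of claws, [q] sees exactly two consecutive vertices
    [a], [b] of [S], and these three form the triangle. *)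
Lemma ports_tripod x1 x2 x3 : e x1 x2 -> nonbig x1 x2 ->
  port x1 x2 x1 -> port x1 x2 x2 -> port x1 x2 x3 -> x3 != x1 -> x3 != x2 ->
  exists t1 l1 t2 l2 t3 l3, tripod g t1 l1 t2 l2 t3 l3 /\
    [/\ inner_leg x1 x2 t1 l1 x1, inner_leg x1 x2 t2 l2 x2 & inner_leg x1 x2 t3 l3 x3].
Proof.
move=> x12 nb po1 po2 po3 x31 x32.
have [i [ipi simi]] := simplicial_path x12.
have [D3 _] := po3.
have [D1 D2] : within x1 x2 x1 /\ within x1 x2 x2 by rewrite within_l ?within_r.
have Di z : z \in x1 :: rcons i x2 -> within x1 x2 z.
  rewrite inE mem_rcons inE => /or3P[/eqP->|/eqP->|/simi/andP[]] //.
have x3S : x3 \notin x1 :: rcons i x2.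
  rewrite inE mem_rcons inE (negbTE x31) (negbTE x32) /=.
  by apply/negP => /simi sx; have := port_not_simplicial po3; rewrite sx.
have x31e : e x3 x1 by apply: (within_clique x12).
have [j [ipj simj0]] := simplicial_path x31e.
have simj : {in j, forall z, simplicial x1 x2 z}.
  by move=> z /simj0; apply: simplicial_change.
pose S := x1 :: rcons i x2.
pose P := fun z => (z \in S) || has (g z) S.
have hP : has P (x3 :: rcons j x1).
  by apply/hasP; exists x1; rewrite ?inE ?mem_rcons ?inE ?eqxx ?orbT // /P mem_head.
have [r1 [q [r2 [RE Pq al]]]] := first_split hP.
have DR z : z \in r1 ++ [:: q] -> z != x1 -> z = x3 \/ simplicial x1 x2 z.
  move=> zr zx; have : z \in x3 :: rcons j x1.
    by rewrite RE; move: zr; rewrite !mem_cat !inE => /orP[]->; rewrite ?orbT.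
  rewrite inE mem_rcons inE (negbTE zx) /= => /orP[/eqP->|/simj]; by [left|right].
have r1P z : z \in r1 -> z \notin S /\ forall y, y \in S -> ~~ g z y.
  move=> /(allP al) /=; rewrite /P negb_or => /andP[-> /hasPn H]; split=> // y /H.
have [ipq _ _ gq] := ipath_split sg ipj RE.
have qS : q \notin S.
  case: (lastP r1) RE r1P gq => [[<- _] _ _|r1' q' _ r1P gq] //.
  have q'r : q' \in rcons r1' q' by rewrite mem_rcons mem_head.
  apply/negP => qS; have [_ H] := r1P q' q'r.
  by have := H _ qS; rewrite (gq r1' q').
have x1S : x1 \in S by rewrite mem_head.
have qx1 : q != x1 by apply: contraNneq qS => ->.
have Dq : within x1 x2 q.
  by case: (DR q _ qx1) => [|->|/andP[]] //; rewrite mem_cat mem_head orbT.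
have Dr z : z \in r1 -> within x1 x2 z.
  move=> zr; have [zS _] := r1P z zr.
  have zx1 : z != x1 by apply: contraNneq zS => ->.
  by case: (DR z _ zx1) => [|->|/andP[]] //; rewrite mem_cat zr.
have hq : has (g q) S by move: Pq; rewrite /P (negbTE qS).
have [s1 [a [s2 [SE qa als]]]] := first_split hq.
have s1q z : z \in s1 -> ~~ g q z by move/(allP als).
have [ip1 ip2 f12 ga] := ipath_split sg ipi SE.
have uS : uniq S by apply: ipath_uniq ipi.
have Ds z : z \in s1 ++ a :: s2 -> within x1 x2 z by rewrite -SE; apply: Di.
have qn z : z \in S -> q != z by move=> zS; apply: contraNneq qS => ->.
have aS : a \in S by rewrite SE mem_cat mem_head orbT.
have s1S z : z \in s1 -> z \in S by move=> zs; rewrite SE mem_cat zs.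
have s2S z : z \in s2 -> z \in S by move=> zs; rewrite SE mem_cat inE zs !orbT.
have Da : within x1 x2 a by apply: Di.
(* The first neighbour [a] of [q] is not the end [x2]: the port property there would make [q]
   adjacent to the vertex before [a]. *)
case: s2 SE ip2 f12 Ds s2S => [|b s2] SE ip2 f12 Ds s2S.
  have aE : a = x2.
    by have := congr1 (last x1) SE; rewrite last_cat /= last_rcons => <-.
  case: (lastP s1) SE s1q ga s1S => [|s1' a'] SE s1q ga s1S.
    by have := congr1 size SE; rewrite /S /= size_rcons.
  have a's : a' \in rcons s1' a' by rewrite mem_rcons mem_head.
  have gaa : g a a' by rewrite sg (ga s1' a').
  have : g a' q.
    have poa : port x1 x2 a by rewrite aE.
    apply: (port_clique x12 nb poa) => //.
    - exact: Di (s1S _ a's).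
    - by rewrite sg.
    - by rewrite eq_sym qn ?s1S.
  by rewrite sg (negbTE (s1q _ a's)).
have /= /and3P[ab /allP far_a ipb] := ip2.
have bS : b \in S by apply: s2S; rewrite mem_head.
have Db := Di b bS.
have aq : g a q by rewrite sg.
have bq : g b q.
  case: (lastP s1) SE s1q ga s1S f12 => [|s1' a'] SE s1q ga s1S f12.
    have ax1 : a = x1 by case: SE.
    have poa : port x1 x2 a by rewrite ax1.
    by rewrite sg; apply: (port_clique x12 nb poa); rewrite // qn.
  have a's : a' \in rcons s1' a' by rewrite mem_rcons mem_head.
  have /farP/(_ a' b a's (mem_head b s2))[na'b ba'] := f12.
  have := @nonbig_claw x1 x2 a a' b q x12 nb (Di _ (s1S _ a's)) Db Dq.
  rewrite [g a a']sg (ga s1' a') // ab aq (eq_sym a' b) ba' !(eq_sym _ q) (qn b bS) (qn a' (s1S _ a's)).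
  move=> /(_ isT isT isT isT isT isT).
  by rewrite (negbTE na'b) [g a' q]sg (negbTE (s1q _ a's)).
have s2q c : c \in s2 -> ~~ g q c.
  move=> cs; apply/negP => qc; have /andP[nac ca] := far_a c cs.
  have cS : c \in S by apply: s2S; rewrite inE cs orbT.
  case: (lastP r1) RE r1P gq Dr => [|r1' q'] RE r1P gq Dr.
    have qx3 : q = x3 by case: RE.
    rewrite qx3 in qa qc; move: nac; rewrite (port_clique x12 nb po3 Da (Di _ cS)) //.
    by rewrite eq_sym.
  have q'r : q' \in rcons r1' q' by rewrite mem_rcons mem_head.
  have [q'S nq'] := r1P q' q'r.
  have := @nonbig_claw x1 x2 q q' a c x12 nb (Dr _ q'r) Da (Di _ cS).
  rewrite [g q q']sg (gq r1' q') // qa qc => /(_ isT isT isT).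
  rewrite (contraNneq _ q'S) => [|->//]; rewrite (contraNneq _ q'S) => [|->//].
  rewrite eq_sym ca => /(_ isT isT isT).
  by rewrite (negbTE nac) (negbTE (nq' _ aS)) (negbTE (nq' _ cS)).
have x1x2 : x1 != x2 by apply: contraTneq x12 => ->; rewrite ie.
exists a, (rev s1), b, s2, q, (rev r1); split.
  split.
  - by split.
  - by split.
  - split; apply/farP => y z.
    + by rewrite mem_rev => ys zs; move/farP: f12; apply.
    + rewrite mem_rev inE mem_rev => ys /orP[/eqP->|zr].
        by rewrite sg s1q // qn ?s1S.
      have [zS nz] := r1P z zr; rewrite sg nz ?s1S //; split=> //.
      by apply: contraNneq zS => ->; apply: s1S.
    + have yS : y \in s2 -> y \in S by move=> ys; apply: s2S; rewrite inE ys orbT.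
      rewrite inE mem_rev => ys /orP[/eqP->|zr].
        by rewrite sg s2q // qn ?yS.
      have [zS nz] := r1P z zr; rewrite sg nz ?yS //; split=> //.
      by apply: contraNneq zS => ->; apply: yS.
  - split; apply/farP => y z; rewrite inE => /eqP->.
    + by move/far_a/andP.
    + rewrite mem_rev => zr; have [zS nz] := r1P z zr; rewrite sg nz //; split=> //.
      by apply: contraNneq zS => ->.
    + rewrite mem_rev => zr; have [zS nz] := r1P z zr; rewrite sg nz //; split=> //.
      by apply: contraNneq zS => ->.
have mid z : z \in S -> z != x1 -> z != x2 -> simplicial x1 x2 z.
  by rewrite inE mem_rcons inE => /or3P[/eqP->|/eqP->|/simi //]; rewrite eqxx.
have lastS : last a (b :: s2) = x2.
  by have := congr1 (last x1) SE; rewrite last_cat /= last_rcons => <-.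
have x2s : x2 \in b :: s2 by rewrite -lastS /= mem_last.
have us : uniq (s1 ++ a :: b :: s2) by rewrite -SE.
have dis y z : y \in s1 ++ [:: a] -> z \in b :: s2 -> y != z.
  move=> ys zs; move: us; rewrite -cat_rcons cat_uniq => /and3P[_ /hasPn H _].
  by apply: contraTneq ys => ->; rewrite cats1 H.
split; split.
- by case: (s1) SE => [|y r] [-> _] //; rewrite last_rev_cons.
- move=> w; rewrite inE mem_rev => /orP[/eqP->//|ws].
  by apply: Di; apply: s1S.
- case: s1 SE dis s1S us {ip1 f12 ga s1q als Ds} => [|x1' r] SE dis s1S us // w.
  have x1E : x1' = x1 by case: SE.
  rewrite rev_cons belast_rcons inE mem_rev => wr.
  have wS : w \in S by case/orP: wr => [/eqP->//|wr]; apply: s1S; rewrite inE wr orbT.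
  apply: mid => //; last first.
    by apply: dis => //; rewrite mem_cat !inE; case/orP: wr => ->; rewrite !orbT.
  move: us; rewrite x1E /= mem_cat negb_or inE negb_or => /andP[/and3P[x1r x1a _] _].
  by case/orP: wr => [/eqP->|wr]; [rewrite eq_sym|apply: contraNneq x1r => <-].
- exact: lastS.
- by move=> w ws; apply: Di; apply: s2S.
- move=> w wb; have ws : w \in b :: s2 by apply: mem_belast.
  apply: mid; first exact: s2S.
    rewrite eq_sym; case: (s1) SE dis => [|y r] [yE _] dis.
      by rewrite yE; apply: dis => //; rewrite mem_head.
    by rewrite yE; apply: dis => //; rewrite mem_head.
  have : uniq (b :: s2) by move: us; rewrite cat_uniq => /and4P[_ _ _].
  rewrite lastI rcons_uniq => /andP[+ _].
  have -> : last b s2 = x2 by rewrite -lastS.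
  by move=> nx; apply: contraNneq nx => <-.
- by case: (r1) RE => [|y r] [-> _] //; rewrite last_rev_cons.
- by move=> w; rewrite inE mem_rev => /orP[/eqP->//|ws]; apply: Dr.
- move=> w wb.
  have [w1 w3] : w \in r1 ++ [:: q] /\ w != x3.
    case: (r1) RE ipq wb => [|y r] [yE _] ipq //.
    have uq : uniq (q :: rev (y :: r)) by apply: ipath_uniq ipq.
    rewrite rev_cons belast_rcons => wr; split.
      by rewrite mem_cat !inE; move: wr; rewrite inE mem_rev => /orP[]->; rewrite ?orbT.
    move: uq; rewrite rev_cons -rcons_cons rcons_uniq -yE => /andP[H _].
    by apply: contraNneq H => <-.
  have wx1 : w != x1.
    move: w1; rewrite mem_cat inE => /orP[/r1P[wS _]|/eqP->//].
    by apply: contraNneq wS => ->.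
  by case: (DR w w1 wx1) => // E; rewrite E eqxx in w3.
Qed.

Definition outer_leg x y z s r := [/\ ipath g z s, shadow s r &
  {in r, forall w, ~~ within x y w}].

Lemma outer_leg_far x y z s r t w : outer_leg x y z s r -> t \in s ->
  simplicial x y w -> ~~ g w t /\ t != w.
Proof.
move=> [_ sh out] /sh[t' /out nt d] sw.
have Dw : within x y w by case/andP: sw.
have wt : ~~ e t' w.
  apply: contraNN nt => tw; move: sw => /andP[_ /forallP/(_ t')].
  by rewrite se tw.
have wt' : w != t' by apply: contraNneq nt => <-.
have [h1 h2] := dominated_far d wt wt'.
split; last by rewrite eq_sym.
by apply: contraNN h1; rewrite sg; apply: sub.
Qed.

Lemma shadow_far s r s' r' : shadow s r -> shadow s' r' -> far e r r' -> far g s s'.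
Proof.
move=> sh sh' /farP f; apply/farP => y z ys zs.
have [y' yr dy] := sh y ys; have [z' zr dz] := sh' z zs.
have [n1 n2] := f y' z' yr zr.
have [h1 h2] : ~~ e z y' /\ y' != z by apply: (dominated_far dz); rewrite // ?[e z' _]se // eq_sym.
have [h3 h4] : ~~ e y z /\ z != y by apply: (dominated_far dy); rewrite // ?[e y' _]se // eq_sym.
by split=> //; apply: contraNN h3; apply: sub.
Qed.

(** Inner legs are simplicial except for the port at their end, so they touch no foreign outer leg,
    and their own only at the port. Each inner leg is prolonged by its outer leg. *)
Lemma center x1 x2 x3 s1 s2 s3 r1 r2 r3 : e x1 x2 -> nonbig x1 x2 ->
  port x1 x2 x1 -> port x1 x2 x2 -> port x1 x2 x3 -> x3 != x1 -> x3 != x2 ->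
  outer_leg x1 x2 x1 s1 r1 -> outer_leg x1 x2 x2 s2 r2 -> outer_leg x1 x2 x3 s3 r3 ->
  far e r1 (x2 :: x3 :: r2) -> far e r1 r3 -> far e r2 (x1 :: x3 :: r3) -> far e r3 [:: x1; x2] ->
  exists t1 l1 t2 l2 t3 l3, tripod g t1 l1 t2 l2 t3 l3 /\
    [/\ size l1 = size s1, size l2 = size s2 & size l3 = size s3].
Proof.
move=> x12 nb po1 po2 po3 x31 x32 L1 L2 L3 f1 f13 f2 f3.
have [t1 [l1 [t2 [l2 [t3 [l3 [tri [I1 I2 I3]]]]]]]] := ports_tripod x12 nb po1 po2 po3 x31 x32.
case: tri => -[ip1 ip2 ip3] [t12 t13 t23] [fl12 fl13 fl23] [ft12 ft13 ft23].
have ip t l x s r : ipath g t l -> inner_leg x1 x2 t l x -> outer_leg x1 x2 x s r ->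
    ipath g t (l ++ s).
  move=> ipt [lt Dt St] L; have [ips _ _] := L; rewrite ipath_cat ipt lt ips /=.
  apply/farP => w y wb ys; exact: (outer_leg_far L ys (St w wb)).
have mid t l x w : inner_leg x1 x2 t l x -> w \in t :: l -> w = x \/ simplicial x1 x2 w.
  move=> [lt Dt St]; rewrite lastI mem_rcons inE lt => /orP[/eqP|/St]; by [left|right].
have io t l x x' s r : inner_leg x1 x2 t l x -> outer_leg x1 x2 x' s r -> far e r [:: x] ->
    far g (t :: l) s.
  move=> I L /farP fx; apply/farP => w y wl ys.
  have [->|sw] := mid t l x w I wl; last exact: (outer_leg_far L ys sw).
  have [_ sh _] := L; have [y' y'r d] := sh y ys.
  have [n1 n2] := fx y' x y'r (mem_head _ _).
  have [h1 h2] := dominated_far d n1 n2; split; last by rewrite eq_sym.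
  by apply: contraNN h1; rewrite sg; apply: sub.
have sub_far r s s' : {subset s' <= s} -> far e r s -> far e r s'.
  by move=> ss /farP f; apply/farP => y z yr zs; apply: f => //; apply: ss.
have pair t l x s r t' l' x' s' r' : inner_leg x1 x2 t l x -> inner_leg x1 x2 t' l' x' ->
    outer_leg x1 x2 x s r -> outer_leg x1 x2 x' s' r' ->
    far e r [:: x'] -> far e r' [:: x] -> far e r r' ->
    far g l (t' :: l') -> far g [:: t] l' ->
    far g (l ++ s) (t' :: l' ++ s') /\ far g [:: t] (l' ++ s').
  move=> I I' L L' fx fx' frr fl ft.
  have [_ sh _] := L; have [_ sh' _] := L'.
  have f1' : far g (t :: l) s' := io _ _ _ _ _ _ I L' fx'.
  have f2' : far g (t' :: l') s := io _ _ _ _ _ _ I' L fx.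
  have f3' : far g s s' := shadow_far sh sh' frr.
  split; apply/farP => y z; last first.
    rewrite inE mem_cat => /eqP-> /orP[zl|zs].
      by move/farP: ft; apply; rewrite ?mem_head.
    by move/farP: f1'; apply; rewrite ?mem_head.
  rewrite mem_cat -cat_cons mem_cat => /orP[yl|ys] /orP[zl|zs].
  - by move/farP: fl; apply.
  - by move/farP: f1'; apply; rewrite // inE yl orbT.
  - by move: f2'; rewrite far_sym // => /farP; apply.
  - by move/farP: f3'; apply.
have [a1 a2] : far g (l1 ++ s1) (t2 :: l2 ++ s2) /\ far g [:: t1] (l2 ++ s2).
  apply: (pair _ _ x1 _ r1 _ _ x2 _ r2) => //.
  - by apply: sub_far f1 => z; rewrite inE => /eqP->; rewrite mem_head.
  - by apply: sub_far f2 => z; rewrite inE => /eqP->; rewrite mem_head.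
  - by apply: sub_far f1 => z zr; rewrite !inE zr !orbT.
have [b1 b2] : far g (l1 ++ s1) (t3 :: l3 ++ s3) /\ far g [:: t1] (l3 ++ s3).
  apply: (pair _ _ x1 _ r1 _ _ x3 _ r3) => //.
  - by apply: sub_far f1 => z; rewrite inE => /eqP->; rewrite !inE eqxx orbT.
  - by apply: sub_far f3 => z; rewrite inE => /eqP->; rewrite mem_head.
have [c1 c2] : far g (l2 ++ s2) (t3 :: l3 ++ s3) /\ far g [:: t2] (l3 ++ s3).
  apply: (pair _ _ x2 _ r2 _ _ x3 _ r3) => //.
  - by apply: sub_far f2 => z; rewrite inE => /eqP->; rewrite !inE eqxx orbT.
  - by apply: sub_far f3 => z; rewrite inE => /eqP->; rewrite !inE eqxx orbT.
  - by apply: sub_far f2 => z zr; rewrite !inE zr !orbT.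
(* The inner parts only lengthen the legs, so cutting restores the prescribed lengths. *)
exists t1, (take (size s1) (l1 ++ s1)), t2, (take (size s2) (l2 ++ s2)),
  t3, (take (size s3) (l3 ++ s3)).
have sb n t (l s : seq T) : {subset t :: take n (l ++ s) <= t :: l ++ s}.
  by move=> z; rewrite !inE => /orP[->//|/mem_take->]; rewrite orbT.
have sb' n (l s : seq T) : {subset take n (l ++ s) <= l ++ s} by move=> z /mem_take.
have ff (p q p' q' : seq T) : far g p q -> {subset p' <= p} -> {subset q' <= q} -> far g p' q'.
  by move=> /farP f pp qq; apply/farP => y z /pp yp /qq; apply: f.
split; last by rewrite !size_takel // size_cat leq_addl.
split.
- by split; apply: ipath_take; [apply: ip ip1 I1 L1|apply: ip ip2 I2 L2|apply: ip ip3 I3 L3].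
- by [].
- by split; [apply: ff a1 _ _|apply: ff b1 _ _|apply: ff c1 _ _].
- by split; [apply: ff a2 _ _|apply: ff b2 _ _|apply: ff c2 _ _].
Qed.

(** This serves triangles whose third vertex need not be a port; the price is that [x1 x2] is an
    edge of [g]. The apex is the last vertex before [x1] on a simplicial path from [x3], and [x2]
    sees it by [port_clique]. *)
Lemma apex x1 x2 x3 : e x1 x2 -> nonbig x1 x2 -> port x1 x2 x1 -> port x1 x2 x2 ->
  within x1 x2 x3 -> x3 != x1 -> x3 != x2 -> g x1 x2 ->
  exists t, [/\ g x1 t, g x2 t & t = x3 \/ simplicial x1 x2 t].
Proof.
move=> x12 nb po1 po2 D3 x31 x32 gx.
have [D1 D2] : within x1 x2 x1 /\ within x1 x2 x2 by rewrite within_l ?within_r.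
have x31e : e x3 x1 by apply: (within_clique x12).
have [j [ipj simj0]] := simplicial_path x31e.
have simj : {in j, forall z, simplicial x1 x2 z}.
  by move=> z /simj0; apply: simplicial_change.
have tx : last x3 j = x3 \/ simplicial x1 x2 (last x3 j).
  by case: (lastP j) simj => [|j' z] simj; [left|right; rewrite last_rcons simj // mem_rcons mem_head].
have gt : g x1 (last x3 j).
  by move: ipj; rewrite -cats1 ipath_cat /= andbT => /and3P[_ + _]; rewrite sg.
have tx2 : last x3 j != x2.
  case: tx => [->//|st]; apply: contraTneq st => ->; exact: port_not_simplicial.
exists (last x3 j); split=> //; rewrite sg.
have Dt : within x1 x2 (last x3 j) by case: tx => [->|/andP[]].
by apply: (port_clique x12 nb po1).
Qed.

(** Two heavy vertices in the first clique pull every heavy vertex into it. Two in the second would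
    then make both cliques equal, but [z] separates them. *)
Lemma nonbig_or x y x' y' z : e x y -> e x' y' -> within x y z -> ~~ within x' y' z ->
  nonbig x y \/ nonbig x' y'.
Proof.
move=> xy xy' Dz nDz; have [nb|big] := classic (nonbig x y); [by left|right].
move=> a' b' Da' Db' ha' hb'; apply/eqP/negPn/negP => ab'.
apply: big => a b Da Db ha hb; apply/eqP/negPn/negP => ab.
have inD c : heavy g c -> within x y c.
  move=> hc; have [->//|ca] := eqVneq c a; have [->//|cb] := eqVneq c b.
  by apply: (clique_ext xy Da Db ab); apply: hK; rewrite // eq_sym.
case/negP: nDz; rewrite -(within_change z xy' Da' Db' ab').
by rewrite (within_change z xy (inD _ ha') (inD _ hb') ab').
Qed.

(** At [u], the vertices [c] and [d] end the two clique runs, with [s] and [t] next on the cycle; at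
    [v], the vertices [a], [a'] and [b], [b'] play these roles. Here [c], [s], [a], [a'] lie on
    [q1], the others on [q2]. *)
Lemma theta_config u v q1 q2 p : min_theta e u v q1 q2 p ->
  exists x p' (c s d t a a' b b' : T), [/\ p = x :: p',
    [/\ e u c, e u d & e c d], [/\ e c s, e d t & e v a], [/\ e v b, e a b & e a a'] &
    e b b'] /\
  [/\ all (nadj e v) [:: c; s; d; t; a'; b'], all (nadj e u) [:: a; a'; b; b'; s; t] &
      far e p [:: c; s; d; t; a; a'; b; b']].
Proof.
move=> mt; have mr := min_theta_rev se mt; have mm := min_theta_mirror se mt.
have mmr := min_theta_rev se mm.
have [_ _ np] := min_theta_nil se mt.
have [x [p' [p'' [y [pE pE']]]]] := seq_ends np.
have rpE : rev p = y :: rev p'' by rewrite pE' rev_rcons.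
have [cl [c [s [q [q1E sc [cs us vs vc] fr1]]]]] := end_facts se alpha2 tr mt pE.
have [dl [d [t [q' [q2E sd [dt ut vt vd] fr2]]]]] := end_facts se alpha2 tr mr pE.
have [bl [b [b' [q3 [q3E sb [bb' vb' ub' ub] fr3]]]]] := end_facts se alpha2 tr mm rpE.
have [al [a [a' [q4 [q4E sa [aa' va' ua' ua] fr4]]]]] := end_facts se alpha2 tr mmr rpE.
have last_side (r : seq T) z (P : T -> Prop) : {in rcons r z, forall y, P y} -> P z.
  by apply; rewrite mem_rcons mem_head.
have /and3P[uc xc cx] := last_side _ _ _ sc; have /and3P[ud xd dx] := last_side _ _ _ sd.
have /and3P[vb yb by_] := last_side _ _ _ sb; have /and3P[va ya ay] := last_side _ _ _ sa.
have [uv ne nq nqp] := theta_neq mt.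
have c1 : c \in q1 by rewrite q1E mem_cat mem_head orbT.
have s1 : s \in q1 by rewrite q1E mem_cat !inE eqxx !orbT.
have d2 : d \in q2 by rewrite -mem_rev q2E mem_cat mem_head orbT.
have t2 : t \in q2 by rewrite -mem_rev q2E mem_cat !inE eqxx !orbT.
have b2 : b \in q2 by rewrite q3E mem_cat mem_head orbT.
have b2' : b' \in q2 by rewrite q3E mem_cat !inE eqxx !orbT.
have a1 : a \in q1 by rewrite -mem_rev q4E mem_cat mem_head orbT.
have a1' : a' \in q1 by rewrite -mem_rev q4E mem_cat !inE eqxx !orbT.
have ux : e u x.
  by have [[_ _ _ P3] _ _] := mt; move: P3; rewrite pE seg_cons => /andP[].
have vy : e v y.
  by have [[_ _ _ P3] _ _] := mm; move: P3; rewrite rpE seg_cons => /andP[].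
exists x, p', c, s, d, t, a, a', b, b'; split.
  split=> //; split=> //.
    by apply: (side_clique alpha2 ux (last_side _ _ _ sc) (last_side _ _ _ sd)); apply: nq.
  by apply: (side_clique alpha2 vy (last_side _ _ _ sa) (last_side _ _ _ sb)); apply: nq.
have inX z : (z \in q1) || (z \in q2) -> u != z /\ v != z.
  by move=> zq; apply: ne; rewrite catA mem_cat mem_cat zq.
split.
- apply/allP => z zin; suff [vz zq] : ~~ e v z /\ ((z \in q1) || (z \in q2)).
    by rewrite /nadj vz /=; have [_ +] := inX z zq; rewrite eq_sym.
  move: zin; rewrite !inE.
  by do ?[case/orP]=> /eqP->; rewrite ?c1 ?s1 ?d2 ?t2 ?a1' ?b2' ?orbT.
- apply/allP => z zin; suff [vz zq] : ~~ e u z /\ ((z \in q1) || (z \in q2)).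
    by rewrite /nadj vz /=; have [+ _] := inX z zq; rewrite eq_sym.
  move: zin; rewrite !inE.
  by do ?[case/orP]=> /eqP->; rewrite ?a1 ?s1 ?b2 ?t2 ?a1' ?b2' ?orbT.
- apply/farP => w z wp zin; suff [vz zq] : ~~ e w z /\ z \in q1 ++ q2.
    by split=> //; have := nqp w z wp zq; rewrite eq_sym.
  have wp' : w \in rev p by rewrite mem_rev.
  move: (fr1 w wp) (fr2 w wp) (fr3 w wp') (fr4 w wp').
  move: zin; rewrite !inE mem_cat => zin [h1 h2] [h3 h4] [h5 h6] [h7 h8]; move: zin.
  by do ?[case/orP]=> /eqP->; rewrite ?a1 ?s1 ?b2 ?t2 ?a1' ?b2' ?c1 ?d2 ?orbT.
Qed.

Lemma other_end (v a b s : T) : e v a -> e v b -> e a b -> nadj e v s ->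
  nadj e a s \/ nadj e b s.
Proof.
move=> va vb ab /andP[vs sv].
have sa : s != a by apply: contraNneq vs => ->.
have sb : s != b by apply: contraNneq vs => ->.
have [as_|nas] := boolP (e a s); last by left; rewrite /nadj nas.
right; rewrite /nadj sb andbT; apply: contraNN vs => bs.
by apply: (@tr a v b s) => //; rewrite 1?se // eq_sym.
Qed.

Lemma open_triangle (v y z w : T) : e v y -> e v w -> e y w -> nadj e v z -> e y z ->
  nadj e w z.
Proof.
move=> vy vw yw /andP[vz zv] yz.
have wz : z != w by apply: contraNneq vz => ->.
rewrite /nadj wz andbT; apply: contraNN vz => wz'.
by apply: (@tr y v w z) => //; rewrite 1?se // eq_sym.
Qed.

Lemma alpha2_clique (c u s y : T) : e c u -> e c s -> e c y -> nadj e u s -> nadj e u y ->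
  s != y -> e s y.
Proof.
move=> cu cs cy /andP[us su] /andP[uy yu] sy.
have := alpha2 cu cs cy; rewrite eq_sym su eq_sym yu sy (negbTE us) (negbTE uy).
by apply.
Qed.

Ltac adj := first [done | by rewrite se | by rewrite nadj_sym].
Ltac ipath_tac := rewrite ?ipath_cons ?far_cons ?far_nil /=;
  repeat match goal with |- is_true (_ && _) => apply/andP; split end; adj.

Section NonAdjacency.
Local Opaque nadj.

Lemma long_ipath u v q1 q2 p : min_theta e u v q1 q2 p ->
  exists z r, ipath e z r /\ size r = 5.
Proof.
move=> mt; have [x [p' [c [s [d [t [a [a' [b [b' [[pE [uc ud cd] [cs dt va] [vb ab aa'] bb'] [fv fu fp]]]]]]]]]]]] := theta_config mt.
move: fv fu => /= /and5P[vc vs vd vt /and3P[va' vb' _]] /and5P[ua ua' ub ub' /and3P[us ut _]].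
have ux : e u x.
  by have [[_ _ _ P3] _ _] := mt; move: P3; rewrite pE seg_cons => /andP[].
have fpw w : w \in p -> all (nadj e w) [:: c; s; d; t; a; a'; b; b'].
  by move=> wp; move/allP: fp => /(_ w wp).
have := fpw x; rewrite pE mem_head /= => /(_ isT) /and5P[xc xs xd xt /and5P[xa xa' xb xb' _]].
have cu : e c u by rewrite se.
have nyc y : e v y -> nadj e y s -> nadj e u y -> nadj e y c.
  rewrite nadjE => vy /andP[ys sy] uy; have cy : c != y.
    by apply: contraTneq vy => <-; case/andP: vc.
  rewrite nadjE cy andbT; apply: contraNN ys => yc; rewrite se.
  by apply: (alpha2_clique cu cs) => //; rewrite se.
(* Here [y] is one of [a], [b] that misses [s], [y'] is the other one, and [z] is the outer
   neighbour of [y]. *)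
have [y [y' [z [[vy vy' yy' yz] [uy uy' uz vz] [xy xy' xz ys]]]]] : exists y y' z,
    [/\ [/\ e v y, e v y', e y y' & e y z],
     [/\ nadj e u y, nadj e u y', nadj e u z & nadj e v z] &
     [/\ nadj e x y, nadj e x y', nadj e x z & nadj e y s]].
  by case: (other_end va vb ab vs) => h; [exists a, b, a'|exists b, a, b']; split; split; adj.
have yc := nyc y vy ys uy.
have sc : e s c by rewrite se.
(* Without the chord [u v] the ear is induced, and [s], [c], [u], [p], [v] contains six vertices
   unless the ear is a single vertex; then [y] is added. *)
have [uv|nuv] := boolP (e u v); last first.
  have nuv' : nadj e u v by rewrite nadjE nuv eq_sym; have [] := theta_neq mt.
  have ipu := ear_induced se ie mt nuv.
  have pc : all (nadj e c) p.
    by apply/allP => w /fpw /= /andP[h _]; rewrite nadj_sym.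
  have ps : all (nadj e s) p.
    by apply/allP => w /fpw /= /and3P[_ h _]; rewrite nadj_sym.
  have ip : ipath e s (c :: u :: rcons p v).
    rewrite !ipath_cons ipu /= !all_rcons pc ps sc cu.
    by rewrite (nadj_sym se s u) us (nadj_sym se s v) vs (nadj_sym se c v) vc.
  have [p'0|p'n] := eqVneq p' [::].
    exists s, [:: c; u; x; v; y]; split=> //.
    have xv : e x v.
      by move: ipu; rewrite pE p'0 /= => /and4P[_ _ + _].
    by ipath_tac.
  exists s, (take 5 (c :: u :: rcons p v)); split; first exact: ipath_take.
  rewrite size_takel //= size_rcons pE /= !ltnS.
  by case: (p') p'n.
have xv := chord_near se alpha2 tr mt pE uv.
have xu : e x u by rewrite se.
have zc : z != c by apply: contraTneq yz => ->; case/andP: yc.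
have zs : z != s by apply: contraTneq yz => ->; case/andP: ys.
have y'z : nadj e y' z := open_triangle vy vy' yy' vz yz.
have [cz|ncz] := boolP (e c z).
  have cy' : nadj e c y'.
    have y'c : y' != c by apply: contraTneq vy' => ->; case/andP: vc.
    rewrite nadjE y'c andbT; apply: contraTN (y'z) => cy'; rewrite nadjE negb_and negbK.
    have zy' : z != y' by apply: contraTneq vy' => <-; case/andP: vz.
    by rewrite se (alpha2_clique cu cz cy').
  have zy : e z y by rewrite se.
  by exists x, [:: u; c; z; y; y']; split=> //; ipath_tac.
have cz' : nadj e c z by rewrite nadjE ncz.
have [sz|nsz] := boolP (e s z).
  have zy : e z y by rewrite se.
  by exists x, [:: u; c; s; z; y]; split=> //; ipath_tac.
have sz' : nadj e s z by rewrite nadjE nsz.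
by exists s, [:: c; u; v; y; z]; split=> //; ipath_tac.
Qed.
End NonAdjacency.

Lemma tripod_pull x1 r1 x2 r2 x3 r3 s1 s2 s3 : tripod e x1 r1 x2 r2 x3 r3 ->
  nonbig x1 x2 -> port x1 x2 x1 -> port x1 x2 x2 -> port x1 x2 x3 ->
  ipath g x1 s1 -> shadow s1 r1 -> ipath g x2 s2 -> shadow s2 r2 ->
  ipath g x3 s3 -> shadow s3 r3 ->
  exists t1 l1 t2 l2 t3 l3, tripod g t1 l1 t2 l2 t3 l3 /\
    [/\ size l1 = size s1, size l2 = size s2 & size l3 = size s3].
Proof.
move=> [_ [x12 x13 x23] [f12 f13 f23] [h12 h13 h23]] nb po1 po2 po3 i1 sh1 i2 sh2 i3 sh3.
have ne y z : e y z -> z != y by apply: contraTneq => ->; rewrite ie.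
have out r y : far e [:: y] r -> (y == x1) || (y == x2) -> {in r, forall w, ~~ within x1 x2 w}.
  move=> /farP f yx w wr; have [n1 n2] := f y w (mem_head _ _) wr.
  by apply/negP => /andP[]; case/orP: yx => /eqP <-; rewrite (negbTE n1) (negbTE n2).
have fsub (r r' r'' : seq T) : {subset r'' <= r'} -> far e r r' -> far e r r''.
  by move=> ss /farP f; apply/farP => y z yr /ss; apply: f.
have fs := far_sym se.
apply: (center x12 nb po1 po2 po3 (ne _ _ x13) (ne _ _ x23)
  (s1 := s1) (s2 := s2) (s3 := s3) (r1 := r1) (r2 := r2) (r3 := r3)).
- split=> //; apply: (out r1 x2); last by rewrite eqxx orbT.
  by rewrite fs; apply: fsub f12 => w; rewrite inE => /eqP->; rewrite mem_head.
- by split=> //; apply: (out r2 x1); rewrite ?eqxx.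
- by split=> //; apply: (out r3 x1); rewrite ?eqxx.
- apply/farP => w z wr; rewrite !inE => /or3P[/eqP->|/eqP->|zr].
  + by move/farP: f12; apply; rewrite ?mem_head.
  + by move/farP: f13; apply; rewrite ?mem_head.
  + by move/farP: f12; apply; rewrite // inE zr orbT.
- by apply: fsub f13 => w wr; rewrite inE wr orbT.
- apply/farP => w z wr; rewrite inE => /orP[/eqP->|].
    by move: h12; rewrite fs => /farP; apply; rewrite ?mem_head.
  by move/farP: f23; apply.
- rewrite fs; apply/farP => w z; rewrite !inE => /orP[]/eqP->.
    by move/farP: h13; apply; rewrite mem_head.
  by move/farP: h23; apply; rewrite mem_head.
Qed.

Lemma tripod_pull_e x1 r1 x2 r2 x3 r3 : tripod e x1 r1 x2 r2 x3 r3 ->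
  nonbig x1 x2 -> port x1 x2 x1 -> port x1 x2 x2 -> port x1 x2 x3 ->
  exists t1 l1 t2 l2 t3 l3, tripod g t1 l1 t2 l2 t3 l3 /\
    [/\ size l1 = size r1, size l2 = size r2 & size l3 = size r3].
Proof.
move=> tri nb po1 po2 po3; have [[ip1 ip2 ip3] _ _ _] := tri.
have [s1 [<- i1 sh1]] := leg ip1; have [s2 [<- i2 sh2]] := leg ip2.
by have [s3 [<- i3 sh3]] := leg ip3; apply: (tripod_pull tri).
Qed.

Lemma tripod_apex x1 r1 x2 r2 x3 : tripod e x1 r1 x2 r2 x3 [::] ->
  nonbig x1 x2 -> port x1 x2 x1 -> port x1 x2 x2 -> g x1 x2 ->
  exists t1 l1 t2 l2 t3 l3, tripod g t1 l1 t2 l2 t3 l3 /\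
    [/\ size l1 = size r1, size l2 = size r2 & size l3 = 0].
Proof.
move=> [[ip1 ip2 _] [x12 x13 x23] [f12 f13 f23] [h12 _ _]] nb po1 po2 gx.
have ne y z : e y z -> z != y by apply: contraTneq => ->; rewrite ie.
have D3 : within x1 x2 x3 by rewrite /common_nbhd x13 x23 !orbT.
have [t [g1t g2t tE]] := apex x12 nb po1 po2 D3 (ne _ _ x13) (ne _ _ x23) gx.
have [s1 [sz1 i1 sh1]] := leg ip1; have [s2 [sz2 i2 sh2]] := leg ip2.
have fs := far_sym se.
have shx y : shadow [:: y] [:: y] by move=> z zy; exists z.
have fsub (r r' r'' : seq T) : {subset r'' <= r'} -> far e r r' -> far e r r''.
  by move=> ss /farP f; apply/farP => y z yr /ss; apply: f.
have out r y : far e [:: y] r -> (y == x1) || (y == x2) -> {in r, forall w, ~~ within x1 x2 w}.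
  move=> /farP f yx w wr; have [n1 n2] := f y w (mem_head _ _) wr.
  by apply/negP => /andP[]; case/orP: yx => /eqP <-; rewrite (negbTE n1) (negbTE n2).
have f1x2 : far e r1 [:: x2].
  by apply: fsub f12 => w; rewrite inE => /eqP->; rewrite mem_head.
have L1 : outer_leg x1 x2 x1 s1 r1.
  by split=> //; apply: (out r1 x2); rewrite ?eqxx ?orbT // fs.
have L2 : outer_leg x1 x2 x2 s2 r2.
  by split=> //; apply: (out r2 x1); rewrite ?eqxx.
have ft y s r : outer_leg x1 x2 y s r -> far e r [:: x3] -> far g s [:: t].
  move=> L f; case: tE => [->|st].
    by have [_ sh _] := L; apply: shadow_far sh (shx x3) f.
  rewrite far_sym //; apply/farP => w z; rewrite inE => /eqP-> zs.
  exact: (outer_leg_far L zs st).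
exists x1, s1, x2, s2, t, [::]; split; last by [].
split; split=> //.
- apply/farP => y z ys; rewrite inE => /orP[/eqP->|zs].
    by move/farP: (shadow_far sh1 (shx x2) f1x2); apply; rewrite ?mem_head.
  have f : far e r1 r2 by apply: fsub f12 => w wr; rewrite inE wr orbT.
  by move/farP: (shadow_far sh1 sh2 f); apply.
- exact: ft L1 f13.
- exact: ft L2 f23.
- exact: shadow_far (shx x1) sh2 h12.
Qed.

(** The refinement of an edge missing from [g] has an inner vertex, so a single step of the closure
    already yields two steps. *)
Lemma long_leg x y : e x y -> ~~ g x y ->
  exists s, [/\ size s = 2, ipath g x s & shadow s [:: y]].
Proof.
move=> xy nxy; have [i [ipi simi]] := simplicial_path xy.
exists (take 2 (rcons i y)); split.
- rewrite size_takel // size_rcons; case: i ipi {simi} => //=.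
  by rewrite (negbTE nxy).
- exact: ipath_take.
- move=> z /mem_take; rewrite mem_rcons inE => zi; exists y; first exact: mem_head.
  case/orP: zi => [/eqP-> t //|/simi sz]; by have [] := simplicial_dominated sz.
Qed.

Lemma nonbig_sym x y : nonbig x y -> nonbig y x.
Proof. by move=> nb a b Da Db; apply: nb; rewrite within_sym. Qed.

Lemma port_nadj x y z w f : within x y z -> e z f -> nadj e w f ->
  (w == x) || (w == y) -> port x y z.
Proof.
move=> Dz zf /andP[n1 n2] wxy; split=> //; exists f => //; apply/negP => /andP[].
by case/orP: wxy => /eqP <-; rewrite (negbTE n1) (negbTE n2).
Qed.

Definition nonbig_end u x := forall c, side e u x c -> nonbig u c.

(** The clique of [u] away from the ear contains [u], which does not see the vertex [b] of the
    corresponding clique at [v]. The cliques differ and [nonbig_or] applies. *)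
Lemma nonbig_end_or u v q1 q2 p x p' y p'' : min_theta e u v q1 q2 p ->
  p = x :: p' -> rev p = y :: p'' -> nonbig_end u x \/ nonbig_end v y.
Proof.
move=> mt pE rpE; have mm := min_theta_mirror se mt.
have ux : e u x.
  by have [[_ _ _ P3] _ _] := mt; move: P3; rewrite pE seg_cons => /andP[].
have vy : e v y.
  by have [[_ _ _ P3] _ _] := mm; move: P3; rewrite rpE seg_cons => /andP[].
have [cl [c [s [q [q1E sc _ _]]]]] := end_facts se alpha2 tr mt pE.
have [bl [b [b' [q3 [q3E sb [_ _ _ ub] _]]]]] := end_facts se alpha2 tr mm rpE.
have {}sc : side e u x c by apply: sc; rewrite mem_rcons mem_head.
have {}sb : side e v y b by apply: sb; rewrite mem_rcons mem_head.
have bu : b != u.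
  have [_ ne _ _] := theta_neq mt; have [] := ne b; last by rewrite eq_sym.
  by rewrite q3E !mem_cat mem_head !orbT.
have uc : e u c by case/and3P: sc.
have vb : e v b by case/and3P: sb.
have change w z a a' : e w z -> side e w z a -> side e w z a' -> nonbig w a -> nonbig w a'.
  move=> wz sa sa' nb; have [<-//|aa'] := eqVneq a a'.
  have wa : e w a by case/and3P: sa.
  have wa' : e w a' by case/and3P: sa'.
  have eaa := side_clique alpha2 wz sa sa' aa'.
  have wa'n : w != a' by apply: contraTneq wa' => ->; rewrite ie.
  have Da' : within w a a' by rewrite /common_nbhd wa' eaa !orbT.
  by move=> h1 h2; rewrite !(within_change _ wa (within_l wa) Da' wa'n); apply: nb.
have nD : ~~ within v b u.
  by rewrite /common_nbhd [e b u]se (negbTE ub) [u == b]eq_sym (negbTE bu) andbF.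
case: (nonbig_or uc vb (within_l uc) nD) => nb; [left|right] => a sa.
  exact: change ux sc sa nb.
exact: change vy sb sa nb.
Qed.

Lemma net_end_tripod u v q1 q2 p x p' : min_theta e u v q1 q2 p -> p = x :: p' ->
  nonbig_end u x -> exists t1 l1 t2 l2 t3 l3, tripod g t1 l1 t2 l2 t3 l3 /\
    [/\ size l1 = 1, size l2 = 1 & size l3 = 1].
Proof.
move=> mt pE nb.
have ux : e u x.
  by have [[_ _ _ P3] _ _] := mt; move: P3; rewrite pE seg_cons => /andP[].
have [c [d [s [t [[sc sd cd'] [[cs us su xs] [dt ut tu xt] st]]]]]] :=
  net_end se ie alpha2 tr mt pE.
have cd := side_clique alpha2 ux sc sd cd'.
have nbc := nb c sc.
case/and3P: sc => uc xc cx; case/and3P: sd => ud xd dx.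
have us' : nadj e u s by rewrite nadjE us.
have ut' : nadj e u t by rewrite nadjE ut.
have ne y z w : e y z -> ~~ e y w -> w != z by move=> yz; apply: contraNneq => ->.
have sx := ne _ _ _ ux us; have tx := ne _ _ _ ux ut.
have ds : nadj e d s := open_triangle uc ud cd us' cs.
have dc : e d c by rewrite se.
have ct : nadj e c t := open_triangle ud uc dc ut' dt.
have ts : t != s by apply: contraTneq dt => ->; case/andP: ds.
have xc' : nadj e x c by rewrite nadjE xc.
have xd' : nadj e x d by rewrite nadjE xd.
have xs' : nadj e x s by rewrite nadjE xs.
have xt' : nadj e x t by rewrite nadjE xt.
have st' : nadj e s t by rewrite nadjE st.
have tri : tripod e u [:: x] c [:: s] d [:: t].
  by split; split; ipath_tac.
have Dd : within u c d by rewrite /common_nbhd ud cd !orbT.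
apply: (tripod_pull_e tri nbc).
- by apply: (port_nadj (w := c) (f := x)); rewrite ?within_l ?eqxx ?orbT // nadj_sym.
- by apply: (port_nadj (w := u) (f := s)); rewrite ?within_r ?eqxx.
- by apply: (port_nadj (w := u) (f := t)); rewrite ?eqxx.
Qed.

Definition has_tripod n1 n2 n3 := exists t1 l1 t2 l2 t3 l3,
  tripod g t1 l1 t2 l2 t3 l3 /\ [/\ size l1 = n1, size l2 = n2 & size l3 = n3].

(** The triangle is [u c d], with [s] hanging from [c]. The long leg at [u] runs along the induced
    ear, or towards [v] by [long_leg] if the chord [u v] is not an edge of [g]. *)
Lemma wounded_at_end u v q1 q2 p x p' : min_theta e u v q1 q2 p -> p = x :: p' ->
  nonbig_end u x -> ~~ e u v || ~~ g u v -> has_tripod 2 1 0.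
Proof.
move=> mt pE nb uv.
have [x0 [p0 [c [s [d [t [a [a' [b [b' [[pE0 [uc ud cd] [cs dt va] [vb ab aa'] bb'] [fv fu fp]]]]]]]]]]]] := theta_config mt.
have [? ?] : x0 = x /\ p0 = p' by move: pE0; rewrite pE => -[].
subst x0 p0.
move: fv fu => /= /and5P[vc vs vd vt _] /and5P[_ _ _ _ /and3P[us ut _]].
have ux : e u x.
  by have [[_ _ _ P3] _ _] := mt; move: P3; rewrite pE seg_cons => /andP[].
have fpw w : w \in p -> all (nadj e w) [:: c; s; d].
  move=> wp; move/allP: fp => /(_ w wp) /= /and5P[h1 h2 h3 _ _]; by rewrite /nadj h1 h2 h3.
have := fpw x; rewrite pE mem_head /= => /(_ isT) /and4P[xc xs xd _].
have ds : nadj e d s := open_triangle uc ud cd us cs.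
have vu : v != u by rewrite eq_sym; have [] := theta_neq mt.
have nbc : nonbig u c by apply: nb; rewrite /side uc.
have po1 : port u c u.
  by apply: (port_nadj (w := c) (f := x)); rewrite ?within_l ?eqxx ?orbT // nadj_sym.
have po2 : port u c c.
  by apply: (port_nadj (w := u) (f := s)); rewrite ?within_r ?eqxx.
have po3 : port u c d.
  apply: (port_nadj (w := u) (f := t)); rewrite ?eqxx // /common_nbhd.
  by rewrite ud cd !orbT.
have [uv'|nuv] := boolP (e u v).
  move: uv; rewrite uv' /= => guv.
  have [s1 [sz1 i1 sh1]] := long_leg uv' guv.
  have tri : tripod e u [:: v] c [:: s] d [::] by split; split; ipath_tac.
  have [[_ ip2 _] _ _ _] := tri.
  have [s2 [sz2 i2 sh2]] := leg ip2.
  have shn : shadow [::] [::] by [].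
  have := tripod_pull (s3 := [::]) tri nbc po1 po2 po3 i1 sh1 i2 sh2 isT shn.
  by rewrite sz1 sz2.
have ipu := ear_induced se ie mt nuv.
have [y [r [yE yP]]] : exists y r, rcons p v = [:: x, y & r] /\ (y = v \/ y \in p).
  rewrite pE; case: (p') => [|y r]; first by exists v, [::]; split; [|left].
  by exists y, (rcons r v); split=> //; right; rewrite !inE eqxx orbT.
have [ycf ysf ydf] : [/\ nadj e y c, nadj e y s & nadj e y d].
  by case: yP => [->|/fpw /= /and4P[]]; split.
have [uy xy] : nadj e u y /\ e x y.
  by move: ipu; rewrite yE /= => /and3P[_ /andP[h _] /and3P[xy _ _]].
have tri : tripod e u [:: x; y] c [:: s] d [::] by split; split; ipath_tac.
exact: (tripod_pull_e tri nbc).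
Qed.

(** If the clique of [u v] has at most one heavy vertex, the triangle [u v x] carries the pattern,
    with apex [x]. Otherwise every other maximal clique is nonbig and the triangle may be chosen
    freely among those. *)
Lemma wounded_chord u v q1 q2 p : min_theta e u v q1 q2 p -> e u v -> g u v ->
  has_tripod 2 1 0.
Proof.
move=> mt uv guv.
have [x [p' [c [s [d [t [a [a' [b [b' [[pE [uc ud cd] [cs dt va] [vb ab aa'] bb'] [fv fu fp]]]]]]]]]]]] := theta_config mt.
move: fv fu => /= /and5P[vc vs vd vt _] /and5P[ua _ ub _ /and3P[us ut _]].
have ux : e u x.
  by have [[_ _ _ P3] _ _] := mt; move: P3; rewrite pE seg_cons => /andP[].
have := fp; rewrite pE /= => /andP[/and5P[xc xs xd xt /and5P[xa _ xb _ _]] _].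
have xv := chord_near se alpha2 tr mt pE uv.
have vx : e v x by rewrite se.
have dc : e d c by rewrite se.
have cu : e c u by rewrite se.
have du : e d u by rewrite se.
have ds : nadj e d s := open_triangle uc ud cd us cs.
have ct : nadj e c t := open_triangle ud uc dc ut dt.
have ny (c0 s0 y : T) : e c0 u -> e c0 s0 -> nadj e u s0 -> nadj e v c0 -> e v y ->
    nadj e u y -> nadj e y s0 -> nadj e y c0.
  move=> cu0 cs0 us0 vc0 vy uy; rewrite nadjE => /andP[ys0 sy].
  have cy : c0 != y by apply: contraTneq vy => <-; case/andP: vc0.
  rewrite nadjE cy andbT; apply: contraNN ys0 => yc0; rewrite se.
  by apply: (alpha2_clique cu0 cs0) => //; rewrite se.
have [nb|big] := classic (nonbig u v).
  have [y [vy uy xy ys]] : exists y, [/\ e v y, nadj e u y, nadj e x y & nadj e y s].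
    by case: (other_end va vb ab vs) => h; [exists a|exists b].
  have yc := ny c s y cu cs us vc vy uy ys.
  have tri : tripod e u [:: c; s] v [:: y] x [::] by split; split; ipath_tac.
  apply: (tripod_apex tri nb) => //.
    by apply: (port_nadj (w := v) (f := c)); rewrite ?within_l ?eqxx ?orbT.
  by apply: (port_nadj (w := u) (f := y)); rewrite ?within_r ?eqxx.
have nbu : nonbig u c.
  have nD : ~~ within u c v.
    by move: vc; rewrite nadjE /common_nbhd [e v c]se [c == v]eq_sym => /andP[/negbTE-> /negbTE->]; rewrite andbF.
  by case: (nonbig_or uv uc (within_r uv) nD).
have out y w : nadj e u y -> e w y -> nonbig w y.
  rewrite nadjE => /andP[uy yu] wy.
  have nD : ~~ within w y u by rewrite /common_nbhd [e y u]se (negbTE uy) [u == y]eq_sym (negbTE yu) andbF.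
  by case: (nonbig_or uv wy (within_l uv) nD).
have through (c0 s0 d0 t0 y : T) : [/\ e u c0, e u d0, e c0 d0, e c0 s0 & e d0 t0] ->
    [/\ nadj e u s0, nadj e u t0, nadj e v c0, nadj e v s0 & nadj e v d0] ->
    nadj e d0 s0 -> nadj e x c0 -> [/\ e v y, nadj e u y, nadj e y s0 & nadj e y d0] ->
    has_tripod 2 1 0.
  move=> [uc0 ud0 cd0 cs0 dt0] [us0 ut0 vc0 vs0 vd0] ds0 xc0 [vy uy ys0 yd0].
  have cu0 : e c0 u by rewrite se.
  have yc0 := ny c0 s0 y cu0 cs0 us0 vc0 vy uy ys0.
  have nb0 : nonbig u c0.
    have nD : ~~ within u c0 v.
      by move: vc0; rewrite nadjE /common_nbhd [e v c0]se [c0 == v]eq_sym => /andP[/negbTE-> /negbTE->]; rewrite andbF.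
    by case: (nonbig_or uv uc0 (within_r uv) nD).
  have tri : tripod e u [:: v; y] c0 [:: s0] d0 [::] by split; split; ipath_tac.
  apply: (tripod_pull_e tri nb0).
  - by apply: (port_nadj (w := c0) (f := v)); rewrite ?within_l ?eqxx ?orbT // nadj_sym.
  - by apply: (port_nadj (w := u) (f := s0)); rewrite ?within_r ?eqxx.
  - apply: (port_nadj (w := u) (f := t0)); rewrite ?eqxx // /common_nbhd.
    by rewrite ud0 cd0 !orbT.
(* Otherwise the triangles at [u] and [v] are joined by two further triangles. *)
have joined_case y1 y2 : [/\ e v y1, e v y2 & e y1 y2] ->
    [/\ nadj e u y1, nadj e u y2, nadj e x y1 & nadj e x y2] ->
    [/\ nadj e y1 s, e y1 d, e y2 c & e y2 s] -> has_tripod 2 1 0.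
  move=> [vy1 vy2 y12] [uy1 uy2 xy1 xy2] [y1s y1d y2c y2s].
  have y1c := ny c s y1 cu cs us vc vy1 uy1 y1s.
  have cy2 : e c y2 by rewrite se.
  have sy2 : e s y2 by rewrite se.
  have y21 : e y2 y1 by rewrite se.
  have y2d : nadj e y2 d := open_triangle vy1 vy2 y12 vd y1d.
  (* If [c y2] is an edge of [g], the triangle [c y2 s] is used with apex [s]; if not, its
     refinement is the long leg at [c] of the triangle [c u d]. *)
  have [gcy|ngcy] := boolP (g c y2).
    have tri : tripod e c [:: u; x] y2 [:: y1] s [::] by split; split; ipath_tac.
    apply: (tripod_apex tri (out _ _ uy2 cy2)) => //.
    - by apply: (port_nadj (w := y2) (f := u)); rewrite ?within_l ?eqxx ?orbT // nadj_sym.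
    - by apply: (port_nadj (w := c) (f := y1)); rewrite ?within_r ?eqxx // nadj_sym.
  have [s1 [sz1 i1 sh1]] := long_leg cy2 ngcy.
  have tri : tripod e c [:: y2] u [:: x] d [::] by split; split; ipath_tac.
  have [[_ ip2 _] _ _ _] := tri.
  have [s2 [sz2 i2 sh2]] := leg ip2.
  have shn : shadow [::] [::] by [].
  rewrite /has_tripod -sz1 -[1]/(size [:: x]) -sz2.
  apply: (tripod_pull (s3 := [::]) tri (nonbig_sym nbu) _ _ _ i1 sh1 i2 sh2 isT shn).
  - by apply: (port_nadj (w := u) (f := s)); rewrite ?within_l ?eqxx ?orbT.
  - by apply: (port_nadj (w := c) (f := x)); rewrite ?within_r ?eqxx // nadj_sym.
  - apply: (port_nadj (w := u) (f := t)); rewrite ?eqxx ?orbT // /common_nbhd.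
    by rewrite ud cd !orbT.
have main y1 y2 : [/\ e v y1, e v y2 & e y1 y2] ->
    [/\ nadj e u y1, nadj e u y2, nadj e x y1 & nadj e x y2] -> nadj e y1 s ->
    has_tripod 2 1 0.
  move=> [vy1 vy2 y12] [uy1 uy2 xy1 xy2] y1s.
  have vd' y : e v y -> d != y by move=> vy; apply: contraTneq vy => <-; case/andP: vd.
  have vc' y : e v y -> c != y by move=> vy; apply: contraTneq vy => <-; case/andP: vc.
  have [y1d|y1d] := boolP (e y1 d); last first.
    by apply: (through c s d t y1) => //; split=> //; rewrite nadjE y1d vd'.
  have dy1 : e d y1 by rewrite se.
  have y1t : t != y1 by apply: contraTneq vy1 => <-; case/andP: vt.
  have ty1 : e t y1 := alpha2_clique du dt dy1 ut uy1 y1t.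
  have y2t : nadj e y2 t.
    by apply: (open_triangle vy1 vy2 y12 vt); rewrite se.
  have [y2c|y2c] := boolP (e y2 c); last first.
    by apply: (through d t c s y2) => //; split=> //; rewrite nadjE y2c vc'.
  have cy2 : e c y2 by rewrite se.
  have y2s : s != y2 by apply: contraTneq vy2 => <-; case/andP: vs.
  have sy2 : e s y2 := alpha2_clique cu cs cy2 us uy2 y2s.
  by apply: (joined_case y1 y2) => //; split=> //; rewrite se.
by case: (other_end va vb ab vs) => h; [apply: (main a b)|apply: (main b a)] => //;
  split=> //; rewrite se.
Qed.

Theorem theta_tripods u v q1 q2 p : min_theta e u v q1 q2 p ->
  has_tripod 1 1 1 /\ has_tripod 2 1 0.
Proof.
move=> mt; have mm := min_theta_mirror se mt.
have [_ _ np] := min_theta_nil se mt.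
have [x [p' [p'' [y [pE pE']]]]] := seq_ends np.
have rpE : rev p = y :: rev p'' by rewrite pE' rev_rcons.
have or := nonbig_end_or mt pE rpE.
split.
  by case: or => nb; [apply: net_end_tripod mt pE nb|apply: net_end_tripod mm rpE nb].
have [|] := boolP (~~ e u v || ~~ g u v).
  move=> h; case: or => nb; first exact: wounded_at_end mt pE nb h.
  by apply: (wounded_at_end mm rpE nb); rewrite se sg.
by rewrite negb_or !negbK => /andP[uv guv]; apply: (wounded_chord mt).
Qed.

Theorem theta_path u v q1 q2 p : min_theta e u v q1 q2 p ->
  exists z r, ipath g z r /\ size r = 5.
Proof.
move=> /long_ipath[z [r [ip <-]]]; have [r' [sz ip' _]] := leg ip.
by exists z, r'.
Qed.

End PullBack.

(** * Sufficiency *)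

Theorem nonham_patterns (T : finType) (g : rel T) :
  symmetric g -> irreflexive g -> claw_heavy g -> two_connected g -> ~ ham g ->
  [/\ has_tripod g 1 1 1, has_tripod g 2 1 0 & exists z r, ipath g z r /\ size r = 5].
Proof.
move=> sg ig chg tcg nhg.
have [e [[se ie sub] nhe hK [alpha2 tr] jn]] := closure sg ig chg nhg.
have hKg x y : heavy g x -> heavy g y -> x != y -> e x y.
  by move=> hx hy; apply: hK; apply: heavy_mono sub _.
have tce : two_connected e.
  case: tcg => lt co; split=> // w x y xw yw.
  apply: connect_sub (co w x y xw yw) => a b /andP[ab h].
  by apply: connect1; rewrite (sub _ _ ab) h.
have [u [v [q1 [q2 [p mt]]]]] := has_min_theta se ie tce nhe.
have [t1 t2] := theta_tripods sg ig chg se ie sub alpha2 tr hKg jn mt.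
by split=> //; apply: (theta_path sg ig chg se ie sub alpha2 tr hKg jn mt).
Qed.

(** * Embeddings of the pattern graphs *)

Definition embedding (S G : sgraph) (f : S -> G) :=
  injective f /\ forall x y, adj (f x) (f y) = adj x y.

Definition embeds (S G : sgraph) := exists f : S -> G, embedding f.

Lemma isomorphic_sym S G : isomorphic S G -> isomorphic G S.
Proof.
case=> f [f' fK f'K] fadj; exists f'; first by exists f.
by move=> x y; rewrite -fadj !f'K.
Qed.

Lemma isomorphic_embeds S G : isomorphic S G -> embeds S G.
Proof. by case=> f /bij_inj fi fa; exists f. Qed.

Lemma embeds_trans S G H : embeds S G -> embeds G H -> embeds S H.
Proof.
case=> f [fi fa] [f' [fi' fa']]; exists (f' \o f); split; first exact: inj_comp.
by move=> x y /=; rewrite fa' fa.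
Qed.

Section Image.
Variables (S G : sgraph) (f : S -> G).
Hypothesis ef : embedding f.

Lemma image_codom x : f x \in f @: setT. Proof. by apply: imset_f. Qed.

Definition to_image x : induced (f @: setT) := exist _ (f x) (image_codom x).

Lemma image_isomorphic : isomorphic (induced (f @: setT)) S.
Proof.
apply: isomorphic_sym; exists to_image; last by move=> x y; apply: ef.2.
apply: inj_card_bij.
  by move=> x y /(congr1 val) /ef.1.
rewrite card_sig -cardsT; apply: leq_trans (leq_imset_card f setT).
by apply: subset_leq_card; apply/subsetP.
Qed.

Lemma f_heavy_pair u v w : f_heavy S G -> u != v -> ~~ adj u v -> adj u w -> adj w v ->
  heavy adj (f u) || heavy adj (f v).
Proof.
move=> fh uv nuv uw wv; have := fh _ image_isomorphic (to_image u) (to_image v).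
rewrite maxnMr leq_max; apply; split.
  by exists [:: to_image w; to_image v]; split=> //=; rewrite /induced_adj /= !ef.2 uw wv.
case=> [|x [|y p]] [] //=.
  by move=> _ /(congr1 val) /ef.1 E; rewrite E eqxx in uv.
rewrite andbT /induced_adj /= => h E; move: h; rewrite E /= ef.2.
by rewrite (negbTE nuv).
Qed.
End Image.

Lemma embeds_not_free S G : embeds S G -> ~ is_free S G.
Proof. by case=> f ef; apply; exists (f @: setT); apply: image_isomorphic. Qed.

Lemma not_free_embeds S G : ~ is_free S G -> embeds S G.
Proof.
move/NNPP => [A] /isomorphic_sym[f /bij_inj fi fa].
exists (fun x => val (f x)); split; last by move=> x y; apply: fa.
by move=> x y /val_inj /fi.
Qed.

Definition edge_in (E : seq (nat * nat)) (i j : nat) :=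
  (i != j) && (((i, j) \in E) || ((j, i) \in E)).

Lemma edge_in_sym E : symmetric (edge_in E).
Proof. by move=> i j; rewrite /edge_in eq_sym orbC. Qed.

Lemma embeds_seq n E (G : sgraph) (x0 : G) (s : seq G) :
  (forall i j, i < j -> j < n -> if edge_in E i j then adj (nth x0 s i) (nth x0 s j)
     else nadj adj (nth x0 s i) (nth x0 s j)) ->
  @embedding (edge_list_graph n E) G (fun i => nth x0 s (val i)).
Proof.
move=> H; pose f (i : edge_list_graph n E) := nth x0 s (val i); rewrite -/f.
have key (i j : 'I_n) : i < j -> f i != f j /\ adj (f i) (f j) = edge_in E i j.
  move=> ij; have := H i j ij (ltn_ord j); rewrite -/(f i) -/(f j).
  case: ifP => [eE h|eE /andP[/negbTE-> +]]; last by rewrite eq_sym.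
  by split=> //; apply: contraTneq h => ->; rewrite adj_irrefl.
split=> i j.
  by case: (ltngtP i j) => [/key[h _] E'|/key[h _] E'|/val_inj] //; rewrite E' eqxx in h.
case: (ltngtP i j) => [/key[_ ->]|/key[_ h]|/val_inj->] //.
  by rewrite adj_sym h; apply: edge_in_sym.
by rewrite !adj_irrefl.
Qed.

Section Patterns.
Variable G : sgraph.
Local Opaque nadj.

Let sG := @adj_sym G.

Ltac unpack := rewrite ?far_cons ?far_nil ?ipath_cons /=; intros;
  repeat match goal with H : is_true (_ && _) |- _ => move/andP: H => [? ?] end.

Ltac pairs := case=> [|[|[|[|[|[|[|i]]]]]]] [|[|[|[|[|[|j]]]]]] //= _ _;
  first [done | by rewrite nadj_sym | by rewrite sG].

Lemma claw_heavy_adj : f_heavy claw G -> claw_heavy (@adj G).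
Proof.
move=> fh v x y z vx vy vz xy xz yz nxy nxz nyz.
have na (a b : G) : a != b -> ~~ adj a b -> nadj adj a b.
  by rewrite nadjE eq_sym => -> ->.
have xy' := na _ _ xy nxy; have xz' := na _ _ xz nxz; have yz' := na _ _ yz nyz.
have ef : @embedding claw G (fun i => nth v [:: v; x; y; z] (val i)).
  by apply: embeds_seq; pairs.
have P (i j : nat) : 0 < i -> i < j -> j < 4 ->
    heavy adj (nth v [:: v; x; y; z] i) || heavy adj (nth v [:: v; x; y; z] j).
  pose E := [:: (0, 1); (0, 2); (0, 3)].
  move=> i0 ij j4; have i4 := ltn_trans ij j4.
  have [e1 e2 e3] : [/\ edge_in E i j = false, edge_in E 0 i & edge_in E j 0].
    by case: i j i0 ij j4 i4 => [|[|[|[|i]]]] [|[|[|[|j]]]].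
  apply: (f_heavy_pair ef (u := Ordinal i4) (v := Ordinal j4) (w := ord0) fh) => //.
  - by rewrite -val_eqE /= ltn_eqF.
  - exact: negbT e1.
  - by rewrite adj_sym.
  - by rewrite adj_sym.
by rewrite /two_of (P 1 2) ?(P 1 3) ?(P 2 3).
Qed.

Lemma net_embeds : has_tripod (@adj G) 1 1 1 -> embeds net G.
Proof.
case=> t1 [[|a [|? ?]] [t2 [[|b [|? ?]] [t3 [[|c [|? ?]] [+ [//= _ _ _]]]]]]].
case=> -[+ + +] [+ + +] [+ + +] [+ + +]; unpack.
exists (fun i => nth t1 [:: t1; t2; t3; a; b; c] (val i)); apply: embeds_seq; pairs.
Qed.

Lemma wounded_embeds : has_tripod (@adj G) 2 1 0 -> embeds wounded G.
Proof.
case=> t1 [[|a [|a' [|? ?]]] [t2 [[|b [|? ?]] [t3 [[|? ?] [+ [//= _ _ _]]]]]]].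
case=> -[+ + +] [+ + +] [+ + +] [+ + +]; unpack.
exists (fun i => nth t1 [:: t1; t2; t3; a; b; a'] (val i)); apply: embeds_seq; pairs.
Qed.

Lemma path_embeds z r : ipath (@adj G) z r -> size r = 5 -> embeds (pathG 6) G.
Proof.
case: r => [|a [|b [|c [|d [|e [|? ?]]]]]] + // _; unpack.
exists (fun i => nth z [:: z; a; b; c; d; e] (val i)); apply: embeds_seq; pairs.
Qed.

Lemma two_connected_adj : k_connected 2 G -> two_connected (@adj G).
Proof.
case=> lt H; split=> // w x y xw yw.
have [|_ co] := H [set w]; first by rewrite cards1.
have inX a : a != w -> a \in ~: [set w] by rewrite !inE.
pose a : induced (~: [set w]) := exist _ x (inX x xw).
have /connectP[p pp E] := co a (exist _ y (inX y yw)).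
apply/connectP; exists (map val p); last first.
  by rewrite -[x]/(val a) last_map -E.
rewrite -[x]/(val a); elim: p a pp {E} => //= b p IH a /andP[ab /IH ->].
rewrite andbT; move: ab; rewrite /= /induced_adj => ->.
by have := valP a; have := valP b; rewrite !inE => -> ->.
Qed.

Theorem patterns : k_connected 2 G -> f_heavy claw G -> ~ hamiltonian G ->
  [/\ embeds net G, embeds wounded G & embeds (pathG 6) G].
Proof.
move=> tc fh nh.
have [t1 t2 [z [r [ip sz]]]] := nonham_patterns (@adj_sym G) (@adj_irrefl G)
  (claw_heavy_adj fh) (two_connected_adj tc) nh.
by split; [apply: net_embeds|apply: wounded_embeds|apply: path_embeds ip sz].
Qed.

End Patterns.

Definition subpattern n (E : seq (nat * nat)) n' (E' : seq (nat * nat)) (h : seq nat) :=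
  [&& size h == n, uniq h, all (fun i => i < n') h &
    all (fun i => all (fun j => edge_in E' (nth 0 h i) (nth 0 h j) == edge_in E i j)
      (iota 0 n)) (iota 0 n)].

Lemma subpattern_embeds n E n' E' h : subpattern n E n' E' h ->
  embeds (edge_list_graph n E) (edge_list_graph n' E').
Proof.
case/and4P=> /eqP szh uh /allP hn /allP H.
have hi (i : 'I_n) : nth 0 h i < n' by apply/hn/mem_nth; rewrite szh.
exists (fun i => Ordinal (hi i) : edge_list_graph n' E'); split=> i j.
  by move=> [] /eqP; rewrite nth_uniq ?szh // => /eqP/val_inj.
have it (k : 'I_n) : val k \in iota 0 n by rewrite mem_iota /=.
by have /allP/(_ _ (it j))/eqP := H _ (it i).
Qed.

Lemma patterns_sufficient (S G : sgraph) :
  [\/ [\/ isomorphic S (pathG 4), isomorphic S (pathG 5) | isomorphic S (pathG 6)],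
      [\/ isomorphic S C3, isomorphic S (Z 1) | isomorphic S (Z 2)]
    | [\/ isomorphic S bull, isomorphic S net | isomorphic S wounded]] ->
  k_connected 2 G -> f_heavy claw G -> is_free S G -> hamiltonian G.
Proof.
move=> iso tc fh fr; apply: NNPP => nh; apply: embeds_not_free fr.
have [en ew ep] := patterns tc fh nh.
have sub n E n' E' h : embeds (edge_list_graph n' E') G ->
    isomorphic S (edge_list_graph n E) -> subpattern n E n' E' h -> embeds S G.
  move=> eG /isomorphic_embeds eS /subpattern_embeds e.
  exact: embeds_trans eS (embeds_trans e eG).
case: iso => -[] iso.
(* Each list gives the images of the vertices 0, 1, ... of the pattern; the paths lie in [pathG 6],
   [Z 2] in [wounded], and [C3], [Z 1] and [bull] in [net]. *)
- exact: (sub _ _ _ _ [:: 0; 1; 2; 3] ep iso).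
- exact: (sub _ _ _ _ [:: 0; 1; 2; 3; 4] ep iso).
- exact: (sub _ _ _ _ [:: 0; 1; 2; 3; 4; 5] ep iso).
- exact: (sub _ _ _ _ [:: 0; 1; 2] en iso).
- exact: (sub _ _ _ _ [:: 1; 2; 0; 3] en iso).
- exact: (sub _ _ _ _ [:: 1; 2; 0; 3; 5] ew iso).
- exact: (sub _ _ _ _ [:: 0; 1; 2; 3; 4] en iso).
- exact: (sub _ _ _ _ [:: 0; 1; 2; 3; 4; 5] en iso).
- exact: (sub _ _ _ _ [:: 0; 1; 2; 3; 4; 5] ew iso).
Qed.

(** * Necessity *)

Section Search.
Variables (cand : seq nat) (ok : seq nat -> nat -> bool).

Fixpoint search n := if n is n'.+1
  then flatten [seq [seq rcons s v | v <- cand & ok s v] | s <- search n']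
  else [:: [::]].

Lemma searchS n s v : (rcons s v \in search n.+1) =
  [&& s \in search n, v \in cand & ok s v].
Proof.
apply/flatten_mapP/and3P => [[s' ss' /mapP[v']]|[ss vc o]].
  by rewrite mem_filter => /andP[o vc] /rcons_inj[-> ->].
by exists s => //; apply/mapP; exists v; rewrite // mem_filter o.
Qed.

Lemma search_size n s : s \in search n -> size s = n.
Proof.
elim: n s => [|n IH] s; first by rewrite inE => /eqP->.
case/flatten_mapP=> s' ss' /mapP[v' _ ->]; by rewrite size_rcons (IH s').
Qed.
End Search.

Definition copy_ok (a b : rel nat) s v := (v \notin s) &&
  all (fun i => b (nth 0 s i) v == a i (size s)) (iota 0 (size s)).

Definition copies (a b : rel nat) cand n := search cand (copy_ok a b) n.

Lemma copiesP a b cand n s : reflect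
  [/\ size s = n, uniq s, {subset s <= cand} &
      forall i j, i < j -> j < n -> b (nth 0 s i) (nth 0 s j) = a i j]
  (s \in copies a b cand n).
Proof.
rewrite /copies; elim: n s => [|n IH] s.
  rewrite inE; apply: (iffP eqP) => [->|[/size0nil]] //; by split.
case: (lastP s) => [|s' v].
  by apply: (iffP idP) => [/search_size|[]].
rewrite searchS size_rcons rcons_uniq; apply: (iffP and3P).
  case=> /IH[sz us sc H] vc /andP[vs /allP al]; rewrite sz vs us; split=> //.
    by move=> x; rewrite mem_rcons inE => /orP[/eqP->|/sc].
  move=> i j ij; rewrite ltnS leq_eqVlt !nth_rcons sz => /orP[/eqP jn|jn].
    subst j; rewrite ij ltnn eqxx -sz; apply/eqP/al.
    by rewrite mem_iota sz.
  by rewrite jn (ltn_trans ij jn); apply: H.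
case=> -[sz] /andP[vs us] sc H; split.
- apply/IH; split=> // [x xs|i j ij jn]; first by apply: sc; rewrite mem_rcons inE xs orbT.
  have := H i j ij (ltnW jn); rewrite !nth_rcons sz jn (ltn_trans ij jn) //.
- by apply: sc; rewrite mem_rcons mem_head.
- rewrite /copy_ok vs /=; apply/allP => i; rewrite mem_iota sz /= => ilt; apply/eqP.
  by have := H i n ilt (leqnn _); rewrite !nth_rcons sz ilt ltnn eqxx.
Qed.

Definition numbering (S : sgraph) m E (h : S -> nat) :=
  [/\ injective h, forall x, h x < m & forall x y, edge_in E (h x) (h y) = adj x y].

Lemma embeds_numbering (S : sgraph) m E : embeds S (edge_list_graph m E) -> exists h, @numbering S m E h.
Proof.
case=> f [fi fa]; exists (fun x => val (f x)); split.
- by move=> x y /val_inj/fi.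
- by move=> x; apply: ltn_ord.
- by move=> x y; apply: fa.
Qed.

Lemma numbering_copies (S : sgraph) m E (h : S -> nat) (a : rel nat) (x0 : S) (xs : seq S) :
  numbering m E h -> uniq xs ->
  (forall i j, i < j -> j < size xs -> a i j = adj (nth x0 xs i) (nth x0 xs j)) ->
  map h xs \in copies a (edge_in E) (iota 0 m) (size xs).
Proof.
move=> [hi hm ha] us H; apply/copiesP; split.
- by rewrite size_map.
- by rewrite map_inj_uniq.
- by move=> _ /mapP[x _ ->]; rewrite mem_iota /= hm.
- move=> i j ij jn; rewrite !(nth_map x0) ?(ltn_trans ij jn) //.
  by rewrite ha H.
Qed.

Lemma claw_free m E : nilp (copies (edge_in [:: (0, 1); (0, 2); (0, 3)]) (edge_in E) (iota 0 m) 4) ->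
  f_heavy claw (edge_list_graph m E).
Proof.
move=> none A iso; have /embeds_numbering[h nh] : embeds claw (edge_list_graph m E).
  by apply: not_free_embeds => /(_ (ex_intro _ A iso)).
have := @numbering_copies claw m E h (edge_in [:: (0, 1); (0, 2); (0, 3)]) ord0
  (enum 'I_4) nh (enum_uniq _).
rewrite size_enum_ord (nilP none) in_nil => H u v _; exfalso.
apply: notF; apply: H => i j ij jn.
by rewrite /= /edge_list_adj -val_eqE /= !nth_enum_ord // (ltn_trans ij).
Qed.

Section Growth.
Variables (a : rel nat) (dom : seq nat).

Definition grow (r : seq nat) := [seq i <- dom | (i \in r) || has (fun j => a j i) r].

Definition reached k := iter k grow [:: head 0 dom].

Definition closed_in (r : seq nat) := all (fun i => all (fun j => a i j ==> (j \in r)) dom) r.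
End Growth.

Lemma reached_connect (G : sgraph) (h : G -> nat) a dom k x0 :
  (forall x y, a (h x) (h y) = adj x y) -> injective h ->
  (forall i, i \in dom -> exists x, h x = i) -> h x0 = head 0 dom ->
  forall x, h x \in reached a dom k -> connect adj x0 x.
Proof.
move=> ha hi hd h0; elim: k => [|k IH] x /=.
  by rewrite inE -h0 => /eqP/hi->.
rewrite mem_filter => /andP[/orP[/IH//|/hasP[j jr aj]] _].
have [y hy] : exists y, h y = j.
  case: k jr {IH} => [|k] /=; first by rewrite inE => /eqP->; exists x0.
  by rewrite mem_filter => /andP[_ /hd].
apply: connect_trans (IH y _) (connect1 _); first by rewrite hy.
by rewrite -ha hy.
Qed.

(** The value [w = m] deletes no vertex and stands for the empty set; the other values delete one
    vertex each. *)
Definition biconnected_check m E := all (fun w =>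
  let dom := [seq i <- iota 0 m | i != w] in
  all (mem (reached (edge_in E) dom m)) dom) (iota 0 m.+1).

Lemma biconnected m E : 2 < m -> biconnected_check m E -> k_connected 2 (edge_list_graph m E).
Proof.
move=> m2 /allP chk; split; first by rewrite card_ord.
move=> X X2; have [w wm Xw] : exists2 w, w < m.+1 & forall i : 'I_m, (i \in ~: X) = (val i != w).
  case: (posnP #|X|) => [/eqP|X0].
    rewrite cards_eq0 => /eqP->; exists m => // i.
    by rewrite !inE neq_ltn ltn_ord.
  have /cards1P[w ->] : #|X| == 1 by rewrite eqn_leq X0 -ltnS X2.
  by exists (val w); [rewrite ltnW // ltnS ltn_ord|move=> i; rewrite !inE].
have wi : w \in iota 0 m.+1 by rewrite mem_iota.
have {}chk := chk _ wi.
set dom := [seq i <- iota 0 m | i != w] in chk.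
pose h (x : induced (~: X : {set edge_list_graph m E})) : nat := val (val x).
have hd i : i \in dom -> exists x, h x = i.
  rewrite mem_filter mem_iota /= add0n => /andP[iw im].
  have iX : Ordinal im \in ~: X by rewrite Xw.
  by exists (exist _ (Ordinal im) iX).
have hdom x : h x \in dom.
  by rewrite mem_filter mem_iota -Xw (valP x) /= add0n ltn_ord.
have hi : injective h by move=> x y /val_inj/val_inj.
have d0 : head 0 dom \in dom.
  suff : has (predC1 w) (iota 0 m) by rewrite has_filter -/dom; case: dom {chk hd hdom} => //= ? ? _; rewrite mem_head.
  apply/hasP; exists (w == 0 : nat); first by rewrite mem_iota; case: (w == 0) m2; lia.
  by rewrite /=; case: (w).
have [x0 h0] := hd _ d0.
have con x : connect adj x0 x.
  apply: (reached_connect (h := h) (a := edge_in E) (dom := dom) (k := m)) => //.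
  by apply: (allP chk).
split; first by apply/card_gt0P; exists x0.
move=> x y; apply: connect_trans (con y).
by rewrite (sym_connect_sym (@adj_sym _)).
Qed.

(** A Hamiltonian cycle can be rotated to start at 0, so only paths from 0 are enumerated. *)
Definition cycle_ok (a : rel nat) s v := (v \notin s) &&
  (if s is _ :: _ then a (last 0 s) v else v == 0).

Lemma no_hamilton_cycle m E : 0 < m ->
  all (fun s => ~~ edge_in E (last 0 s) 0) (search (iota 0 m) (cycle_ok (edge_in E)) m) ->
  ~ hamiltonian (edge_list_graph m E).
Proof.
move=> m0 /allP none [c [uc _ cov]].
have [i s rE] := rot_to (cov (Ordinal m0)).
move: uc; rewrite -(rot_ucycle i) rE => /andP[pc uc].
have sz : size (0 :: map val s) = m.
  have -> : 0 :: map val s = map val (Ordinal m0 :: s) by [].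
  rewrite size_map -(card_uniqP uc) -[RHS]card_ord; apply: eq_card => x.
  by rewrite -rE mem_rot cov.
move: pc; rewrite /= rcons_path => /andP[pc lc].
have : 0 :: map val s \in
    search (iota 0 m) (cycle_ok (edge_in E)) (size (0 :: map val s)).
  move: uc pc; clear; elim/last_ind: s => [|s v IH].
    by rewrite -[0 :: _]/(rcons [::] 0) size_rcons searchS /= mem_iota m0.
  rewrite -rcons_cons rcons_uniq rcons_path => /andP[vs us] /andP[ps ev].
  rewrite map_rcons -rcons_cons size_rcons searchS IH // mem_iota ltn_ord /=.
  have h : \val v \notin map val (Ordinal m0 :: s) by rewrite (mem_map val_inj).
  by rewrite /cycle_ok h /=; move: ev; rewrite -[0]/(val (Ordinal m0)) last_map.
rewrite sz.
move/none; rewrite /= -[0]/(val (Ordinal m0)) last_map.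
by move=> /negP; apply; apply: lc.
Qed.

Fixpoint subseqs (s : seq nat) :=
  if s is x :: s' then subseqs s' ++ map (cons x) (subseqs s') else [:: [::]].

Lemma filter_subseqs p s : filter p s \in subseqs s.
Proof.
elim: s => //= x s IH; rewrite mem_cat; case: (p x); last by rewrite IH.
by rewrite map_f ?orbT.
Qed.

(* Triangles on a = 0, 1, 2 and b = 3, 4, 5; with c = 6, 7, 8, the vertices a_i and b_i are
   joined by a triangle a_i b_i c_i in [P_TTT] and by a path a_i c_i b_i in [P_333]. *)
Definition triangles := [:: (0, 1); (1, 2); (2, 0); (3, 4); (4, 5); (5, 3)].
Definition P_TTT := triangles ++
  [:: (0, 3); (3, 6); (6, 0); (1, 4); (4, 7); (7, 1); (2, 5); (5, 8); (8, 2)].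
Definition P_333 := triangles ++ [:: (0, 6); (6, 3); (1, 7); (7, 4); (2, 8); (8, 5)].

Lemma P_TTT_spec : [/\ k_connected 2 (edge_list_graph 9 P_TTT),
  f_heavy claw (edge_list_graph 9 P_TTT) & ~ hamiltonian (edge_list_graph 9 P_TTT)].
Proof. by split; [apply: biconnected|apply: claw_free|apply: no_hamilton_cycle]; vm_compute. Qed.

Lemma P_333_spec : [/\ k_connected 2 (edge_list_graph 9 P_333),
  f_heavy claw (edge_list_graph 9 P_333) & ~ hamiltonian (edge_list_graph 9 P_333)].
Proof. by split; [apply: biconnected|apply: claw_free|apply: no_hamilton_cycle]; vm_compute. Qed.

(** The path on three vertices heads the list because it occurs in both test graphs;
    [patterns_necessary] discards it by hypothesis. *)
Definition targets : seq (nat * seq (nat * nat)) :=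
  let P i := (i, [seq (j, j.+1) | j <- iota 0 i.-1]) in
  let Z i := (i + 3, triangle ++ [seq (j, j.+1) | j <- iota 2 i]) in
  [:: P 3; P 4; P 5; P 6; (3, triangle); Z 1; Z 2; (5, triangle ++ [:: (0, 3); (1, 4)]);
      (6, triangle ++ [:: (0, 3); (1, 4); (2, 5)]);
      (6, triangle ++ [:: (0, 3); (3, 5); (1, 4)])].

(** The test [closed_in] makes a positive answer sound for every number [k] of rounds; five rounds
    are enough for [all_classified]. *)
Definition disconnected_on a dom k :=
  closed_in a dom (reached a dom k) && ~~ all (mem (reached a dom k)) dom.

Definition restrict (a : rel nat) dom i j := a (nth 0 dom i) (nth 0 dom j).

(* Induced subgraphs of [P_TTT] that do not occur in [P_333]: the three 4-cycles
   and the six bowties, then a triangle with two isolated vertices, three times. *)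
Definition obstructions := [::
  [:: 0; 1; 3; 4]; [:: 0; 2; 3; 5]; [:: 1; 2; 4; 5];
  [:: 0; 1; 2; 3; 6]; [:: 0; 1; 2; 4; 7]; [:: 0; 1; 2; 5; 8];
  [:: 0; 3; 4; 5; 6]; [:: 1; 3; 4; 5; 7]; [:: 2; 3; 4; 5; 8];
  [:: 0; 3; 6; 7; 8]; [:: 1; 4; 6; 7; 8]; [:: 2; 5; 6; 7; 8]].

Lemma obstructions_absent : all (fun o =>
  uniq o && nilp (copies (restrict (edge_in P_TTT) o) (edge_in P_333) (iota 0 9) (size o)))
  obstructions.
Proof. by vm_compute. Qed.

(* Nested conditionals, because [vm_compute] evaluates both arguments of [||]. *)
Definition classified E h :=
  if size h < 3 then true else if has (all (mem h)) obstructions then true else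
  if disconnected_on (edge_in E) h 5 then true else
  has (fun t => if t.1 == size h then ~~ nilp (copies (edge_in t.2) (edge_in E) h t.1) else false)
    targets.

Lemma all_classified : all (classified P_TTT) (subseqs (iota 0 9)).
Proof. by vm_compute. Qed.

Lemma head_reached a dom k : dom != [::] -> head 0 dom \in reached a dom k.
Proof.
move=> d0; elim: k => [|k IH] /=; first exact: mem_head.
by rewrite mem_filter IH /=; case: (dom) d0 => //= x s _; apply: mem_head.
Qed.

Section Classification.
Variables (S : sgraph) (m : nat) (E : seq (nat * nat)) (h : S -> nat) (dom : seq nat).
Hypothesis nh : numbering m E h.
Hypothesis domP : forall i, reflect (exists x, h x = i) (i \in dom).

Lemma not_disconnected k : connected S -> ~~ disconnected_on (edge_in E) dom k.
Proof.
case=> /card_gt0P[z _] co; rewrite negb_and negbK; apply/orP.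
have [/allP cl|_] := boolP (closed_in _ _ _); [right|by left].
have [hi _ ha] := nh.
have d0 : dom != [::].
  by have /domP : exists x, h x = h z by [exists z]; case: (dom).
have := head_reached (edge_in E) k d0; set r := reached _ _ _ in cl *.
have /domP[x0 <-] : head 0 dom \in dom by case: (dom) d0 => //= ? ? _; apply: mem_head.
move=> x0r; apply/allP => _ /domP[x <-] /=.
have /connectP[p pp ->] := co x0 x.
elim: p (x0) x0r pp => //= y p IH w wr /andP[wy]; apply: IH.
have yd : h y \in dom by apply/domP; exists y.
by have := allP (cl _ wr) _ yd; rewrite /= ha wy.
Qed.

Lemma copy_isomorphic n E' s : size dom = n ->
  s \in copies (edge_in E') (edge_in E) dom n -> isomorphic S (edge_list_graph n E').
Proof.
move=> sd /copiesP[sz us sub H]; have [hi _ ha] := nh.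
have sE : s =i dom by have [] := uniq_min_size us sub; rewrite ?sd ?sz.
apply: isomorphic_sym.
have ex (i : 'I_n) : exists x, h x == nth 0 s i.
  have /sub/domP[x hx] : nth 0 s i \in s by rewrite mem_nth ?sz ?ltn_ord.
  by exists x; apply/eqP.
pose f (i : edge_list_graph n E') := xchoose (ex i).
have hf i : h (f i) = nth 0 s (val i) by apply/eqP/(xchooseP (ex i)).
have fi : injective f.
  by move=> i j /(congr1 h); rewrite !hf => /eqP; rewrite nth_uniq ?sz ?ltn_ord // => /eqP/val_inj.
exists f.
  apply: inj_card_bij => //; rewrite card_ord -sz cardE -(size_map h).
  apply: uniq_leq_size; first by rewrite map_inj_uniq ?enum_uniq.
  by move=> _ /mapP[x _ ->]; rewrite sE; apply/domP; exists x.
move=> i j; rewrite -ha !hf.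
case: (ltngtP (val i) (val j)) => [ij|ij|/val_inj->].
- by rewrite H ?ltn_ord.
- by rewrite edge_in_sym H ?ltn_ord //; apply: edge_in_sym.
- by rewrite /= /edge_list_adj /edge_in !eqxx.
Qed.

Lemma absent_subset E' o : {subset o <= dom} -> uniq o ->
  nilp (copies (restrict (edge_in E) o) (edge_in E') (iota 0 m) (size o)) ->
  o != [::] -> ~ embeds S (edge_list_graph m E').
Proof.
move=> od uo no o0 /embeds_numbering[h' nh'].
have /map_preim E2 : {subset o <= codom h} by move=> i /od/domP[x <-]; apply: codom_f.
set xs := preim_seq h o in E2.
have uxs : uniq xs by apply: (@map_uniq _ _ h); rewrite E2.
have szx : size xs = size o by rewrite -E2 size_map.
have [x0 _] : exists x : S, x \in xs.
  by case: (xs) szx => [|x ? _]; [case: (o) o0|exists x; rewrite mem_head].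
have := numbering_copies (a := restrict (edge_in E) o) (x0 := x0) nh' uxs.
rewrite szx (nilP no) in_nil => H; apply: notF; apply: H => i j ij jn.
have [_ _ ha] := nh; rewrite -ha /restrict -E2 !(nth_map x0) ?szx //.
exact: ltn_trans ij jn.
Qed.

End Classification.

Lemma classification (S : sgraph) h dom : numbering 9 P_TTT h ->
  (forall i, reflect (exists x : S, h x = i) (i \in dom)) ->
  connected S -> 2 < #|S| -> embeds S (edge_list_graph 9 P_333) -> classified P_TTT dom ->
  exists2 t, t \in targets & isomorphic S (edge_list_graph t.1 t.2).
Proof.
move=> nh domP co S3 eS; rewrite /classified; case: ifP => [+ _|_].
  rewrite ltnNge; case/negP; apply: leq_trans S3 _; rewrite cardE -(size_map h).
  have [hi _ _] := nh; apply: uniq_leq_size; first by rewrite map_inj_uniq ?enum_uniq.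
  by move=> _ /mapP[x _ ->]; apply/domP; exists x.
case: ifP => [/hasP[o oO /allP od] _|_].
  have /andP[uo no] := allP obstructions_absent _ oO.
  case: (absent_subset nh domP od uo no _ eS).
  by apply: contraTneq oO => ->; vm_compute.
case: ifP => [dis _|_]; first by case/negP: (not_disconnected nh domP 5 co).
case/hasP=> t tT; case: ifP => // /eqP sz.
rewrite /nilp -lt0n -has_predT => /hasP[s ss _]; exists t => //.
exact: (copy_isomorphic nh domP (esym sz) ss).
Qed.


Lemma patterns_necessary (S : sgraph) : connected S -> 2 < #|S| -> ~ isomorphic S (pathG 3) ->
  (forall G : sgraph, k_connected 2 G -> f_heavy claw G -> is_free S G -> hamiltonian G) ->
  [\/ [\/ isomorphic S (pathG 4), isomorphic S (pathG 5) | isomorphic S (pathG 6)],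
      [\/ isomorphic S C3, isomorphic S (Z 1) | isomorphic S (Z 2)]
    | [\/ isomorphic S bull, isomorphic S net | isomorphic S wounded]].
Proof.
move=> co S3 nP3 forced.
have emb E : k_connected 2 (edge_list_graph 9 E) -> f_heavy claw (edge_list_graph 9 E) ->
    ~ hamiltonian (edge_list_graph 9 E) -> embeds S (edge_list_graph 9 E).
  by move=> tc fh nh; apply: not_free_embeds => /(forced _ tc fh).
have [t1 f1 n1] := P_TTT_spec; have /embeds_numbering[h nh] := emb _ t1 f1 n1.
have [t2 f2 n2] := P_333_spec; have e2 := emb _ t2 f2 n2.
pose dom := [seq i <- iota 0 9 | [exists x, h x == i]].
have domP i : reflect (exists x, h x = i) (i \in dom).
  apply: (iffP idP); first by rewrite mem_filter => /andP[/existsP[x /eqP <-]]; exists x.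
  case=> x <-; rewrite mem_filter mem_iota /=; have [_ -> _] := nh; rewrite andbT.
  by apply/existsP; exists x.
have cl := allP all_classified _ (filter_subseqs _ _ : dom \in _).
have [t] := classification nh domP co S3 e2 cl.
rewrite !inE => tT iso; move: tT.
by do ?[case/predU1P => [tE|]]; last (move=> /eqP tE); subst t => //;
  first [by case: nP3 | by apply: Or31; first [by apply: Or31|by apply: Or32|by apply: Or33]
   | by apply: Or32; first [by apply: Or31|by apply: Or32|by apply: Or33]
   | by apply: Or33; first [by apply: Or31|by apply: Or32|by apply: Or33]].
Qed.

(** The order bound excludes the complete graphs on one and two vertices: every 2-connected graph
    contains them, so for them the implication holds vacuously. *)
Theorem corollary3 (S : sgraph) (S_connected : connected S)
    (S_order : 3 <= #|S|) (S_neq_P3 : ~ isomorphic S (pathG 3)) :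
  (forall G : sgraph, k_connected 2 G -> f_heavy claw G -> is_free S G ->
     hamiltonian G)
  <->
  [\/ [\/ isomorphic S (pathG 4), isomorphic S (pathG 5)
        | isomorphic S (pathG 6)],
      [\/ isomorphic S C3, isomorphic S (Z 1) | isomorphic S (Z 2)]
    | [\/ isomorphic S bull, isomorphic S net | isomorphic S wounded]].
Proof.
split; first exact: patterns_necessary.
by move=> iso G; apply: patterns_sufficient.
Qed.
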